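(* Consider a sequence of $n\times n$ input-queued switches, $n=1,2,\dots$, under uniform Bernoulli traffic with mean arrival rate matrix $\boldsymbol\lambda=\frac{1-\epsilon(n)}n\mathbf 1$, where $\epsilon(n)\in(0,1)$ and $\epsilon(n)=\Theta(n^{-\beta})$. Then $$\lim_{n\to\infty}\frac{\epsilon(n)}n\,\mathbb E\Big[\sum_{i,j}\bar q_{ij}\Big]=1\qquad(\ast)$$ holds in each of the following cases: (i) under algorithms in the class $\Pi_1(\frac1n\mathbf 1)$, for $\beta>3+\alpha_1$, where the constant $W_1=W_1(n)$ of the class satisfies $1/W_1=O(n^{\alpha_1})$. In particular, the power-of-$d$ ($d\ge2$) and random $d$-flip ($d\ge1$) algorithms satisfy $(\ast)$ for $\beta>6$. (ii) under algorithms in the class $\Pi_2$, for $\beta>2+\max\{\alpha_2,2\}$, where the constant $W_2=W_2(n)$ of the class satisfies $W_2=O(n^{\alpha_2})$. In particular, the bursty MaxWeight and pipelined MaxWeight algorithms with parameter $m=m(n)=O(n^\gamma)$ satisfy $(\ast)$ for $\beta>3+\max\{\gamma,1\}$.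
   Context: Switch model. For each $n$; time slots are $t=0,1,2,\dots$. $\mathbf q(t)\in\mathbb Z_{\ge0}^{n\times n}$ is the queue length matrix, $\mathbf a(t)$ the arrival matrix, and the schedule $\mathbf s(t)$ is an element of the set $\mathcal X$ of $n\times n$ permutation matrices, picked in each slot by a (possibly randomized) scheduling algorithm. The evolution is $q_{ij}(t+1)=\max\{0,\,q_{ij}(t)+a_{ij}(t)-s_{ij}(t)\}$. $\langle\cdot,\cdot\rangle$, $\|\cdot\|$ are the Frobenius inner product and norm; $\mathbf 1$ is the $n\times n$ all-ones matrix. $\tilde{\mathcal H}_t=\{\mathbf q(0),\mathbf s(0),\dots,\mathbf s(t-1),\mathbf q(t),\mathbf s(t)\}$. The exponent satisfies $\beta>0$. Uniform Bernoulli traffic with parameter $\epsilon$: the $a_{ij}(t)$ are independent over $i,j,t$, Bernoulli with mean $(1-\epsilon)/n$, and $\mathbf a(t)$ is independent of $\tilde{\mathcal H}_t$. Markov chain. It is assumed that there is a process $X(t)$ associated with the switch forming a Markov chain on a countable state space. A.1: $X(t)$ is $\sigma(\tilde{\mathcal H}_t)$-measurable, irreducible and aperiodic. A.2: there is $g$ with $\mathbf q(t)=g(X(t))$ and $g^{-1}(\mathcal A)$ finite for every finite $\mathcal A\subset\mathbb Z^{n\times n}$. (By convention state spaces are restricted to the communicating class reachable from the empty system.) $\bar{\mathbf q}$ is the steady-state limit in distribution of $\mathbf q(t)$, in the $n$-th system with $\epsilon=\epsilon(n)$. Cone. $\mathcal S=\{\mathbf x\in\mathbb R^{n\times n}: x_{ij}=w_i+\tilde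 w_j \text{ for some } w,\tilde w\in\mathbb R^n\}$, $\mathcal K=\mathcal S\cap\mathbb R_{\ge0}^{n\times n}$; $\mathbf x_{\|\mathcal K}$ is the Euclidean projection of $\mathbf x$ onto $\mathcal K$, $\mathbf x_{\perp\mathcal K}=\mathbf x-\mathbf x_{\|\mathcal K}$. Classes. $\Pi_1(\boldsymbol\nu)$: $X(t)$ satisfies A.1, A.2 and there is $W_1>0$, independent of $\epsilon$, with $\mathbb E[\langle\mathbf q(t),\mathbf s(t)\rangle\mid X(t)=X]\ge\langle\mathbf q,\boldsymbol\nu\rangle+W_1\|\mathbf q_{\perp\mathcal K}\|$ for all $t\ge0$ and all $X$, where $\mathbf q=g(X)$. $\Pi_2$: $X(t)$ satisfies A.1, A.2 and there is $W_2\ge0$, independent of $\epsilon$, with $\mathbb E[\langle\mathbf q(t),\mathbf s(t)\rangle\mid X(t)=X]\ge\max_{\mathbf s\in\mathcal X}\langle\mathbf q,\mathbf s\rangle-W_2$ for all $t\ge0$ and all $X$, where $\mathbf q=g(X)$. Algorithms. Power-of-$d$: in slot $t$, sample $d$ schedules independently and uniformly from $\mathcal X$ (with replacement), independently of the past, and use the one with largest weight $\langle\mathbf q(t),\cdot\rangle$. Flip step on $\mathbf s_1$ given $\mathbf q$: sample two distinct index pairs $(i,j),(k,l)$ uniformly among those with $s_{1,ij}=s_{1,kl}=1$; let $\mathbf s_2$ equal $\mathbf s_1$ except $s_{2,ij}=s_{2,kl}=0$, $s_{2,il}=s_{2,kj}=1$; output whichever of $\mathbf s_1,\mathbf s_2$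 has larger weight $\langle\mathbf q,\cdot\rangle$. Random $d$-flip ($n\ge2$): in slot $t$, sample a schedule uniformly from $\mathcal X$ and apply the flip step (with $\mathbf q=\mathbf q(t)$) $d$ times consecutively with fresh randomness. A MaxWeight schedule for $\mathbf q$ maximizes $\langle\mathbf q,\mathbf s\rangle$ over $\mathcal X$ (ties broken by a fixed rule). Bursty MaxWeight: the MaxWeight schedule is computed every $m$ slots and used for $m$ consecutive slots; a counter of slots since the last computation is kept (a new computation is made when it is $0$), and it is reset to $0$ whenever $\mathbf q(t)=\mathbf 0$. Pipelined MaxWeight: $\mathbf s(t)$ is a MaxWeight schedule for $\mathbf q(t-m)$ (for $\mathbf q(0)$ if $t<m$). *)

(* Defs.v *)
From HB Require Import structures.
From mathcomp Require Export all_boot all_order all_algebra all_fingroup.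
From mathcomp Require Export all_classical all_reals all_analysis.

Set Implicit Arguments.
Unset Strict Implicit.
Unset Printing Implicit Defensive.

Import Order.TTheory GRing.Theory Num.Theory.
Import numFieldNormedType.Exports.

Local Open Scope classical_set_scope.
Local Open Scope ring_scope.

Section Geometry.
Variables (R : realType) (n : nat).
Implicit Types (x y : 'M[R]_n) (q : 'M[nat]_n) (s : 'S_n).

Definition frob x y : R := \sum_i \sum_j x i j * y i j.
Definition frob_norm x : R := Num.sqrt (frob x x).

Definition real_mx q : 'M[R]_n := map_mx (fun k : nat => k%:R) q.

(* A schedule is a permutation [s], standing for the permutation matrix
   [perm_mx s], whose entry (i, j) is 1 when [s i = j] and 0 otherwise. *)
Definition weight q s : R := frob (real_mx q) (perm_mx s).

Definition max_weight q : R :=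
  \big[Num.max/0]_(s : 'S_n) weight q s.

Definition coneS : set 'M[R]_n :=
  [set x | exists w w' : 'I_n -> R, forall i j, x i j = w i + w' j].

Definition coneK : set 'M[R]_n :=
  [set x | coneS x /\ forall i j, 0 <= x i j].

(* The nearest point of [coneK]; it exists and is unique, as [coneK] is a
   nonempty closed convex set, so the default value 0 is never used. *)
Definition projK x : 'M[R]_n :=
  xget 0 [set y | coneK y /\
    forall z, coneK z -> frob_norm (x - y) <= frob_norm (x - z)].

Definition perpK x : 'M[R]_n := x - projK x.

Definition is_maxweight_rule (mw : 'M[nat]_n -> 'S_n) : Prop :=
  forall q s, weight q s <= weight q (mw q).

(* [ch q ss] selects a schedule of largest weight in the list [ss]; ties are
   resolved in an arbitrary but fixed way. *)
Definition is_heaviest_choice (ch : 'M[nat]_n -> seq 'S_n -> 'S_n) : Prop :=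
  forall q (ss : seq 'S_n), ss != [::] ->
    ch q ss \in ss /\ {in ss, forall s, weight q s <= weight q (ch q ss)}.

End Geometry.

Section DiscreteProbability.
Context {R : realType} {d : measure_display} {T : measurableType d}.
Variable P : probability T R.

(* Measurability of a map into a countable set with all subsets measurable. *)
Definition discrete_rv (U : Type) (Y : T -> U) : Prop :=
  forall u, measurable (Y @^-1` [set u]).

Definition mutually_independent (I : eqType) (U : Type) (Y : I -> T -> U) :=
  forall (J : seq I) (v : I -> U), uniq J ->
    P (\bigcap_(k in [set` J]) (Y k @^-1` [set v k])) =
    (\prod_(k <- J) P (Y k @^-1` [set v k]))%E.

(* E[Y | A], for P A <> 0. *)
Definition cond_expectation (Y : T -> R) (A : set T) : R :=
  (\int[P]_(w in A) Y w)%R / fine (P A).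

End DiscreteProbability.

Section MarkovChain.
Context {R : realType} {d : measure_display} {T : measurableType d}.
Variables (P : probability T R) (St : countType).
Implicit Types (X : nat -> T -> St) (p : St -> St -> R).

Definition stochastic p : Prop :=
  (forall x y, 0 <= p x y) /\
  (forall x, \esum_(y in [set: St]) (p x y)%:E = 1%E).

Definition markov_chain X p : Prop :=
  [/\ stochastic p,
      forall t, discrete_rv (X t) &
      forall t (x : nat -> St) y,
        P ((\bigcap_(u in [set u | (u <= t)%N]) (X u @^-1` [set x u]))
             `&` X t.+1 @^-1` [set y]) =
        (P (\bigcap_(u in [set u | (u <= t)%N]) (X u @^-1` [set x u]))
             * (p (x t) y)%:E)%E].

Fixpoint kstep p (k : nat) (x y : St) : \bar R :=
  if k is k'.+1 then \esum_(z in [set: St]) ((p x z)%:E * kstep p k' z y)%E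
  else ((x == y)%:R)%:E.

Definition irreducible_chain p : Prop :=
  forall x y, exists k, (0 < kstep p k x y)%E.

(* gcd {k >= 1 : p^k(x, x) > 0} = 1 for all x. *)
Definition aperiodic_chain p : Prop :=
  forall x (c : nat),
    (forall k, (0 < k)%N -> (0 < kstep p k x x)%E -> (c %| k)%N) -> c = 1%N.

End MarkovChain.

Record switch (R : realType) (n : nat) := Switch {
  sw_disp : measure_display;
  sw_T : measurableType sw_disp;
  sw_P : probability sw_T R;
  queue : nat -> sw_T -> 'M[nat]_n;
  arrival : nat -> sw_T -> 'M[nat]_n;
  schedule : nat -> sw_T -> 'S_n;
  queue_rv : forall t, discrete_rv (queue t);
  arrival_rv : forall t, discrete_rv (arrival t);
  schedule_rv : forall t, discrete_rv (schedule t);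
  (* [subn] is truncated, so this is max{0, q + a - s} *)
  queueE : forall t w i j,
    queue t.+1 w i j = (queue t w i j + arrival t w i j - (schedule t w i == j))%N
}.

Section SwitchModel.
Variables (R : realType) (n : nat) (sw : switch R n).
Local Notation T := (sw_T sw).
Local Notation P := (sw_P sw).

(* sigma(q(0), ..., q(t), s(0), ..., s(t' - 1)) *)
Definition info (t t' : nat) : set (set T) :=
  <<s [set A | (exists u m, (u <= t)%N /\ A = queue u @^-1` [set m])
            \/ (exists u s, (u < t')%N /\ A = schedule u @^-1` [set s])] >>.

(* [past t] is what is known when s(t) is about to be chosen, [history t] is
   generated by q(0), s(0), ..., s(t - 1), q(t), s(t). *)
Definition past (t : nat) := info t t.
Definition history (t : nat) := info t t.+1.

Definition uniform_bernoulli (eps : R) : Prop :=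
  [/\ forall t i j,
        P [set w | arrival t w i j = 1%N] = ((1 - eps) / n%:R)%:E /\
        P [set w | arrival t w i j = 0%N] = (1 - (1 - eps) / n%:R)%:E,
      mutually_independent P
        (fun (k : nat * 'I_n * 'I_n) (w : T) => arrival k.1.1 w k.1.2 k.2) &
      forall t (m : 'M[nat]_n) (B : set T), history t B ->
        P (arrival t @^-1` [set m] `&` B) =
        (P (arrival t @^-1` [set m]) * P B)%E].

Definition condA1 (St : countType) (X : nat -> T -> St) : Prop :=
  (forall t x, history t (X t @^-1` [set x])) /\
  exists p : St -> St -> R,
    [/\ markov_chain P X p, irreducible_chain p & aperiodic_chain p].

Definition condA2 (St : countType) (X : nat -> T -> St)
    (g : St -> 'M[nat]_n) : Prop :=
  (forall t (w : T), queue t w = g (X t w)) /\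
  (forall A : set 'M[nat]_n, finite_set A -> finite_set (g @^-1` A)).

(* E[<q(t), s(t)> | X(t) = x] >= bound (g x) for all t and x; the conditional
   expectation is meaningful only when X(t) = x has positive probability. *)
Definition weight_bound (St : countType) (X : nat -> T -> St)
    (g : St -> 'M[nat]_n) (bound : 'M[nat]_n -> R) : Prop :=
  forall t x, P (X t @^-1` [set x]) != 0%E ->
    bound (g x) <=
    cond_expectation P (fun w => weight R (queue t w) (schedule t w))
      (X t @^-1` [set x]).

Definition classPi1 (nu : 'M[R]_n) (W1 : R) : Prop :=
  0 < W1 /\
  exists (St : countType) (X : nat -> T -> St) (g : St -> 'M[nat]_n),
    [/\ condA1 X, condA2 X g &
        weight_bound X g (fun q =>
          frob (real_mx R q) nu + W1 * frob_norm (perpK (real_mx R q)))].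

Definition classPi2 (W2 : R) : Prop :=
  0 <= W2 /\
  exists (St : countType) (X : nat -> T -> St) (g : St -> 'M[nat]_n),
    [/\ condA1 X, condA2 X g &
        weight_bound X g (fun q => max_weight R q - W2)].

(* In slot t, draw xi(t) uniformly from the finite set Xi, independently of
   the past, and use the schedule [rule q(t) xi(t)]. *)
Definition sampled_schedule (Xi : finType)
    (rule : 'M[nat]_n -> Xi -> 'S_n) : Prop :=
  exists xi : nat -> T -> Xi,
    [/\ forall t, discrete_rv (xi t),
        forall t u (B : set T), past t B ->
          P (xi t @^-1` [set u] `&` B) = ((#|Xi|%:R^-1)%:E * P B)%E &
        forall t (w : T), schedule t w = rule (queue t w) (xi t w)].

(* A uniform element of the set of d-tuples is d independent uniform draws. *)
Definition power_of_d (d : nat) (ch : 'M[nat]_n -> seq 'S_n -> 'S_n) : Prop :=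
  sampled_schedule (fun q (ss : d.-tuple 'S_n) => ch q ss).

(* An index pair (i, j) with s_ij = 1 is determined by its row i, with j = s i.
   Hence two distinct such pairs are given by two distinct rows (i, k), and the
   flipped schedule maps i to s k, k to s i and agrees with s elsewhere. *)
Definition row_pair := {r : 'I_n * 'I_n | r.1 != r.2}.

Definition flip (s : 'S_n) (r : row_pair) : 'S_n :=
  (tperm (val r).1 (val r).2 * s)%g.

Definition flip_step (ch : 'M[nat]_n -> seq 'S_n -> 'S_n) (q : 'M[nat]_n)
    (s : 'S_n) (r : row_pair) : 'S_n :=
  ch q [:: s; flip s r].

Definition random_flip (d : nat) (ch : 'M[nat]_n -> seq 'S_n -> 'S_n) : Prop :=
  sampled_schedule (fun q (xi : 'S_n * d.-tuple row_pair) =>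
    foldl (flip_step ch q) xi.1 xi.2).

Fixpoint burst_counter (m t : nat) (w : T) : nat :=
  if t is t'.+1 then
    if queue t w == const_mx 0%N then 0%N
    else ((burst_counter m t' w).+1 %% m)%N
  else 0%N.

Definition bursty_maxweight (m : nat) (mw : 'M[nat]_n -> 'S_n) : Prop :=
  forall t (w : T), schedule t w =
    if burst_counter m t w == 0%N then mw (queue t w) else schedule t.-1 w.

(* [subn] is truncated, so q(0) is used for t < m. *)
Definition pipelined_maxweight (m : nat) (mw : 'M[nat]_n -> 'S_n) : Prop :=
  forall t (w : T), schedule t w = mw (queue (t - m)%N w).

End SwitchModel.

Record random_matrix (R : realType) (n : nat) := RandomMatrix {
  rm_disp : measure_display;
  rm_T : measurableType rm_disp;
  rm_P : probability rm_T R;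
  rm_val : rm_T -> 'M[nat]_n;
  rm_rv : discrete_rv rm_val
}.
Arguments rm_val {R n} r _.

(* Every function on the discrete space of natural matrices is continuous, so
   the test functions of convergence in distribution are the bounded ones. *)
Definition steady_state (R : realType) (n : nat) (sw : switch R n)
    (qbar : random_matrix R n) : Prop :=
  forall f : 'M[nat]_n -> R, (exists M, forall q, `|f q| <= M) ->
    'E_(sw_P sw)[fun w => f (queue t w)]%E @[t --> \oo] -->
    'E_(rm_P qbar)[fun w => f (rm_val qbar w)]%E.

Definition mean_total_queue (R : realType) (n : nat)
    (qbar : random_matrix R n) : \bar R :=
  'E_(rm_P qbar)[fun w => (\sum_i \sum_j (rm_val qbar w i j)%:R)%R]%E.

(* The steady state exists for every n >= n0 (and is unique in law, being a
   limit in distribution), and (eps(n) / n) E[sum_ij qbar_ij] tends to 1. *)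
Definition heavy_traffic_limit (R : realType) (n0 : nat) (eps : nat -> R)
    (sw : forall n, switch R n) : Prop :=
  exists qbar : forall n, random_matrix R n,
    (forall n, (n0 <= n)%N -> steady_state (sw n) (qbar n)) /\
    ((eps n / n%:R)%:E * mean_total_queue (qbar n))%E @[n --> \oo] --> 1%E.

(* Main.v *)
From HB Require Import structures.
Require Import Defs.
From mathcomp Require Import ring lra zify measurable_realfun.

(** All six cases reduce to one statement about a switch whose schedule, in state
[x] with queues [q], has mean weight at least [total q / n + w * |q_perp| - c],
where [q_perp] is the part of [q] off the cone ([switch_model]).

The total queue length is read off from the quadratic form
[frob (parmx q) q], which is [n] times the squared norm of the projection of [q]
onto the space spanned by the cone.  All schedules have the same product with a
matrix of that space, so its one-step drift does not depend on the algorithm: it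
is [- 2 eps * total q], plus the variance of the arrivals seen through the form
([slot_variance]), plus a correction from the service that finds an empty
queue ([one_step_identity]).  In the steady state the drift vanishes, hence
[eps / n * E total] is [slot_variance / (2 n)], which tends to 1, up to the
correction.  A queue that wastes service is empty after the slot, so the
correction is controlled by the product of the unused service, whose mean is
[n * eps] by flow balance, with the distance to the cone
([frob_parmx_unused]).  That distance has moments of every order at the scale
[(n + c) / w] as soon as [eps <= w / 4] ([collapse_moments]); truncating it at
[K = n ^ (a + b + delta)], when [1 / w = O(n ^ a)] and [n + c = O(n ^ b)], leaves an
error of order [K * n * eps], which vanishes for [beta > 1 + a + b]
([heavy_traffic_of_estimates]).

The steady state is produced by a contraction argument in a norm weighted by the
exponential of the queue lengths ([geometric_ergodicity]).  It is kept as a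
functional on functions of controlled growth, which is enough for the moment
computations, and turned into a probability only at the end ([law_matrix]).

What remains is to find [w] and [c] for each algorithm.
- For the class with gain [W1], [w] is [min(W1, 1)] and [c = 0].  Then
  [a = max(alpha1, 0)] and [b = 1], and [beta > 3 + alpha1] suffices because
  [alpha1 >= -1]: the gain is at most [2 n] ([gain_le]).
- MaxWeight has [w = 1 / n] and [c = 0]: by linear programming duality
  ([egervary]) the maximal weight is the value of a cover of [q] by a matrix of
  the cone, and the distance of [q] to that cover is what MaxWeight gains
  ([max_weight_gap]).  The second class loses [W2].  Outdated schedules lose
  [2 n m], as one slot changes a weight by at most [n].
- Power-of-[d] and random flips have [w = 1 / (4 n ^ 4)] and [c = 0]: if flips
  rarely change the weight, then [q] nearly satisfies the linear equations of the
  cone ([flip_gap]).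

The last algorithms and the outdated ones come without a Markov chain; the queues together with the
schedules in use form one ([policy_switch_model]). *)

Set Implicit Arguments.
Unset Strict Implicit.
Unset Printing Implicit Defensive.

Import Order.TTheory GRing.Theory Num.Theory.
Import numFieldNormedType.Exports.

Local Open Scope classical_set_scope.
Local Open Scope ring_scope.

(** * Geometric ergodicity *)

Section MarkovOperators.
Variables (R : realType) (St : Type).
Implicit Types (f h : St -> R) (A : (St -> R) -> St -> R).

(** A Markov kernel seen through its action on functions: the ergodic theory below
only composes and compares expectations, whether they come from sums over a
countable space or from finite mixtures. *)
Record markov_operator A : Prop := MarkovOperator {
  mo_lin : forall c f h x, A (fun y => c * f y + h y) x = c * A f x + A h x;
  mo_le : forall f h, (forall x, f x <= h x) -> forall x, A f x <= A h x;
  mo_cst : forall c x, A (fun=> c) x = c }.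

Section Basics.
Variable A : (St -> R) -> St -> R.
Hypothesis HA : markov_operator A.

Lemma mo_scale c f x : A (fun y => c * f y) x = c * A f x.
Proof.
have -> : (fun y => c * f y) = (fun y => c * f y + (fun=> 0) y).
  by apply/funext => y; rewrite addr0.
by rewrite (mo_lin HA) (mo_cst HA) addr0.
Qed.

Lemma mo_add f h x : A (fun y => f y + h y) x = A f x + A h x.
Proof.
have -> : (fun y => f y + h y) = (fun y => 1 * f y + h y).
  by apply/funext => y; rewrite mul1r.
by rewrite (mo_lin HA) mul1r.
Qed.

Lemma mo_sub f h x : A (fun y => f y - h y) x = A f x - A h x.
Proof.
have -> : (fun y => f y - h y) = (fun y => -1 * h y + f y).
  by apply/funext => y; rewrite mulN1r addrC.
by rewrite (mo_lin HA) mulN1r addrC.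
Qed.

Lemma mo_ge0 f : (forall x, 0 <= f x) -> forall x, 0 <= A f x.
Proof. by move=> f0 x; rewrite -(mo_cst HA 0 x); apply: (mo_le HA). Qed.

Lemma mo_norm f h x : (forall x, `|f x| <= h x) -> `|A f x| <= A h x.
Proof.
move=> fh; rewrite ler_norml; apply/andP; split.
  rewrite lerNl -mulN1r -mo_scale; apply: (mo_le HA) => y.
  by rewrite mulN1r; have := fh y; rewrite ler_norml lerNl => /andP[].
by apply: (mo_le HA) => y; have := fh y; rewrite ler_norml => /andP[].
Qed.

Lemma markov_iter t : markov_operator (iter t A).
Proof.
elim: t => [|t IH]; first by split.
split.
- move=> c f h x /=.
  rewrite (_ : iter t A _ = fun y => c * iter t A f y + iter t A h y).
    by rewrite (mo_lin HA).
  by apply/funext => y; rewrite (mo_lin IH).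
- by move=> f h fh x; apply: (mo_le HA); exact: (mo_le IH).
- move=> c x /=; rewrite (_ : iter t A _ = fun=> c) ?(mo_cst HA)//.
  by apply/funext => y; rewrite (mo_cst IH).
Qed.

End Basics.

(** A geometric drift inequality iterates to a bound that is uniform in time:
the additive constants form a geometric series. *)
Lemma drift_iter A (W : St -> R) (r K : R) t x : markov_operator A ->
  0 <= r < 1 -> 0 <= K -> (forall x, A W x <= r * W x + K) ->
  iter t A W x <= r ^+ t * W x + K / (1 - r).
Proof.
move=> HA /andP[r0 r1] K0 drift.
have r1' : 0 < 1 - r by rewrite subr_gt0.
elim: t => [|t IH].
  by rewrite expr0 mul1r /= lerDl divr_ge0 // ltW.
rewrite iterSr.
have HAt := markov_iter HA t.
apply: (le_trans (mo_le HAt drift x)).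
rewrite (mo_lin HAt _ _ (fun=> K)) (mo_cst HAt).
have -> : K / (1 - r) = r * (K / (1 - r)) + K by field; rewrite gt_eqF.
by rewrite exprS -mulrA addrA -mulrDr lerD2r ler_wpM2l.
Qed.

Section Oscillation.
Variable V : St -> R.
Hypothesis V0 : forall x, 0 <= V x.

(** Bounds on the oscillation between two points are bounds on the distance to
one constant, namely the supremum of the lower envelopes. *)
Lemma oscillation_center f (c b : R) : 0 <= c -> 0 <= b ->
  (forall x y, f x - f y <= c * (2 + b * V x + b * V y)) ->
  exists a : R, forall x, `|f x - a| <= c * (1 + b * V x).
Proof.
move=> c0 b0 osc.
have [[x0]|noSt] := pselect (inhabited St); last first.
  by exists 0 => x; case: noSt; exists.
pose S := range (fun x => f x - c * (1 + b * V x)).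
have ub y : ubound S (f y + c * (1 + b * V y)).
  by move=> _ [x _ <-]; have := osc x y; lra.
have S0 : S !=set0 by exists (f x0 - c * (1 + b * V x0)), x0.
exists (sup S) => y; rewrite ler_norml; apply/andP; split.
  by have := ge_sup S0 (ub y); lra.
have : f y - c * (1 + b * V y) <= sup S.
  apply: ub_le_sup; last by exists y.
  by exists (f y + c * (1 + b * V y)).
lra.
Qed.

(** The contraction of Hairer and Mattingly: far out the drift shrinks the
weighted oscillation, and on the sublevel set the common mass [alpha] at [z]
does so, provided that the weight [b] of [V] is small. *)
Lemma oscillation_contraction Q (r K alpha : R) z : markov_operator Q ->
  0 <= r < 1 -> 0 <= K -> 0 < alpha ->
  (forall x, Q V x <= r * V x + K) ->
  (forall x, V x <= (2 * K + 1) / (1 - r) ->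
     forall f, (forall y, 0 <= f y) -> alpha * f z <= Q f x) ->
  exists b rho : R, [/\ 0 < b, 0 <= rho < 1 & forall f (c : R), 0 <= c ->
    (forall x y, f x - f y <= c * (2 + b * V x + b * V y)) ->
    forall x y, Q f x - Q f y <= rho * c * (2 + b * V x + b * V y)].
Proof.
move=> HQ /andP[r0 r1] K0 a0 drift minor.
have r1' : 0 < 1 - r by rewrite subr_gt0.
set Rr := (2 * K + 1) / (1 - r) in minor.
have Rr0 : 0 < Rr by rewrite divr_gt0//; lra.
have RrE : Rr * (1 - r) = 2 * K + 1 by rewrite /Rr mulfVK// gt_eqF.
pose b := alpha / (2 * K + 1).
have b0 : 0 < b by rewrite divr_gt0//; lra.
have bE : b * (2 * K + 1) = alpha by rewrite /b mulfVK//; rewrite gt_eqF//; lra.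
pose rho1 := (2 + 2 * b * K + b * r * Rr) / (2 + b * Rr).
have den0 : 0 < 2 + b * Rr by rewrite addr_gt0// mulr_gt0.
have rho1E : rho1 * (2 + b * Rr) = 2 + 2 * b * K + b * r * Rr.
  by rewrite /rho1 mulfVK// gt_eqF.
have rho1_lt1 : rho1 < 1.
  rewrite ltr_pdivrMr// mul1r.
  have : b * (Rr * (1 - r)) = b * (2 * K + 1) by rewrite RrE.
  nra.
have rho1_ger : r <= rho1.
  by rewrite ler_pdivlMr//; have := mulr_ge0 (ltW b0) K0; nra.
pose rho := Num.max rho1 (1 - alpha / 2).
have rho_1 : rho1 <= rho by rewrite le_max lexx.
have rho_a : 1 - alpha / 2 <= rho by rewrite le_max lexx orbT.
exists b, rho; split => //.
  apply/andP; split; first by apply: le_trans rho_1; apply: le_trans rho1_ger.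
  by rewrite gt_max rho1_lt1/=; lra.
move=> f c c0 osc x y.
have [a fa] := oscillation_center c0 (ltW b0) osc.
pose f' w := f w - a; pose h w := c * (1 + b * V w).
have f'h w : `|f' w| <= h w by exact: fa.
have Qh w : Q h w = c * (1 + b * Q V w).
  have -> : h = fun v => c * b * V v + c by apply/funext => v; rewrite /h; ring.
  by rewrite (mo_lin HQ _ _ (fun=> c)) (mo_cst HQ); ring.
have Qf' w : Q f' w = Q f w - a by rewrite (mo_sub HQ _ (fun=> a)) (mo_cst HQ).
have -> : Q f x - Q f y = Q f' x - Q f' y by rewrite !Qf'; ring.
have dx := drift x; have dy := drift y.
have Vx := V0 x; have Vy := V0 y.
rewrite -(mulrA rho) (mulrCA rho).
case: (lerP Rr (V x + V y)) => [far|near].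
  have : Q f' x - Q f' y <= Q h x + Q h y.
    apply: lerD; first by apply: le_trans (mo_norm HQ x f'h); rewrite ler_norm.
    by apply: le_trans (mo_norm HQ y f'h); rewrite -normrN ler_norm.
  move=> /le_trans; apply; rewrite !Qh -mulrDr; apply: ler_wpM2l => //.
  apply: (@le_trans _ _ (2 + b * r * (V x + V y) + 2 * b * K)).
    by have := ler_wpM2l (ltW b0) dx; have := ler_wpM2l (ltW b0) dy; nra.
  have : rho1 * (2 + b * V x + b * V y) <= rho * (2 + b * V x + b * V y).
    by apply: ler_wpM2r => //; rewrite !addr_ge0// mulr_ge0// ltW.
  have : 0 <= b * (rho1 - r) * (V x + V y - Rr).
    apply: mulr_ge0; last by rewrite subr_ge0.
    by apply: mulr_ge0; rewrite ?subr_ge0// ltW.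
  nra.
(* In a sublevel set the functional [Q f - alpha * f z] is still positive. *)
have T_le w : V w <= Rr -> `|Q f' w - alpha * f' z| <= c * (1 + b * Q V w) - alpha * c.
  move=> Vw.
  have pos g : (forall v, `|g v| <= h v) -> alpha * (h z - g z) <= Q h w - Q g w.
    move=> gh; rewrite -(mo_sub HQ); apply: (minor _ Vw) => v.
    by rewrite subr_ge0; apply: le_trans (gh v); rewrite ler_norm.
  have hz : c <= h z.
    by rewrite -[leLHS]mulr1 ler_wpM2l// lerDl mulr_ge0// ltW.
  have ahz := ler_wpM2l (ltW a0) hz.
  have := pos _ f'h; rewrite Qh => H1.
  have := pos (fun v => -1 * f' v).
  rewrite Qh (mo_scale HQ (-1) f' w) => H2.
  have {}H2 := H2 (fun v => eq_ind_r (fun u => u <= h v) (f'h v)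
      (etrans (congr1 _ (mulN1r _)) (normrN _))).
  by rewrite ler_norml; apply/andP; split; nra.
have Tx : V x <= Rr by lra.
have Ty : V y <= Rr by lra.
move: (T_le _ Tx) (T_le _ Ty); rewrite !ler_norml => /andP[_ H1] /andP[H2 _].
apply: (@le_trans _ _ (c * (2 - 2 * alpha + b * (Q V x + Q V y)))); first by lra.
apply: ler_wpM2l => //.
have := ler_wpM2l (ltW b0) dx; have := ler_wpM2l (ltW b0) dy.
have : (1 - alpha / 2) * 2 <= rho * 2 by lra.
have : r * (b * V x + b * V y) <= rho * (b * V x + b * V y).
  apply: ler_wpM2r; last exact: le_trans rho_1.
  by rewrite addr_ge0// mulr_ge0// ltW.
nra.
Qed.

End Oscillation.

(** Geometric ergodicity.  A contracted oscillation traps all later values near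
one constant, so that the iterates are Cauchy with a common limit. *)
Theorem geometric_ergodicity A (V : St -> R) (r K : R) : markov_operator A ->
  (forall x, 0 <= V x) -> 0 <= r < 1 -> 0 <= K ->
  (forall x, A V x <= r * V x + K) ->
  (forall M : R, exists (N : nat) (alpha : R) z, [/\ (0 < N)%N, 0 < alpha &
     forall x, V x <= M -> forall f, (forall y, 0 <= f y) ->
       alpha * f z <= iter N A f x]) ->
  forall f (c : R), (forall x, `|f x| <= c * (1 + V x)) ->
  exists l : R, forall x, iter t A f x @[t --> \oo] --> l.
Proof.
move=> HA V0 /andP[r0 r1] K0 drift minor f c fc.
have [[x0]|noSt] := pselect (inhabited St); last first.
  by exists 0 => x; case: noSt; exists.
have r1' : 0 < 1 - r by rewrite subr_gt0.
pose K' := K / (1 - r).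
have K'0 : 0 <= K' by rewrite divr_ge0// ltW.
have AtV t x : iter t A V x <= r ^+ t * V x + K'.
  by apply: drift_iter => //; rewrite r0.
have AtV1 t x : iter t A V x <= V x + K'.
  apply: (le_trans (AtV t x)); rewrite lerD2r -[leRHS]mul1r ler_wpM2r//.
  by rewrite exprn_ile1// ltW.
have [N [alpha [z [N0 a0 minorN]]]] := minor ((2 * K' + 1) / (1 - r)).
have HQ := markov_iter HA N.
have driftN x : iter N A V x <= r * V x + K'.
  apply: (le_trans (AtV N x)); rewrite lerD2r ler_wpM2r//.
  by case: N N0 {minorN HQ} => // N _; rewrite exprS ler_piMr// exprn_ile1// ltW.
have [|b [rho [b0 /andP[rho0 rho1] contr]]] :=
  oscillation_contraction V0 HQ _ K'0 a0 driftN minorN; first by rewrite r0.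
have c0 : 0 <= c.
  have := le_trans (normr_ge0 _) (fc x0); rewrite pmulr_lge0//.
  by rewrite ltr_pwDl.
(* The part [c / b] makes up for [b < 1] in the comparison of the two weights. *)
pose c' := c * (1 + b^-1).
have c'0 : 0 <= c' by rewrite mulr_ge0// addr_ge0// invr_ge0 ltW.
have osc0 x y : f x - f y <= c' * (2 + b * V x + b * V y).
  have E : b^-1 * b = 1 by rewrite mulVf// gt_eqF.
  have bi : 0 <= b^-1 by rewrite invr_ge0 ltW.
  have h v : 1 + V v <= (1 + b^-1) * (1 + b * V v).
    have -> : (1 + b^-1) * (1 + b * V v) = 1 + b * V v + b^-1 + (b^-1 * b) * V v by ring.
    by rewrite E mul1r lerD2r -addrA lerDl addr_ge0// mulr_ge0// ltW.
  have := fc x; have := fc y; rewrite !ler_norml => /andP[H1 _] /andP[_ H2].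
  have := ler_wpM2l c0 (h x); have := ler_wpM2l c0 (h y).
  by rewrite /c'; nra.
have osc k x y : iter (k * N) A f x - iter (k * N) A f y <=
    rho ^+ k * c' * (2 + b * V x + b * V y).
  elim: k x y => [|k IH] x y; first by rewrite mul0n expr0 mul1r; exact: osc0.
  rewrite mulSn iterD exprS -(mulrA rho); apply: contr => //.
  by rewrite mulr_ge0// exprn_ge0.
have trap e : 0 < e -> exists T a, forall t x, (T <= t)%N ->
    `|iter t A f x - a| <= e * (1 + b * V x + b * K').
  move=> e0.
  have [k kP] : exists k, rho ^+ k * c' <= e.
    have : (fun k => rho ^+ k * c') @ \oo --> (0 : R).
      rewrite -(mul0r c'); apply: cvgMl; apply: cvg_expr.
      by rewrite ger0_norm.
    move=> /cvgrPdist_le /(_ _ e0)[k _ /(_ k (leqnn k))]/=.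
    rewrite sub0r normrN ger0_norm; last by rewrite mulr_ge0// exprn_ge0.
    by exists k.
  have [a ak] : exists a, forall x, `|iter (k * N) A f x - a| <= e * (1 + b * V x).
    apply: oscillation_center; rewrite ?ltW// => x y; apply: (le_trans (osc k x y)).
    by rewrite ler_wpM2r// !addr_ge0// mulr_ge0// ltW.
  exists (k * N)%N, a => t x /subnK <-; rewrite iterD.
  have HAs := markov_iter HA (t - k * N).
  rewrite -[in leLHS](mo_cst HAs a x) -(mo_sub HAs).
  apply: (le_trans (mo_norm HAs x ak)).
  have -> : (fun v => e * (1 + b * V v)) = fun v => e * b * V v + e.
    by apply/funext => v; ring.
  rewrite (mo_lin HAs _ _ (fun=> e)) (mo_cst HAs).
  have := ler_wpM2l (mulr_ge0 (ltW e0) (ltW b0)) (AtV1 (t - k * N)%N x); nra.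
have w_gt0 x : 0 < 1 + b * V x + b * K'.
  by rewrite -addrA ltr_pwDl// addr_ge0// mulr_ge0// ltW.
have cv x : cvg (iter t A f x @[t --> \oo]).
  apply/cauchy_cvgP; apply: cauchy_exP => e e0.
  have [|T [a Ta]] := trap (e / 2 / (1 + b * V x + b * K')).
    by rewrite !divr_gt0.
  exists a; exists T => // t Tt; rewrite /ball/= distrC.
  apply: le_lt_trans (Ta t x Tt) _.
  by rewrite divfK ?gt_eqF// ltr_pdivrMr// ltr_pMr// ltrDl.
exists (lim (iter t A f x0 @[t --> \oo])) => x.
have diff : (iter t A f x - iter t A f x0) @[t --> \oo] --> (0 : R).
  apply/cvgrPdist_le => e e0.
  pose W := (1 + b * V x + b * K') + (1 + b * V x0 + b * K').
  have W0 : 0 < W by rewrite addr_gt0.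
  have [|T [a Ta]] := trap (e / W); first by rewrite divr_gt0.
  exists T => // t Tt /=; rewrite sub0r normrN.
  have -> : iter t A f x - iter t A f x0 =
    (iter t A f x - a) - (iter t A f x0 - a) by ring.
  apply: (le_trans (ler_normB _ _)); apply: (le_trans (lerD (Ta t x Tt) (Ta t x0 Tt))).
  by rewrite -mulrDr divfK ?gt_eqF.
rewrite -[X in _ --> X]add0r.
suff -> : (fun t => iter t A f x) = (fun t => iter t A f x - iter t A f x0) \+
  (fun t => iter t A f x0) by apply: cvgD diff (cv x0).
by apply/funext => t /=; rewrite subrK.
Qed.

Definition dominated (V f : St -> R) := exists c : R, forall x, `|f x| <= c * (1 + V x).

(** A stationary expectation, given by its values on the functions of growth
[V]; working with it instead of a stationary law keeps integrability questions
out of the drift computations. *)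
Definition limit_functional A V (L : (St -> R) -> R) :=
  forall f, dominated V f -> forall x, iter t A f x @[t --> \oo] --> L f.

Section LimitFunctional.
Variables (A : (St -> R) -> St -> R) (V : St -> R) (L : (St -> R) -> R) (x0 : St).
Hypotheses (HA : markov_operator A) (V0 : forall x, 0 <= V x).
Hypothesis HL : limit_functional A V L.

Lemma dominated_le f h : dominated V h -> (forall x, `|f x| <= h x) -> dominated V f.
Proof.
move=> [c hc] fh; exists c => x; apply: (le_trans (fh x)).
by apply: le_trans (hc x); rewrite ler_norm.
Qed.

Lemma dominated_lin c f h : dominated V f -> dominated V h ->
  dominated V (fun x => c * f x + h x).
Proof.
move=> [c1 fc1] [c2 hc2]; exists (`|c| * c1 + c2) => x.
apply: (le_trans (ler_normD _ _)); rewrite normrM mulrDl -mulrA.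
by apply: lerD => //; apply: ler_wpM2l.
Qed.

Lemma dominated_cst c : dominated V (fun=> c).
Proof.
by exists `|c| => x; rewrite -[leLHS]mulr1 ler_wpM2l// lerDl.
Qed.

Lemma dominated_scale c f : dominated V f -> dominated V (fun x => c * f x).
Proof.
move=> fV; have := dominated_lin c fV (dominated_cst 0).
by under eq_fun do rewrite addr0.
Qed.

Lemma dominated_add f h : dominated V f -> dominated V h ->
  dominated V (fun x => f x + h x).
Proof.
move=> fV hV; have := dominated_lin 1 fV hV.
by under eq_fun do rewrite mul1r.
Qed.

Lemma limit_lin c f h : dominated V f -> dominated V h ->
  L (fun x => c * f x + h x) = c * L f + L h.
Proof.
move=> fV hV.
have lhs := HL (dominated_lin c fV hV) x0.
apply: (cvg_unique _ lhs); first exact: Rhausdorff.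
suff -> : (fun t => iter t A (fun x => c * f x + h x) x0) =
  ((fun t => c * iter t A f x0) \+ (fun t => iter t A h x0)) by apply: cvgD (HL hV x0); exact: cvgMr (HL fV x0).
by apply/funext => t /=; rewrite (mo_lin (markov_iter HA t)).
Qed.

Lemma limit_cst c : L (fun=> c) = c.
Proof.
apply: (cvg_unique _ (HL (dominated_cst c) x0)); first exact: Rhausdorff.
rewrite (_ : (fun t => _) = (fun=> c)); first exact: cvg_cst.
by apply/funext => t; rewrite (mo_cst (markov_iter HA t)).
Qed.

Lemma limit_scale c f : dominated V f -> L (fun x => c * f x) = c * L f.
Proof.
move=> fV; have := limit_lin c fV (dominated_cst 0).
by rewrite limit_cst addr0; under eq_fun do rewrite addr0.
Qed.

Lemma limit_add f h : dominated V f -> dominated V h ->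
  L (fun x => f x + h x) = L f + L h.
Proof.
move=> fV hV; have := limit_lin 1 fV hV.
by rewrite mul1r; under eq_fun do rewrite mul1r.
Qed.

Lemma limit_le f h : dominated V f -> dominated V h ->
  (forall x, f x <= h x) -> L f <= L h.
Proof.
move=> fV hV fh.
apply: (ler_cvg_to (HL fV x0) (HL hV x0)).
by apply: nearW => t; apply: (mo_le (markov_iter HA t)).
Qed.

Lemma limit_ge0 f : dominated V f -> (forall x, 0 <= f x) -> 0 <= L f.
Proof. by move=> fV f0; rewrite -(limit_cst 0); apply: limit_le => //; exact: dominated_cst. Qed.

(** Invariance: one more step does not change the limit. *)
Lemma limit_inv f : dominated V f -> dominated V (A f) -> L (A f) = L f.
Proof.
move=> fV AfV; apply: (cvg_unique _ (HL AfV x0)); first exact: Rhausdorff.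
have := HL fV x0; rewrite -(cvg_shiftS (fun t => iter t A f x0)).
by under eq_fun do rewrite iterSr.
Qed.

(** The drift function itself may grow faster than [V]: only the finite-time
expectations of [W] enter, and these are bounded. *)
Lemma limit_drift (W h : St -> R) (k C : R) : 0 < k <= 1 -> 0 <= C ->
  (forall x, A W x <= (1 - k) * W x + C) -> dominated V h ->
  (forall x, h x <= W x) -> L h <= C / k.
Proof.
move=> /andP[k0 k1] C0 drift hV hW.
have bound : (fun t => (1 - k) ^+ t * W x0 + C / k) @ \oo --> C / k.
  rewrite -[X in _ --> X]add0r -(mul0r (W x0)).
  apply: cvgD; last exact: cvg_cst.
  by apply: cvgMl; apply: cvg_expr; rewrite ger0_norm; lra.
apply: (ler_cvg_to (HL hV x0) bound); apply: nearW => t.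
apply: le_trans (mo_le (markov_iter HA t) hW x0) _.
have := @drift_iter A W (1 - k) C t x0 HA; rewrite opprB addrCA subrr addr0.
by apply => //; apply/andP; split; lra.
Qed.

End LimitFunctional.

End MarkovOperators.

(** * The Frobenius inner product *)

Section FrobeniusGeometry.
Variables (R : realType) (n : nat).
Implicit Types (x y z : 'M[R]_n).

Lemma frobC x y : frob x y = frob y x.
Proof. by apply: eq_bigr => i _; apply: eq_bigr => j _; rewrite mulrC. Qed.

Lemma frobDl x y z : frob (x + y) z = frob x z + frob y z.
Proof.
rewrite /frob -big_split; apply: eq_bigr => i _; rewrite -big_split.
by apply: eq_bigr => j _; rewrite mxE mulrDl.
Qed.

Lemma frobZl c x z : frob (c *: x) z = c * frob x z.
Proof.
rewrite /frob mulr_sumr; apply: eq_bigr => i _; rewrite mulr_sumr.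
by apply: eq_bigr => j _; rewrite mxE mulrA.
Qed.

Lemma frobNl x z : frob (- x) z = - frob x z.
Proof. by rewrite -scaleN1r frobZl mulN1r. Qed.

Lemma frobBl x y z : frob (x - y) z = frob x z - frob y z.
Proof. by rewrite frobDl frobNl. Qed.

Lemma frobDr x y z : frob z (x + y) = frob z x + frob z y.
Proof. by rewrite frobC frobDl !(frobC z). Qed.

Lemma frobBr x y z : frob z (x - y) = frob z x - frob z y.
Proof. by rewrite frobC frobBl !(frobC z). Qed.

Lemma frobZr c x z : frob z (c *: x) = c * frob z x.
Proof. by rewrite frobC frobZl (frobC z). Qed.

Lemma frob_ge0 x : 0 <= frob x x.
Proof. by do 2!apply: sumr_ge0 => ? _; rewrite -expr2 sqr_ge0. Qed.

Lemma frob_norm_ge0 x : 0 <= frob_norm x.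
Proof. exact: sqrtr_ge0. Qed.

Lemma sqr_frob_norm x : frob_norm x ^+ 2 = frob x x.
Proof. by rewrite sqr_sqrtr// frob_ge0. Qed.

Lemma frob_norm_sqr_le x (b : R) : 0 <= b -> (frob_norm x <= b) = (frob x x <= b ^+ 2).
Proof. by move=> b0; rewrite -sqr_frob_norm ler_pXn2r// ?nnegrE ?frob_norm_ge0. Qed.

Lemma frob_normN x : frob_norm (- x) = frob_norm x.
Proof. by rewrite /frob_norm frobNl frobC frobNl opprK. Qed.

Lemma entry_le_frob_norm x i j : `|x i j| <= frob_norm x.
Proof.
rewrite -(ler_pXn2r (n := 2))// ?nnegrE ?frob_norm_ge0// sqr_frob_norm.
rewrite /frob (bigD1 i)//= (bigD1 j)//= real_normK ?num_real// expr2 -addrA lerDl.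
apply: addr_ge0; first by apply: sumr_ge0 => ? _; rewrite -expr2 sqr_ge0.
by do 2!apply: sumr_ge0 => ? _; rewrite -expr2 sqr_ge0.
Qed.

Lemma cauchy_schwarz x y : frob x y <= frob_norm x * frob_norm y.
Proof.
have Z (u v : 'M[R]_n) : frob_norm u = 0 -> frob u v = 0.
  move=> u0; rewrite /frob big1// => i _; rewrite big1// => j _.
  have := entry_le_frob_norm u i j; rewrite u0 normr_le0 => /eqP ->.
  by rewrite mul0r.
set a := frob_norm x; set b := frob_norm y.
have a0 : 0 <= a := frob_norm_ge0 x.
have b0 : 0 <= b := frob_norm_ge0 y.
have [ae|ap] := predU1P (etrans (esym (le_eqVlt 0 a)) a0).
  by rewrite Z// mulr_ge0.
have [be|bp] := predU1P (etrans (esym (le_eqVlt 0 b)) b0); first by rewrite frobC Z// mulr_ge0.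
have := frob_ge0 (b *: x - a *: y).
rewrite frobBl !frobBr !frobZl !frobZr (frobC y) -!sqr_frob_norm -/a -/b => H.
have ab : 0 < a * b by rewrite mulr_gt0.
rewrite -(ler_pM2l ab); nra.
Qed.

Lemma cauchy_schwarz_abs x y : `|frob x y| <= frob_norm x * frob_norm y.
Proof.
rewrite ler_norml cauchy_schwarz andbT lerNl -frobNl -(frob_normN x).
exact: cauchy_schwarz.
Qed.

Lemma frob_norm_triangle x y : frob_norm (x + y) <= frob_norm x + frob_norm y.
Proof.
rewrite frob_norm_sqr_le ?addr_ge0 ?frob_norm_ge0// frobDl !frobDr (frobC y).
rewrite -!sqr_frob_norm; have := cauchy_schwarz x y; nra.
Qed.

Lemma sqr_frob_normD x y :
  frob_norm (x + y) ^+ 2 = frob_norm x ^+ 2 + 2 * frob x y + frob_norm y ^+ 2.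
Proof. by rewrite !sqr_frob_norm frobDl !frobDr (frobC y); ring. Qed.

Lemma frob_perm x (s : 'S_n) : frob x (perm_mx s) = \sum_i x i (s i).
Proof.
apply: eq_bigr => i _; rewrite (bigD1 (s i))//= big1 => [|j ji].
  by rewrite !mxE eqxx mulr1 addr0.
by rewrite !mxE eq_sym (negbTE ji) mulr0.
Qed.

Lemma frob_const x (c : R) : frob x (const_mx c) = c * \sum_i \sum_j x i j.
Proof.
rewrite /frob mulr_sumr; apply: eq_bigr => i _; rewrite mulr_sumr.
by apply: eq_bigr => j _; rewrite mxE mulrC.
Qed.

(** * The cone *)

(** Membership in [coneS] as linear equations on the entries, a form that
survives limits. *)
Lemma coneS_crossP x : coneS x <->
  forall i j k l, x i j + x k l = x i l + x k j.
Proof.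
split=> [[w [w' E]] i j k l|E]; first by rewrite !E; ring.
case: n x E => [|m] x E.
  by exists (fun=> 0), (fun=> 0) => -[].
exists (fun i => x i ord0), (fun j => x ord0 j - x ord0 ord0) => i j.
by rewrite addrA -(E i j ord0 ord0) addrK.
Qed.

Lemma coneK_0 : coneK (0 : 'M[R]_n).
Proof.
split; last by move=> i j; rewrite mxE.
by exists (fun=> 0), (fun=> 0) => i j; rewrite mxE addr0.
Qed.

Lemma coneK_midpoint x y : coneK x -> coneK y -> coneK (2^-1 *: (x + y)).
Proof.
move=> [[w [w' Ex]] x0] [[v [v' Ey]] y0]; split.
  exists (fun i => 2^-1 * (w i + v i)), (fun j => 2^-1 * (w' j + v' j)) => i j.
  by rewrite !mxE Ex Ey; ring.
by move=> i j; rewrite !mxE mulr_ge0// ?invr_ge0// addr_ge0.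
Qed.

(** By the parallelogram law a minimizing sequence in a convex set is Cauchy. *)
Lemma coneK_nearest x : exists y, coneK y /\
  forall z, coneK z -> frob_norm (x - y) <= frob_norm (x - z).
Proof.
pose D z := frob (x - z) (x - z).
pose S := [set D z | z in @coneK R n].
have S0 : S !=set0 by exists (D 0), 0 => //; exact: coneK_0.
have Slb : has_lbound S by exists 0 => _ [z _ <-]; exact: frob_ge0.
pose m : R := inf S.
have D_ge z : coneK z -> m <= D z by move=> Kz; apply: ge_inf => //; exists z.
pose r (k : nat) : R := k.+1%:R^-1.
have zP k : exists z, coneK z /\ D z < m + r k.
  have [|_ [z Kz <-] Hz] := @inf_adherent R S (r k) _ (conj S0 Slb).
    by rewrite invr_gt0.
  by exists z.
have {zP}[z zP] := choice zP.
have parallelogram k l i j : (z k i j - z l i j) ^+ 2 <= 2 * (r k + r l).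
  have [[Kk Dk] [Kl Dl]] := (zP k, zP l).
  pose mid : 'M[R]_n := 2^-1 *: (z k + z l).
  have Dm : m <= D mid := D_ge mid (coneK_midpoint Kk Kl).
  have : frob (z k - z l) (z k - z l) =
      2 * D (z k) + 2 * D (z l) - 4 * D mid.
    rewrite /D /mid !(frobBl, frobBr, frobZl, frobZr, frobDl, frobDr).
    rewrite (frobC (z k) x) (frobC (z l) x) (frobC (z l) (z k)); by field.
  have : (z k i j - z l i j) ^+ 2 <= frob (z k - z l) (z k - z l).
    rewrite -sqr_frob_norm -(real_normK (num_real _)) ler_pXn2r// ?nnegrE ?frob_norm_ge0//.
    by have := entry_le_frob_norm (z k - z l) i j; rewrite !mxE.
  lra.
have cv i j : cvg (z k i j @[k --> \oo]).
  apply/cauchy_cvgP; apply: cauchy_exP => e e0.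
  have [N Ne] : exists N, 4 * r N < e ^+ 2.
    have h : (fun N => 4 * r N) @ \oo --> (0 : R).
      by rewrite -(mulr0 4); apply: cvgMr; exact: cvg_harmonic.
    have e2 : 0 < e ^+ 2 by rewrite exprn_gt0.
    move: h => /cvgrPdist_lt /(_ _ e2)[N _ /(_ N (leqnn N))]/=.
    by rewrite sub0r normrN ger0_norm ?mulr_ge0 ?invr_ge0// => ?; exists N.
  exists (z N i j); exists N => // k /= Nk; rewrite /ball/=.
  rewrite -(ltr_pXn2r (n := 2))// ?nnegrE// ?ltW// real_normK ?num_real//.
  apply: le_lt_trans (parallelogram N k i j) _; apply: le_lt_trans Ne.
  have : r k <= r N by rewrite lef_pV2 ?posrE// ler_nat.
  lra.
pose y := \matrix_(i, j) lim (z k i j @[k --> \oo]) : 'M[R]_n.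
have zy i j : z k i j @[k --> \oo] --> y i j by rewrite mxE; exact: cv.
have Ky : coneK y.
  split; last first.
    by move=> i j; rewrite mxE; apply: limr_ge => //; apply: nearW => k; exact: (zP k).1.2.
  apply/coneS_crossP => i j k l.
  apply: (@cvg_unique _ (@Rhausdorff R) (z h i j + z h k l @[h --> \oo])).
    by apply: cvgD; exact: zy.
  have -> : (fun h => z h i j + z h k l) = (fun h => z h i l + z h k j).
    by apply/funext => h; have [/coneS_crossP + _] := (zP h).1; apply.
  by apply: cvgD; exact: zy.
have Dy : D y <= m.
  have lhs : D (z k) @[k --> \oo] --> D y.
    apply: cvg_big => [|i _]; first exact: add_continuous.
    apply: cvg_big => [|j _]; first exact: add_continuous.
    under eq_fun do rewrite !mxE.
    have xz : x i j - z k i j @[k --> \oo] --> (x - y) i j.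
      by rewrite 2!mxE; apply: cvgB; [exact: cvg_cst|exact: zy].
    exact: cvgM.
  have rhs : m + r k @[k --> \oo] --> m.
    rewrite -[X in _ --> X]addr0; apply: cvgD; first exact: cvg_cst.
    exact: cvg_harmonic.
  apply: (ler_cvg_to lhs rhs); apply: nearW => k; exact: ltW (zP k).2.
exists y; split => // u Ku.
rewrite frob_norm_sqr_le ?frob_norm_ge0// sqr_frob_norm.
exact: le_trans Dy (D_ge _ Ku).
Qed.

Lemma projK_coneK x : coneK (projK x).
Proof.
have := coneK_nearest x; rewrite /projK.
by case: xgetP => [y -> []//|H [y /H]].
Qed.

Lemma perpK_le x z : coneK z -> frob_norm (perpK x) <= frob_norm (x - z).
Proof.
have := coneK_nearest x; rewrite /perpK /projK.
by case: xgetP => [y -> [_ H] _|H [y /H]//]; exact: H.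
Qed.

Lemma perpK_le_norm x : frob_norm (perpK x) <= frob_norm x.
Proof. by have := perpK_le x coneK_0; rewrite subr0. Qed.

End FrobeniusGeometry.

(** * Maximal weight and duality *)

Section Hall.
Import mathcomp.boot.fintype mathcomp.boot.finset.
Variables (T : finType) (e : rel T).
Implicit Types (A B X Y : {set T}).
Local Open Scope set_scope.

Definition neighbors A : {set T} := [set y | [exists x in A, e x y]].

Lemma neighborsU A B : neighbors (A :|: B) = neighbors A :|: neighbors B.
Proof.
apply/setP => y; rewrite !inE; apply/exists_inP/orP.
  by case=> x /setUP[xA|xB] exy; [left|right]; apply/exists_inP; exists x.
by case=> /exists_inP[x xA exy]; exists x => //; rewrite inE xA ?orbT.
Qed.

Lemma neighborsS A B : A \subset B -> neighbors A \subset neighbors B.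
Proof.
move=> sAB; apply/subsetP => y; rewrite !inE => /exists_inP[x xA exy].
by apply/exists_inP; exists x => //; exact: (subsetP sAB).
Qed.

(** The induction splits [X] at a tight proper subset if there is one, and
matches an arbitrary vertex otherwise. *)
Lemma hall_partial m X Y : (#|X| <= m)%N ->
  (forall A, A \subset X -> (#|A| <= #|neighbors A :&: Y|)%N) ->
  exists f : T -> T, {in X &, injective f} /\
    (forall x, x \in X -> f x \in Y /\ e x (f x)).
Proof.
elim: m X Y => [|m IH] X Y.
  rewrite leqn0 cards_eq0 => /eqP -> _.
  by exists id; split=> [x y|x]; rewrite inE.
move=> Xm hallX.
have [->|/set0Pn[x xX]] := eqVneq X set0.
  by exists id; split=> [x y|x]; rewrite inE.
have [/existsP[A /and4P[A0 AX AnX /eqP tight]]|no_tight] := boolP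
    [exists A : {set T}, [&& A != set0, A \subset X, A != X &
                             #|A| == #|neighbors A :&: Y|]].
  have ltAX : (#|A| < #|X|)%N by apply: proper_card; rewrite properEneq AnX.
  have Apos : (0 < #|A|)%N by rewrite card_gt0.
  have [|B BA|f [finj fY]] := IH A (Y :&: neighbors A).
  - by rewrite -ltnS (leq_trans ltAX).
  - have -> : neighbors B :&: (Y :&: neighbors A) = neighbors B :&: Y.
      by rewrite setICA setIA; rewrite (setIC _ Y) -setIA (setIidPl (neighborsS BA)) setIC.
    by apply: hallX; exact: subset_trans BA AX.
  have [|B BX|h [hinj hY]] := IH (X :\: A) (Y :\: neighbors A).
  - by rewrite -ltnS (leq_trans _ Xm)// cardsD (setIidPr AX); lia.
  - have disj : A :&: B = set0.
      apply/setP => y; rewrite !inE; apply/negP => /andP[yA yB].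
      by have := subsetP BX y yB; rewrite inE yA.
    have := hallX (A :|: B); rewrite subUset AX (subset_trans BX (subsetDl _ _)) => /(_ isT).
    have -> : #|A :|: B| = (#|A| + #|B|)%N by rewrite cardsU disj cards0 subn0.
    have -> : neighbors (A :|: B) :&: Y =
        (neighbors A :&: Y) :|: (neighbors B :&: (Y :\: neighbors A)).
      by rewrite neighborsU; apply/setP => y; rewrite !inE; case: [exists _ in A, _]; case: [exists _ in B, _]; case: (y \in Y).
    rewrite tight => /leq_trans/(_ (leq_card_setU _ _)); rewrite leq_add2l.
    exact.
  exists (fun v => if v \in A then f v else h v); split.
    move=> u v uX vX.
    case: (boolP (u \in A)) => uA; case: (boolP (v \in A)) => vA; first exact: finj.
    - have [] := hY v; first by rewrite inE vA.
      rewrite inE => /andP[hvA _] _ fuhv; case/negP: hvA; rewrite -fuhv.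
      by have [] := fY u uA; rewrite inE => /andP[].
    - have [] := hY u; first by rewrite inE uA.
      rewrite inE => /andP[huA _] _ hufv; case/negP: huA; rewrite hufv.
      by have [] := fY v vA; rewrite inE => /andP[].
    - by apply: hinj; rewrite inE ?uA ?vA.
  move=> u uX; case: ifP => uA.
    by have [] := fY u uA; rewrite inE => /andP[].
  by have [] := hY u; [rewrite inE uA|rewrite inE => /andP[]].
have [y] : exists y, y \in neighbors [set x] :&: Y.
  by apply/set0Pn; rewrite -card_gt0 (leq_trans _ (hallX _ _)) ?cards1// sub1set.
rewrite !inE => /andP[/exists_inP[x' /set1P -> exy] yY].
have [|A AX|f [finj fY]] := IH (X :\ x) (Y :\ y).
- by move: Xm; rewrite (cardsD1 x X) xX.
- have [->|A0] := eqVneq A set0; first by rewrite cards0.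
  have AX' := subset_trans AX (subsetDl _ _).
  have AnX : A != X.
    by apply: contraTneq xX => <-; apply/negP => /(subsetP AX); rewrite !inE eqxx.
  have lt : (#|A| < #|neighbors A :&: Y|)%N.
    rewrite ltn_neqAle hallX// andbT; apply: contraNneq no_tight => tight.
    by apply/existsP; exists A; rewrite A0 AX' AnX tight eqxx.
  have -> : neighbors A :&: (Y :\ y) = (neighbors A :&: Y) :\ y by rewrite setIDA.
  by have := cardsD1 y (neighbors A :&: Y); lia.
exists (fun v => if v == x then y else f v); split.
  have fNy v : v \in X -> v != x -> f v != y.
    by move=> vX vx; have [] := fY v; rewrite !inE ?vx// => /andP[].
  move=> u v uX vX; case: eqP => [->|/eqP ux]; case: eqP => [->//|/eqP vx].
  - by move=> E; have := fNy v vX vx; rewrite -E eqxx.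
  - by move=> E; have := fNy u uX ux; rewrite E eqxx.
  - by apply: finj; rewrite !inE ?ux ?vx.
move=> u uX; case: eqP => [->//|/eqP ux].
by have [] := fY u; rewrite !inE ?ux// => /andP[].
Qed.

Theorem hall_marriage : (forall A, (#|A| <= #|neighbors A|)%N) ->
  exists f : T -> T, injective f /\ forall x, e x (f x).
Proof.
move=> hallT; have [|A _|f [finj fe]] := @hall_partial #|T| setT setT.
- by rewrite max_card.
- by rewrite setIT.
exists f; split=> [x y|x]; first exact: (finj x y (in_setT x) (in_setT y)).
by have [] := fe x (in_setT x).
Qed.

End Hall.

Section Egervary.
Variables (n : nat) (q : 'M[nat]_n).
Implicit Types (w : 'I_n -> int).

Definition covers w (w' : 'I_n -> int) := forall i j, ((q i j)%:Z <= w i + w' j)%R.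

(** Egervary's theorem.  Among integer covers one of least total weight has a
perfect matching of tight entries: a violator [A] of Hall's condition would let
us lower the cover on [A] and raise it on the fewer neighbors of [A]. *)
Theorem egervary : exists w w' (s : 'S_n), covers w w' /\
  \sum_i w i + \sum_j w' j = \sum_i (q i (s i))%:Z.
Proof.
suff descent : forall (k : nat) w w', covers w w' -> \sum_i w i + \sum_j w' j = k%:Z ->
    exists w w' (s : 'S_n), covers w w' /\
      \sum_i w i + \sum_j w' j = \sum_i (q i (s i))%:Z.
  pose w i : int := \sum_j (q i j)%:Z.
  have w0 i : 0 <= w i by apply: sumr_ge0.
  apply: (descent (absz (\sum_i w i)) w (fun=> 0)).
    by move=> i j; rewrite addr0 /w (bigD1 j)//= lerDl; exact: sumr_ge0.
  by rewrite [X in _ + X]big1// addr0 gez0_abs// sumr_ge0.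
elim/ltn_ind => k IH w w' cov sumE.
pose e i j := (q i j)%:Z == w i + w' j.
have [/forallP hallP|] := boolP [forall A : {set 'I_n}, #|A| <= #|neighbors e A|]%N.
  have [f [finj fe]] := hall_marriage hallP.
  exists w, w', (perm finj); split=> //.
  have -> : \sum_j w' j = \sum_i w' (perm finj i) by rewrite (reindex_inj (@perm_inj _ (perm finj))).
  by rewrite -big_split; apply: eq_bigr => i _; rewrite permE (eqP (fe i)).
rewrite negb_forall => /existsP[A]; rewrite -ltnNge => viol.
pose v i := w i - (i \in A)%:Z; pose v' j := w' j + (j \in neighbors e A)%:Z.
have cov' : covers v v'.
  move=> i j; rewrite /v /v'; have := cov i j.
  case: (boolP (i \in A)) => iA; case: (boolP (j \in _)) => jA; try lia.
  move=> le; have ne : ~~ e i j.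
    by apply: contra jA => eij; rewrite inE; apply/exists_inP; exists i.
  by move: ne; rewrite /e => /eqP; lia.
have sum' : \sum_i v i + \sum_j v' j = k%:Z - #|A|%:Z + #|neighbors e A|%:Z.
  have cardE (B : {set 'I_n}) : \sum_i ((i \in B)%:Z : int) = #|B|%:Z.
    by rewrite -sum1_card (big_morph Posz PoszD erefl) [RHS]big_mkcond/=; apply: eq_bigr => i _; case: (i \in B).
  rewrite /v /v' big_split/= sumrN big_split/= !cardE -sumE; ring.
have pos : 0 <= \sum_i v i + \sum_j v' j.
  by rewrite -big_split/=; apply: sumr_ge0 => i _; apply: le_trans (cov' i i).
apply: (IH (absz (\sum_i v i + \sum_j v' j)) _ v v' cov'); last by rewrite gez0_abs.
by rewrite sum' in pos *; lia.
Qed.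

End Egervary.

Section MaxWeight.
Variables (R : realType) (n : nat).
Implicit Types (q : 'M[nat]_n) (s : 'S_n) (x : 'M[R]_n).

Definition total q : R := \sum_i \sum_j (q i j)%:R.

Lemma weightE q s : weight R q s = \sum_i (q i (s i))%:R.
Proof. by rewrite /weight frob_perm; apply: eq_bigr => i _; rewrite mxE. Qed.

Lemma weight_ge0 q s : 0 <= weight R q s.
Proof. by rewrite weightE sumr_ge0. Qed.

Lemma weight_le_max q s : weight R q s <= max_weight R q.
Proof. exact: le_bigmax. Qed.

Lemma max_weight_le q (b : R) : 0 <= b -> (forall s, weight R q s <= b) ->
  max_weight R q <= b.
Proof. by move=> b0 H; apply: bigmax_le. Qed.

Lemma frob_norm_le_sum x : frob_norm x <= \sum_i \sum_j `|x i j|.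
Proof.
have S0 : 0 <= \sum_i \sum_j `|x i j| by do 2!apply: sumr_ge0 => ? _.
rewrite frob_norm_sqr_le// expr2 mulr_suml; apply: ler_sum => i _.
rewrite mulr_suml; apply: ler_sum => j _.
rewrite -expr2 -(real_normK (num_real _)) expr2 ler_wpM2l//.
rewrite (bigD1 i)//= (bigD1 j)//= -addrA lerDl addr_ge0//; first exact: sumr_ge0.
by do 2!apply: sumr_ge0 => ? _.
Qed.

(** An optimal dual cover [z] of [q] lies in the cone, as it dominates [q], and
its distance to [q] in the sum norm is [n] times the optimum minus [total q]. *)
Theorem max_weight_gap q :
  total q + frob_norm (perpK (real_mx R q)) <= n%:R * max_weight R q.
Proof.
have [w [w' [s [cov opt]]]] := egervary q.
pose z : 'M[R]_n := \matrix_(i, j) ((w i)%:~R + (w' j)%:~R).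
have qz i j : (q i j)%:R <= z i j.
  by rewrite mxE -intrD [leLHS]pmulrn ler_int; exact: cov.
have Kz : coneK z.
  split; last by move=> i j; apply: le_trans (qz i j).
  by exists (fun i => (w i)%:~R), (fun j => (w' j)%:~R) => i j; rewrite mxE.
have sum_z : \sum_i \sum_j z i j = n%:R * weight R q s.
  transitivity (n%:R * (\sum_i w i + \sum_j w' j)%:~R : R).
    rewrite intrD !(rmorph_sum _ ) /= mulrDr !mulr_sumr.
    transitivity (\sum_i (n%:R * (w i)%:~R + \sum_j (w' j)%:~R : R)).
      apply: eq_bigr => i _; under eq_bigr do rewrite mxE.
      by rewrite big_split/= sumr_const card_ord mulr_natl.
    by rewrite big_split/= sumr_const card_ord -[in X in _ + X]mulr_natl mulr_sumr.
  by rewrite opt weightE rmorph_sum.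
apply: le_trans (_ : n%:R * weight R q s <= _); last first.
  by rewrite ler_wpM2l// weight_le_max.
rewrite -sum_z -lerBrDl; apply: le_trans (perpK_le (real_mx R q) Kz) _.
apply: le_trans (frob_norm_le_sum _) _; rewrite /total -sumrB.
apply: ler_sum => i _; rewrite -sumrB; apply: ler_sum => j _.
have := qz i j; rewrite !mxE => qzij.
by rewrite distrC ger0_norm// subr_ge0.
Qed.

End MaxWeight.

(** * Uniform permutations and flips *)

Section UniformPermutations.
Variables (R : realType) (n : nat).
Implicit Types (s : 'S_n) (q : 'M[nat]_n).

Lemma sum_permMl (F : 'S_n -> R) (p : 'S_n) : \sum_(s : 'S_n) F (p * s)%g = \sum_(s : 'S_n) F s.
Proof. by rewrite [RHS](reindex_inj (mulgI p)). Qed.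

(** The image of one row is uniform, because left multiplication by a
transposition exchanges the images of any two rows. *)
Lemma sum_perm_image (F : 'I_n -> R) i :
  n%:R * \sum_(s : 'S_n) F (s i) = n`!%:R * \sum_j F j.
Proof.
have E j : \sum_(s : 'S_n) F (s i) = \sum_(s : 'S_n) F (s j).
  by rewrite -(sum_permMl _ (tperm i j)); under eq_bigr do rewrite permM tpermL.
transitivity (\sum_(j < n) \sum_(s : 'S_n) F (s j)).
  by rewrite -(eq_bigr _ (fun j _ => E j)) sumr_const card_ord mulr_natl.
rewrite exchange_big/= -card_Sn mulr_natl -sumr_const; apply: eq_bigr => s _.
by rewrite [RHS](reindex_inj (@perm_inj _ s)).
Qed.

Lemma sum_perm_image2 (G : 'I_n -> 'I_n -> R) i k : i != k ->
  (forall j l, 0 <= G j l) ->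
  n`!%:R * \sum_(p : 'I_n * 'I_n | p.1 != p.2) G p.1 p.2 <=
  n%:R ^+ 2 * \sum_(s : 'S_n) G (s i) (s k).
Proof.
move=> ik G0.
have E (p : 'I_n * 'I_n) : p.1 != p.2 ->
    \sum_(s : 'S_n) G (s i) (s k) = \sum_(s : 'S_n) G (s p.1) (s p.2).
  case: p => i' k' /= ik'.
  pose t := tperm i i'; pose u := tperm (t k) k'.
  have ti : t i = i' by rewrite tpermL.
  have tk : i' != t k by rewrite -ti (inj_eq perm_inj).
  rewrite -(sum_permMl _ (t * u)%g); apply: eq_bigr => s _.
  by rewrite !permM ti tpermL tpermD 1?eq_sym.
have -> : n`!%:R * \sum_(p : 'I_n * 'I_n | p.1 != p.2) G p.1 p.2 =
    \sum_(p : 'I_n * 'I_n | p.1 != p.2) \sum_(s : 'S_n) G (s i) (s k).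
  rewrite (eq_bigr _ E) exchange_big/= -card_Sn mulr_natl -sumr_const.
  apply: eq_bigr => s _.
  have sinj : injective (fun p : 'I_n * 'I_n => (s p.1, s p.2)).
    by move=> [a b] [c d] /= [/perm_inj -> /perm_inj ->].
  by rewrite (reindex_inj sinj)/=; apply: eq_bigl => p; rewrite (inj_eq perm_inj).
rewrite sumr_const -[leLHS]mulr_natl ler_wpM2r ?sumr_ge0//.
by rewrite -natrX ler_nat (leq_trans (max_card _))// card_prod card_ord mulnn.
Qed.

Lemma sum_weight q : n%:R * \sum_(s : 'S_n) weight R q s = n`!%:R * total R q.
Proof.
rewrite /total; under eq_bigr do rewrite weightE.
rewrite exchange_big/= !mulr_sumr; apply: eq_bigr => i _.
by rewrite (sum_perm_image (fun j => (q i j)%:R)).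
Qed.

Lemma weight_flip q s (r : row_pair n) :
  weight R q s - weight R q (flip s r) =
  (q (val r).1 (s (val r).1))%:R + (q (val r).2 (s (val r).2))%:R
  - (q (val r).1 (s (val r).2))%:R - (q (val r).2 (s (val r).1))%:R.
Proof.
case: r => -[i k] /= ik; rewrite !weightE /flip/=.
rewrite [X in X - _](bigD1 i)//= [X in _ + X - _](bigD1 k) 1?eq_sym//=.
rewrite [X in _ - X](bigD1 i)//= [X in _ - (_ + X)](bigD1 k) 1?eq_sym//=.
rewrite !permM tpermL tpermR.
have -> : \sum_(a < n | (a != i) && (a != k)) (q a ((tperm i k * s)%g a))%:R =
    \sum_(a < n | (a != i) && (a != k)) (q a (s a))%:R :> R.
  by apply: eq_bigr => a /andP[ai ak]; rewrite permM tpermD// eq_sym.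
ring.
Qed.

Lemma sum_row_pair (F : 'I_n * 'I_n -> R) :
  \sum_(r : row_pair n) F (val r) = \sum_(p : 'I_n * 'I_n | p.1 != p.2) F p.
Proof. exact/esym/(big_sub [pred p : 'I_n * 'I_n | p.1 != p.2]). Qed.

Lemma card_row_pair_le : (#|{: row_pair n}| <= n ^ 2)%N.
Proof.
by rewrite card_sig (leq_trans (max_card _))// card_prod card_ord mulnn.
Qed.

(** Taking [(k, l)] to be a smallest entry of [q], the matrix with entries
[q i l + q k j - q k l] lies in the cone, and its distance to [q] is controlled
by the gains of the flips. *)
Lemma flip_gap q : n`!%:R * frob_norm (perpK (real_mx R q)) <=
  n%:R ^+ 2 * \sum_(r : row_pair n) \sum_(s : {perm _}) `|weight R q s - weight R q (flip s r)|.
Proof.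
have [[i0]|noI] := pselect (inhabited 'I_n); last first.
  rewrite (_ : frob_norm _ = 0) ?mulr0; last first.
    by rewrite /frob_norm /frob big1 ?sqrtr0// => i; case: noI; exists.
  by rewrite mulr_ge0 ?exprn_ge0// sumr_ge0// => r _; exact: sumr_ge0.
pose c i k j l : R := (q i j)%:R + (q k l)%:R - (q i l)%:R - (q k j)%:R.
pose p0 : 'I_n * 'I_n := (i0, i0).
case: (arg_minnP (fun p => q p.1 p.2) (erefl : xpredT p0)) => -[k l] _ /= kl_min.
pose y : 'M[R]_n := \matrix_(i, j) ((q i l)%:R + (q k j)%:R - (q k l)%:R).
have Ky : coneK y.
  split; last by move=> i j; rewrite mxE subr_ge0 -natrD ler_nat (leq_trans (kl_min (i, l) isT))// leq_addr.
  exists (fun i => (q i l)%:R - (q k l)%:R), (fun j => (q k j)%:R) => i j.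
  by rewrite mxE; ring.
apply: (@le_trans _ _ (n`!%:R * \sum_i \sum_j `|c i k j l|)).
  rewrite ler_wpM2l//; apply: le_trans (perpK_le _ Ky) _.
  apply: le_trans (frob_norm_le_sum _) _.
  apply: ler_sum => i _; apply: ler_sum => j _.
  by rewrite !mxE /c le_eqVlt; apply/orP; left; apply/eqP; congr `|_|; ring.
have E (r : row_pair n) (s : {perm _}) : `|weight R q s - weight R q (flip s r)| =
    `|c (val r).1 (val r).2 (s (val r).1) (s (val r).2)| by rewrite weight_flip.
under [in leRHS]eq_bigr do under eq_bigr do rewrite E.
rewrite (sum_row_pair (fun p => \sum_(s : {perm _}) `|c p.1 p.2 (s p.1) (s p.2)|)) [leRHS]mulr_sumr.
apply: (@le_trans _ _ (\sum_(p : 'I_n * 'I_n | p.1 != p.2)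
    n`!%:R * \sum_(a : 'I_n * 'I_n | a.1 != a.2) `|c p.1 p.2 a.1 a.2|)).
  rewrite -mulr_sumr; apply: ler_wpM2l => //.
  have sub : \sum_(i < n | i != k) \sum_(j < n | j != l) `|c i k j l| <=
      \sum_(p : 'I_n * 'I_n | p.1 != p.2)
        \sum_(a : 'I_n * 'I_n | a.1 != a.2) `|c p.1 p.2 a.1 a.2|.
    rewrite -(pair_big_dep xpredT (fun i k => i != k) (fun i k =>
      \sum_(a : 'I_n * 'I_n | a.1 != a.2) `|c i k a.1 a.2|))/=.
    rewrite big_mkcond; apply: ler_sum => i _; case: ifPn => ik; last first.
      by do 2!apply: sumr_ge0 => ? _.
    rewrite [leRHS](bigD1 k)//=; apply: ler_wpDr; first by do 2!apply: sumr_ge0 => ? _.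
    rewrite -(pair_big_dep xpredT (fun j l => j != l) (fun j l => `|c i k j l|))/=.
    rewrite big_mkcond; apply: ler_sum => j _; case: ifPn => jl; last exact: sumr_ge0.
    by rewrite [leRHS](bigD1 l)//=; apply: ler_wpDr => //; exact: sumr_ge0.
  apply: le_trans sub; rewrite [leLHS](bigD1 k)//= [X in X + _]big1 ?add0r; last first.
    by move=> j _; rewrite /c (_ : _ - _ = 0) ?normr0//; ring.
  apply: ler_sum => i _; rewrite [leLHS](bigD1 l)//= [X in X + _](_ : _ = 0) ?add0r//.
  by rewrite /c (_ : _ - _ = 0) ?normr0//; ring.
by apply: ler_sum => -[i j] /= ij; apply: (@sum_perm_image2 (fun a b => `|c i j a b|)).
Qed.

Lemma sum_tuple_cons (T : finType) d (F : d.+1.-tuple T -> R) :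
  \sum_t F t = \sum_x \sum_(t : d.-tuple T) F (cons_tuple x t).
Proof.
rewrite pair_big/= (reindex (fun p : T * d.-tuple T => cons_tuple p.1 p.2))//=.
exists (fun t => (thead t, behead_tuple t)) => [[x t] _|t _] /=.
  by rewrite theadE; congr pair; apply: val_inj.
by apply: val_inj; rewrite /= [in RHS](tuple_eta t).
Qed.

Lemma half_sum_absdiff_le (a b c : R) : a <= c -> b <= c ->
  2^-1 * (a + b + `|a - b|) <= c.
Proof. by move=> ac bc; case: (lerP b a) => ba; rewrite ?ger0_norm ?ltr0_norm ?subr_lt0 ?subr_ge0//; lra. Qed.

(** Two independent samples differ on average at least half as much as a sample
and its flip, by the triangle inequality through the other sample. *)
Lemma sample_gap q : n`!%:R ^+ 2 * frob_norm (perpK (real_mx R q)) <=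
  2 * n%:R ^+ 4 *
    \sum_(s1 : 'S_n) \sum_(s2 : 'S_n) `|weight R q s1 - weight R q s2|.
Proof.
set S := \sum_s1 _; pose w := weight R q.
have S0 : 0 <= S by do 2!apply: sumr_ge0 => ? _.
have H (r : row_pair n) : n`!%:R * \sum_(s : 'S_n) `|w s - w (flip s r)| <= 2 * S.
  have E : S = \sum_(s1 : 'S_n) \sum_(s2 : 'S_n) `|w s2 - w (flip s1 r)|.
    rewrite /S -(sum_permMl _ (tperm (val r).1 (val r).2)).
    by apply: eq_bigr => s1 _; apply: eq_bigr => s2 _; rewrite distrC.
  have -> : 2 * S = S + S by ring.
  rewrite {2}E /S -big_split/= -card_Sn mulr_natl -sumrMnl.
  apply: ler_sum => s1 _; rewrite -big_split/= -sumr_const; apply: ler_sum => s2 _.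
  by apply: le_trans (ler_normD _ _); rewrite addrA subrK.
have sumH : n`!%:R * \sum_(r : row_pair n) \sum_(s : 'S_n) `|w s - w (flip s r)| <=
    n%:R ^+ 2 * (2 * S).
  rewrite mulr_sumr; apply: le_trans (ler_sum _ (fun r _ => H r)) _.
  rewrite sumr_const -[leLHS]mulr_natl -natrX ler_wpM2r ?mulr_ge0// ler_nat.
  exact: card_row_pair_le.
have := ler_wpM2l (ler0n R n`!) (flip_gap q); rewrite mulrA -expr2 => /le_trans; apply.
rewrite mulrCA (_ : 2 * n%:R ^+ 4 * S = n%:R ^+ 2 * (n%:R ^+ 2 * (2 * S))); last ring.
by rewrite ler_wpM2l// exprn_ge0.
Qed.

Lemma foldl_flip_step_le ch q s (rs : seq (row_pair n)) : is_heaviest_choice R ch ->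
  weight R q s <= weight R q (foldl (flip_step ch q) s rs).
Proof.
move=> chP; elim: rs s => [//|r rs IH] s /=; apply: le_trans (IH _).
by have [//|_] := chP q [:: s; flip s r]; apply; rewrite mem_head.
Qed.

(** The maximum of two samples exceeds their average by half of their difference,
and further samples can only help. *)
Lemma power_of_d_gap d ch q : (0 < n)%N -> (2 <= d)%N -> is_heaviest_choice R ch ->
  total R q / n%:R + frob_norm (perpK (real_mx R q)) / (4 * n%:R ^+ 4) <=
  #|{: d.-tuple 'S_n}|%:R^-1 * \sum_(t : d.-tuple 'S_n) weight R q (ch q t).
Proof.
case: d => [//|[//|d]] n0 _ chP.
have nR : 0 < n%:R :> R by rewrite ltr0n.
have fR : 0 < n`!%:R :> R by rewrite ltr0n fact_gt0.
set c := #|{: d.-tuple 'S_n}|%:R : R.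
have c0 : 0 < c.
  by rewrite ltr0n; apply/card_gt0P; exists (nseq_tuple d (1%g : 'S_n)).
have cE : #|{: d.+2.-tuple 'S_n}|%:R = n`!%:R ^+ 2 * c.
  by rewrite /c !card_tuple card_Sn !expnS !natrM mulrA.
rewrite cE ler_pdivlMl; last by rewrite mulr_gt0// exprn_gt0.
set S := \sum_(s1 : 'S_n) \sum_(s2 : 'S_n) `|weight R q s1 - weight R q s2|.
apply: (@le_trans _ _ (c * (2^-1 * (2 * (n`!%:R * \sum_(s : 'S_n) weight R q s) + S)))).
  have Hw : \sum_(s : 'S_n) weight R q s = n`!%:R * (total R q / n%:R).
    by apply: (mulfI (lt0r_neq0 nR)); rewrite sum_weight; field; rewrite gt_eqF.
  have Hs : n`!%:R ^+ 2 * (frob_norm (perpK (real_mx R q)) / (4 * n%:R ^+ 4)) <= 2^-1 * S.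
    rewrite mulrA ler_pdivrMr; last by rewrite mulr_gt0// exprn_gt0.
    have := sample_gap q; rewrite -/S; nra.
  rewrite Hw -mulrA mulrCA ler_wpM2l ?(ltW c0)// mulrDr.
  by apply: le_trans (lerD (lexx _) Hs) _; rewrite le_eqVlt; apply/orP; left; apply/eqP; field; rewrite gt_eqF.
rewrite sum_tuple_cons.
have -> : 2 * (n`!%:R * \sum_(s : 'S_n) weight R q s) + S =
    \sum_(s1 : 'S_n) \sum_(s2 : 'S_n) (weight R q s1 + weight R q s2 +
      `|weight R q s1 - weight R q s2|).
  transitivity (\sum_(s1 : 'S_n) (n`!%:R * weight R q s1 + \sum_(s2 : 'S_n) weight R q s2
     + \sum_(s2 : 'S_n) `|weight R q s1 - weight R q s2|)).
    rewrite 2!big_split/= -mulr_sumr sumr_const card_Sn -/S; ring.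
  by apply: eq_bigr => s1 _; rewrite 2!big_split/= sumr_const card_Sn mulr_natl.
rewrite !mulr_sumr; apply: ler_sum => s1 _.
rewrite sum_tuple_cons !mulr_sumr; apply: ler_sum => s2 _.
rewrite /c mulr_natl -sumr_const; apply: ler_sum => t _.
have [//|_ H] := chP q (cons_tuple s1 (cons_tuple s2 t)).
by apply: half_sum_absdiff_le; apply: H; rewrite !inE eqxx ?orbT.
Qed.

(** A flip kept only when it improves gains, on average, half of the absolute
difference, since the flipped schedule is uniform too. *)
Lemma random_flip_gap d ch q : (1 < n)%N -> (1 <= d)%N -> is_heaviest_choice R ch ->
  total R q / n%:R + frob_norm (perpK (real_mx R q)) / (4 * n%:R ^+ 4) <=
  #|{: 'S_n * d.-tuple (row_pair n)}|%:R^-1 *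
  \sum_(xi : 'S_n * d.-tuple (row_pair n))
    weight R q (foldl (flip_step ch q) xi.1 xi.2).
Proof.
case: d => [//|d] n1 _ chP; have n0 := ltnW n1.
have nR : 0 < n%:R :> R by rewrite ltr0n.
have fR : 0 < n`!%:R :> R by rewrite ltr0n fact_gt0.
have r0 : row_pair n.
  by exists (Ordinal n0, Ordinal n1).
set c := #|{: d.-tuple (row_pair n)}|%:R : R.
set b := #|{: row_pair n}|%:R : R.
have c0 : 0 < c.
  by rewrite ltr0n; apply/card_gt0P; exists (nseq_tuple d r0).
have b0 : 0 < b by rewrite ltr0n; apply/card_gt0P; exists r0.
have b_le : b <= n%:R ^+ 2 by rewrite -natrX ler_nat card_row_pair_le.
have cE : #|{: 'S_n * d.+1.-tuple (row_pair n)}|%:R = n`!%:R * b * c.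
  by rewrite /c /b card_prod !card_tuple card_Sn expnS !natrM mulrA.
rewrite cE ler_pdivlMl; last by rewrite !mulr_gt0.
set S := \sum_(r : row_pair n) \sum_(s : 'S_n) `|weight R q s - weight R q (flip s r)|.
apply: (@le_trans _ _ (c * (2^-1 * (2 * (b * \sum_(s : 'S_n) weight R q s) + S)))).
  have Hw : \sum_(s : 'S_n) weight R q s = n`!%:R * (total R q / n%:R).
    by apply: (mulfI (lt0r_neq0 nR)); rewrite sum_weight; field; rewrite gt_eqF.
  have Hs : n`!%:R * b * (frob_norm (perpK (real_mx R q)) / (4 * n%:R ^+ 4)) <= 2^-1 * S.
    rewrite mulrA ler_pdivrMr; last by rewrite mulr_gt0// exprn_gt0.
    have n2 : 0 <= n%:R ^+ 2 :> R by rewrite exprn_ge0.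
    have H1 := ler_wpM2l n2 (flip_gap q); rewrite -/S in H1.
    have H2 := ler_wpM2r (mulr_ge0 (ltW fR) (frob_norm_ge0 (perpK (real_mx R q)))) b_le.
    have S0 : 0 <= n%:R ^+ 2 * (n%:R ^+ 2 * S).
      by rewrite !mulr_ge0//; do 2!apply: sumr_ge0 => ? _.
    have -> : 2^-1 * S * (4 * n%:R ^+ 4) = 2 * (n%:R ^+ 2 * (n%:R ^+ 2 * S)) by field.
    rewrite mulrAC -mulrA mulrC -mulrA in H2 *; rewrite (mulrC _ b) in H2 *; lra.
  rewrite Hw (mulrC _ c) -(mulrA c) ler_wpM2l ?(ltW c0)// mulrDr.
  apply: le_trans (lerD (lexx _) Hs) _; rewrite le_eqVlt; apply/orP; left; apply/eqP.
  by field; rewrite gt_eqF.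
have -> : \sum_(xi : 'S_n * d.+1.-tuple (row_pair n))
    weight R q (foldl (flip_step ch q) xi.1 xi.2) =
    \sum_(r : row_pair n) \sum_(s : 'S_n) \sum_(t : d.-tuple (row_pair n))
      weight R q (foldl (flip_step ch q) (flip_step ch q s r) t).
  rewrite -(pair_big xpredT xpredT (fun s (t : d.+1.-tuple (row_pair n)) =>
    weight R q (foldl (flip_step ch q) s t)))/= exchange_big/=.
  rewrite sum_tuple_cons; apply: eq_bigr => r _; rewrite exchange_big/=.
  by apply: eq_bigr.
have -> : 2 * (b * \sum_(s : 'S_n) weight R q s) + S =
    \sum_(r : row_pair n) \sum_(s : 'S_n) (weight R q s + weight R q (flip s r) +
      `|weight R q s - weight R q (flip s r)|).
  transitivity (\sum_(r : row_pair n) (2 * (\sum_(s : 'S_n) weight R q s) +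
     \sum_(s : 'S_n) `|weight R q s - weight R q (flip s r)|)).
    by rewrite big_split/= sumr_const -[in RHS](mulr_natl _ #|_|) /S /b; ring.
  apply: eq_bigr => r _; rewrite 2!big_split/=; congr (_ + _).
  by rewrite mulr_natl mulr2n; congr (_ + _); rewrite -(sum_permMl _ (tperm (val r).1 (val r).2)).
rewrite !mulr_sumr; apply: ler_sum => r _.
rewrite !mulr_sumr; apply: ler_sum => s _.
rewrite /c mulr_natl -sumr_const; apply: ler_sum => t _.
apply: le_trans (foldl_flip_step_le _ _ _ chP).
have [//|_ H] := chP q [:: s; flip s r].
by apply: half_sum_absdiff_le; apply: H; rewrite !inE eqxx ?orbT.
Qed.

End UniformPermutations.

(** * Bernoulli arrivals *)

Section FiniteExpectation.
Variables (R : realType) (U : finType) (p : U -> R).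
Implicit Types F G : U -> R.

Definition fmean F : R := \sum_u p u * F u.

Hypotheses (p0 : forall u, 0 <= p u) (p1 : \sum_u p u = 1).

Lemma fmean_le F G : (forall u, F u <= G u) -> fmean F <= fmean G.
Proof. by move=> FG; apply: ler_sum => u _; exact: ler_wpM2l. Qed.

Lemma fmeanD F G : fmean (fun u => F u + G u) = fmean F + fmean G.
Proof. by rewrite /fmean -big_split; apply: eq_bigr => u _; rewrite mulrDr. Qed.

Lemma fmeanZ c F : fmean (fun u => c * F u) = c * fmean F.
Proof. by rewrite /fmean mulr_sumr; apply: eq_bigr => u _; rewrite mulrCA. Qed.

Lemma fmeanB F G : fmean (fun u => F u - G u) = fmean F - fmean G.
Proof. by rewrite /fmean -sumrB; apply: eq_bigr => u _; rewrite mulrBr. Qed.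

Lemma fmean_cst c : fmean (fun=> c) = c.
Proof. by rewrite /fmean -mulr_suml p1 mul1r. Qed.

Lemma fmean_sum (I : finType) (F : I -> U -> R) :
  fmean (fun u => \sum_i F i u) = \sum_i fmean (F i).
Proof.
rewrite /fmean exchange_big; apply: eq_bigr => u _; exact: mulr_sumr.
Qed.

Lemma expR_le_quadratic (x : R) : `|x| <= 3^-1 -> expR x <= 1 + x + x ^+ 2.
Proof.
rewrite ler_norml => /andP[x1 x2].
have H : expR x = (expR (- (x / 2)))^-1 ^+ 2.
  by rewrite -expRN opprK -expRM_natl -mulr_natl; congr expR; field.
have e0 : 0 < 1 - x / 2 by lra.
have le1 : 1 - x / 2 <= expR (- (x / 2)) by exact: expR_ge1Dx.
rewrite H; apply: (@le_trans _ _ ((1 - x / 2)^-1 ^+ 2)).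
  by rewrite lerXn2r ?nnegrE ?invr_ge0 ?expR_ge0 ?(ltW e0)// lef_pV2 ?posrE ?expR_gt0.
rewrite exprVn invf_ple ?posrE ?exprn_gt0//; last by nra.
rewrite -[leLHS]mul1r ler_pdivrMr; nra.
Qed.

(** Negative mean increments make the exponential contract, once [eta] is small
against the variance. *)
Lemma exp_drift (Z : U -> R) (eta D m v : R) : 0 <= eta -> eta * D <= 3^-1 ->
  (forall u, `|Z u| <= D) -> fmean Z <= - m -> fmean (fun u => Z u ^+ 2) <= v ->
  fmean (fun u => expR (eta * Z u)) <= 1 - eta * m + eta ^+ 2 * v.
Proof.
move=> eta0 etaD ZD Zm Zv.
apply: (@le_trans _ _ (fmean (fun u => 1 + eta * Z u + eta ^+ 2 * Z u ^+ 2))).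
  apply: fmean_le => u; rewrite -exprMn; apply: expR_le_quadratic.
  by rewrite normrM (ger0_norm eta0) (le_trans _ etaD)// ler_wpM2l.
rewrite !fmeanD !fmeanZ fmean_cst.
have := ler_wpM2l eta0 Zm; have := ler_wpM2l (sqr_ge0 eta) Zv; lra.
Qed.

End FiniteExpectation.

Definition arr n := {ffun 'I_n * 'I_n -> bool}.

Section Arrivals.
Variables (R : realType) (n : nat) (lam : R).
Hypothesis lam01 : 0 <= lam <= 1.
Implicit Types (a : arr n).

Definition bern a : R := \prod_k (if a k then lam else 1 - lam).

Lemma bern_ge0 a : 0 <= bern a.
Proof. by apply: prodr_ge0 => k _; move/andP: lam01 => [? ?]; case: ifP => _; lra. Qed.

Lemma bern_gt0 a : 0 < lam < 1 -> 0 < bern a.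
Proof. by move=> /andP[? ?]; apply: prodr_gt0 => k _; case: ifP => _; lra. Qed.

Lemma mean_bern_prod (G : 'I_n * 'I_n -> bool -> R) :
  fmean bern (fun a => \prod_k G k (a k)) =
  \prod_k (lam * G k true + (1 - lam) * G k false).
Proof.
transitivity (\prod_k \sum_b ((if b then lam else 1 - lam) * G k b)).
  rewrite bigA_distr_bigA; apply: eq_bigr => a _.
  by rewrite /bern -big_split.
by apply: eq_bigr => k _; rewrite big_bool.
Qed.

Lemma bern_sum1 : \sum_a bern a = 1.
Proof.
have := mean_bern_prod (fun _ _ => 1).
rewrite [RHS]big1 => [<-|k _]; last by ring.
by apply: eq_bigr => a _; rewrite big1// mulr1.
Qed.

Lemma mean_bern_coord k (h : bool -> R) :
  fmean bern (fun a => h (a k)) = lam * h true + (1 - lam) * h false.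
Proof.
have := mean_bern_prod (fun k' b => if k' == k then h b else 1).
rewrite [RHS](bigD1 k)//= [X in _ * X]big1 => [|k' /negbTE ->]; last by ring.
rewrite eqxx mulr1 => <-; apply: eq_bigr => a _; congr (_ * _).
by rewrite (bigD1 k)//= big1 => [|k' /negbTE ->//]; rewrite eqxx mulr1.
Qed.

Lemma mean_bern_coord2 k l (h h' : bool -> R) : k != l ->
  fmean bern (fun a => h (a k) * h' (a l)) =
  (lam * h true + (1 - lam) * h false) * (lam * h' true + (1 - lam) * h' false).
Proof.
move=> kl.
have lk : (l == k) = false by rewrite eq_sym (negbTE kl).
have := mean_bern_prod (fun k' b => if k' == k then h b else if k' == l then h' b else 1).
rewrite [RHS](bigD1 k)//= [X in _ * X](bigD1 l) ?lk//=.
rewrite [X in _ * (_ * X)]big1 => [|k' /andP[/negbTE -> /negbTE ->]]; last by ring.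
rewrite !eqxx mulr1 => <-; apply: eq_bigr => a _; congr (_ * _).
rewrite (bigD1 k)//= (bigD1 l) ?lk//= big1 => [|k' /andP[/negbTE -> /negbTE ->]//].
by rewrite !eqxx ?lk mulr1.
Qed.

Lemma mean_arrival k : fmean bern (fun a => (a k)%:R) = lam.
Proof. by rewrite (mean_bern_coord k (fun b => b%:R)) mulr1 mulr0 addr0. Qed.

Lemma variance_arrivals (c : 'I_n * 'I_n -> R) :
  fmean bern (fun a => (\sum_k c k * ((a k)%:R - lam)) ^+ 2) =
  lam * (1 - lam) * \sum_k c k ^+ 2.
Proof.
transitivity (\sum_k \sum_l c k * c l *
    fmean bern (fun a => ((a k)%:R - lam) * ((a l)%:R - lam))).
  have E a : (\sum_k c k * ((a k)%:R - lam)) ^+ 2 =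
      \sum_k \sum_l c k * c l * (((a k)%:R - lam) * ((a l)%:R - lam)).
    rewrite expr2 mulr_suml; apply: eq_bigr => k _; rewrite mulr_sumr.
    by apply: eq_bigr => l _; ring.
  rewrite (funext E) fmean_sum; apply: eq_bigr => k _; rewrite fmean_sum.
  by apply: eq_bigr => l _; rewrite fmeanZ.
rewrite mulr_sumr; apply: eq_bigr => k _; rewrite (bigD1 k)//= big1 ?addr0 => [|l lk].
  under [in LHS]eq_fun do rewrite -expr2.
  by rewrite (mean_bern_coord k (fun b => (b%:R - lam) ^+ 2)) /=; ring.
rewrite eq_sym in lk.
rewrite (mean_bern_coord2 (fun b => b%:R - lam) (fun b => b%:R - lam) lk) /=; ring.
Qed.

End Arrivals.

(** * One slot of the switch *)

Section OneSlot.
Variables (R : realType) (n : nat).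
Implicit Types (q : 'M[nat]_n) (a : arr n) (s : 'S_n) (x y z : 'M[R]_n).

Definition nextq q a s : 'M[nat]_n :=
  \matrix_(i, j) (q i j + a (i, j) - (s i == j))%N.

Definition arrmx a : 'M[R]_n := \matrix_(i, j) (a (i, j))%:R.

(** The unused service, which the truncation at zero gives back. *)
Definition unused q a s : 'M[R]_n :=
  \matrix_(i, j) ((s i == j) && (q i j + a (i, j) == 0)%N)%:R.

Definition increment q a s : 'M[R]_n := arrmx a - perm_mx s + unused q a s.

Lemma real_nextq q a s : real_mx R (nextq q a s) = real_mx R q + increment q a s.
Proof.
apply/matrixP => i j; rewrite !mxE.
case: (s i == j); case: (a (i, j)); case: (q i j) => [|k] /=;
  rewrite ?addn0 ?addn1 ?subn0 ?subn1 /= -?natr1 ?mulr0n ?mulr1n; ring.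
Qed.

Lemma unused_ge0 q a s i j : 0 <= unused q a s i j.
Proof. by rewrite mxE. Qed.

Lemma frob_queue_unused q a s : frob (real_mx R q) (unused q a s) = 0.
Proof.
rewrite /frob big1// => i _; rewrite big1// => j _; rewrite !mxE.
case: (q i j + a (i, j) =P 0)%N => [|_]; last by rewrite andbF mulr0.
by move=> /eqP; rewrite addn_eq0 => /andP[/eqP -> _]; rewrite mul0r.
Qed.

Lemma frob_nextq_unused q a s : frob (real_mx R (nextq q a s)) (unused q a s) = 0.
Proof.
rewrite /frob big1// => i _; rewrite big1// => j _; rewrite !mxE.
by case: (q i j + a (i, j) =P 0)%N => [->|_]; rewrite ?sub0n ?mul0r// andbF mulr0.
Qed.

Lemma sqr_increment_le q a s i j :
  increment q a s i j ^+ 2 <= Num.min 1 ((a (i, j))%:R + (s i == j)%:R).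
Proof.
rewrite !mxE le_min; case: (s i == j); case: (a (i, j)) => /=; rewrite ?addn1 ?addn0;
  case: (q i j == 0)%N => /=; apply/andP; split; lra.
Qed.

Lemma sum_perm_row s i : \sum_j (s i == j)%:R = 1 :> R.
Proof. by rewrite (bigD1 (s i))//= eqxx big1 ?addr0// => j /negbTE; rewrite eq_sym => ->. Qed.

Lemma sum_perm_col s j : \sum_i (s i == j)%:R = 1 :> R.
Proof.
rewrite (bigD1 ((s^-1)%g j))//= permKV eqxx big1 ?addr0// => i ij.
by case: eqP => // sij; rewrite -sij permK eqxx in ij.
Qed.

Lemma frob_increment_le q a s : frob_norm (increment q a s) ^+ 2 <=
  \sum_i \sum_j (a (i, j))%:R + n%:R.
Proof.
have -> : n%:R = \sum_(i < n) \sum_j (s i == j)%:R :> R.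
  by under eq_bigr do rewrite sum_perm_row; rewrite sumr_const card_ord.
rewrite sqr_frob_norm -big_split; apply: ler_sum => i _.
rewrite -big_split; apply: ler_sum => j _; rewrite -expr2.
by apply: le_trans (sqr_increment_le q a s i j) _; rewrite ge_min lexx orbT.
Qed.

Lemma frob_increment_le_n q a s : frob_norm (increment q a s) <= n%:R.
Proof.
rewrite frob_norm_sqr_le// expr2 -[X in X * _](_ : \sum_(i < n) 1 = _); last first.
  by rewrite sumr_const card_ord.
rewrite mulr_suml; apply: ler_sum => i _; rewrite mul1r.
have -> : n%:R = \sum_(j < n) 1 :> R by rewrite sumr_const card_ord.
apply: ler_sum => j _; rewrite -expr2.
by apply: le_trans (sqr_increment_le q a s i j) _; rewrite ge_min lexx.
Qed.

Lemma total_frob q : total R q = frob (real_mx R q) (const_mx 1).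
Proof. by rewrite frob_const mul1r; do 2!apply: eq_bigr => ? _; rewrite mxE. Qed.

Lemma frob_norm_le_total q : frob_norm (real_mx R q) <= total R q.
Proof.
apply: le_trans (frob_norm_le_sum _) _.
by do 2!apply: ler_sum => ? _; rewrite mxE ger0_norm.
Qed.

Lemma sum_le_frob_norm x : `|\sum_i \sum_j x i j| <= n%:R * frob_norm x.
Proof.
have -> : \sum_i \sum_j x i j = frob x (const_mx 1) by rewrite frob_const mul1r.
apply: le_trans (cauchy_schwarz_abs _ _) _; rewrite mulrC ler_wpM2r ?frob_norm_ge0//.
rewrite frob_norm_sqr_le// frob_const mul1r.
under eq_bigr do under eq_bigr do rewrite mxE.
by under eq_bigr do rewrite sumr_const card_ord; rewrite sumr_const card_ord -[leLHS]mulr_natr expr2.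
Qed.

Lemma coneS_frob_perm z s : coneS z ->
  n%:R * frob z (perm_mx s) = \sum_i \sum_j z i j.
Proof.
move=> [w [w' E]]; rewrite frob_perm mulr_sumr.
transitivity (\sum_(i < n) (n%:R * w i + \sum_j w' j)).
  rewrite big_split/= sumr_const card_ord -[X in _ = _ + X]mulr_natl [X in _ = _ + X]mulr_sumr.
  rewrite [X in _ = _ + X](reindex_inj (@perm_inj _ s)) -big_split.
  by apply: eq_bigr => i _; rewrite E mulrDr.
apply: eq_bigr => i _; under [RHS]eq_bigr do rewrite E.
by rewrite big_split/= sumr_const card_ord mulr_natl.
Qed.

End OneSlot.

Section SlotDrift.
Variables (R : realType) (n : nat) (lam : R) (k : 'S_n -> R).
Hypotheses (n0 : (0 < n)%N) (lam0 : 0 <= lam) (lam_n : n%:R * lam <= 1).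
Hypotheses (k0 : forall s, 0 <= k s) (k1 : \sum_s k s = 1).
Implicit Types (q : 'M[nat]_n) (x y z : 'M[R]_n).

Definition slot_law (u : 'S_n * arr n) : R := k u.1 * bern lam u.2.

Let nR : 1 <= n%:R :> R. Proof. by rewrite ler1n. Qed.

Let lam01 : 0 <= lam <= 1.
Proof. by rewrite lam0/=; move: nR lam_n lam0; nra. Qed.

Lemma slot_law_ge0 u : 0 <= slot_law u.
Proof. by rewrite mulr_ge0// bern_ge0. Qed.

Lemma slot_law_fst (F : 'S_n -> R) : fmean slot_law (fun u => F u.1) = \sum_s k s * F s.
Proof.
rewrite /fmean -(pair_bigA _ (fun s a => slot_law (s, a) * F s))/=.
apply: eq_bigr => s _; rewrite /slot_law/=.
by under eq_bigr do rewrite mulrAC; rewrite -mulr_sumr bern_sum1 mulr1.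
Qed.

Lemma slot_law_snd (F : arr n -> R) : fmean slot_law (fun u => F u.2) = fmean (bern lam) F.
Proof.
rewrite /fmean -(pair_bigA _ (fun s a => slot_law (s, a) * F a))/= /slot_law/=.
under eq_bigr do under eq_bigr do rewrite -mulrA.
by under eq_bigr do rewrite -mulr_sumr; rewrite -mulr_suml k1 mul1r.
Qed.

Lemma slot_law_sum1 : \sum_u slot_law u = 1.
Proof.
have := slot_law_fst (fun=> 1); under [in RHS]eq_bigr do rewrite mulr1.
by rewrite k1 => <-; apply: eq_bigr => u _; rewrite mulr1.
Qed.

Local Notation E := (fmean slot_law).

Lemma slot_mean_frob x : E (fun u => frob x (arrmx R u.2 - perm_mx u.1)) =
  lam * (\sum_i \sum_j x i j) - \sum_s k s * frob x (perm_mx s).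
Proof.
rewrite -(slot_law_fst (fun s => frob x (perm_mx s))).
rewrite (_ : lam * _ = E (fun u => frob x (arrmx R u.2))).
  by rewrite -fmeanB; congr fmean; apply/funext => u; rewrite frobBr.
rewrite (slot_law_snd (fun a => frob x (arrmx R a))) /frob fmean_sum mulr_sumr.
apply: eq_bigr => i _; rewrite fmean_sum mulr_sumr; apply: eq_bigr => j _.
rewrite fmeanZ mulrC; congr (_ * _).
by rewrite -[LHS](mean_arrival (lam) (i, j)); congr fmean; apply/funext => a; rewrite mxE.
Qed.

Lemma slot_mean_sqr_increment q :
  E (fun u => frob_norm (increment R q u.2 u.1) ^+ 2) <= 2 * n%:R.
Proof.
apply: le_trans (fmean_le slot_law_ge0 (fun u => frob_increment_le _ q u.2 u.1)) _.
rewrite (slot_law_snd (fun a => \sum_i \sum_j (a (i, j))%:R + n%:R)) fmeanD.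
rewrite (fmean_cst (bern_sum1 _ _)) fmean_sum.
under eq_bigr do rewrite fmean_sum; under eq_bigr do under eq_bigr do rewrite mean_arrival.
under eq_bigr do rewrite sumr_const card_ord -mulr_natl.
rewrite sumr_const card_ord -[X in X + _]mulr_natl.
by move: nR lam_n lam0; nra.
Qed.

(** The decay rate of the exponential Lyapunov function of a norm with drift
[- w] outside a ball of radius of order [(n + c) / w]. *)
Definition rate (w c : R) : R := w / (8 * (n%:R + c)).

Lemma rate_gt0 w c : 0 < w -> 0 <= c -> 0 < rate w c.
Proof. by move=> w0 c0; rewrite divr_gt0// mulr_gt0// ltr_pwDl// ltr0n. Qed.

Lemma rate_le1 w c : 0 < w <= 1 -> 0 <= c -> rate w c <= 1.
Proof.
move=> /andP[_ w1] c0; have n1 := nR.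
by rewrite ler_pdivrMr ?mul1r; lra.
Qed.

(** Far from the origin the norm of [y + increment] is, to first order, moved by
the component of the increment along [y]; near it the function is bounded. *)
Lemma slot_exp_drift q y (w c : R) : 0 < w <= 1 -> 0 <= c ->
  E (fun u => frob y (increment R q u.2 u.1)) <= - w * frob_norm y + c ->
  E (fun u => expR (rate w c * frob_norm (y + increment R q u.2 u.1))) <=
  (1 - rate w c * w / 2) * expR (rate w c * frob_norm y) + 3.
Proof.
move=> /andP[w0 w1] c0 drift.
set eta := rate w c; pose N := n%:R + c : R.
have n1 := nR.
have N1 : 1 <= N by rewrite /N; lra.
have nN : n%:R <= N by rewrite /N lerDl.
have N0 : 0 < N by lra.
have eta0 : 0 < eta by exact: rate_gt0.
have etaN : eta * N = w / 8 by rewrite /eta /rate -/N; field; rewrite gt_eqF.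
have etan : eta * n%:R <= 8^-1.
  by apply: le_trans (ler_wpM2l (ltW eta0) nN) _; rewrite etaN; lra.
pose D u := increment R q u.2 u.1; pose f := frob_norm y.
have D_le u : frob_norm (D u) <= n%:R by exact: frob_increment_le_n.
have f0 : 0 <= f by exact: frob_norm_ge0.
have upper u : frob_norm (y + D u) <= f + n%:R.
  by apply: le_trans (frob_norm_triangle _ _) _; rewrite lerD2l.
have [near|far] := ltP f (4 * N / w).
  have e3 : forall u, expR (eta * frob_norm (y + D u)) <= 3.
    move=> u; apply: (@le_trans _ _ (expR (5 / 8))).
      rewrite ler_expR; apply: le_trans (ler_wpM2l (ltW eta0) (upper u)) _.
      have : eta * f <= 2^-1.
        apply: le_trans (ler_wpM2l (ltW eta0) (ltW near)) _.
        by rewrite mulrA mulrCA etaN le_eqVlt; apply/orP; left; apply/eqP; field; rewrite gt_eqF.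
      by rewrite mulrDr; lra.
    have h : 3 / 8 <= expR (- (5 / 8)) :> R.
      by apply: le_trans (expR_ge1Dx _); lra.
    by rewrite -(opprK (5 / 8)) expRN invf_ple ?posrE ?expR_gt0//; lra.
  apply: le_trans (fmean_le slot_law_ge0 e3) _.
  rewrite (fmean_cst slot_law_sum1) lerDr mulr_ge0 ?expR_ge0// subr_ge0.
  have : eta * 1 <= eta * N by rewrite ler_wpM2l// ltW.
  by rewrite mulr1 etaN; nra.
have fp : 0 < f by apply: lt_le_trans far; rewrite divr_gt0// mulr_gt0.
pose Z u := frob_norm (y + D u) - f.
have ZD u : `|Z u| <= frob_norm (D u).
  rewrite ler_norml; apply/andP; split; last first.
    by rewrite /Z lerBlDl frob_norm_triangle.
  have := frob_norm_triangle (y + D u) (- D u).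
  by rewrite addrK frob_normN /Z -/f; lra.
have Z_le u : Z u <= f^-1 * frob y (D u) + (2 * f)^-1 * frob_norm (D u) ^+ 2.
  have t0 : 0 <= f + (f^-1 * frob y (D u) + (2 * f)^-1 * frob_norm (D u) ^+ 2).
    have -> : f + (f^-1 * frob y (D u) + (2 * f)^-1 * frob_norm (D u) ^+ 2) =
        (2 * f)^-1 * (f ^+ 2 + frob_norm (y + D u) ^+ 2).
      by rewrite sqr_frob_normD -/f; field; rewrite gt_eqF.
    by rewrite mulr_ge0 ?invr_ge0 ?mulr_ge0// addr_ge0// sqr_ge0.
  rewrite /Z lerBlDl -(ler_pXn2r (n := 2))// ?nnegrE ?frob_norm_ge0//.
  rewrite sqr_frob_normD -/f -subr_ge0.
  set t := _ + (2 * f)^-1 * _; rewrite (_ : _ - _ = t ^+ 2) ?sqr_ge0//.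
  have : 2 * f * t = 2 * frob y (D u) + frob_norm (D u) ^+ 2.
    by rewrite /t; field; rewrite gt_eqF.
  have -> : (f + t) ^+ 2 = f ^+ 2 + 2 * f * t + t ^+ 2 by ring.
  by move=> ->; ring.
have EZ : E Z <= - (3 / 4 * w).
  apply: le_trans (fmean_le slot_law_ge0 Z_le) _; rewrite fmeanD !fmeanZ.
  apply: (@le_trans _ _ (f^-1 * (- w * f + c) + (2 * f)^-1 * (2 * n%:R))).
    apply: lerD; apply: ler_wpM2l; rewrite ?invr_ge0 ?mulr_ge0//.
    exact: slot_mean_sqr_increment.
  have -> : f^-1 * (- w * f + c) + (2 * f)^-1 * (2 * n%:R) = N / f - w.
    by rewrite /N; field; rewrite gt_eqF.
  have : N / f <= w / 4; last by lra.
  by rewrite ler_pdivrMr//; rewrite ler_pdivrMr// in far; lra.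
have EZ2 : E (fun u => Z u ^+ 2) <= 2 * N.
  apply: (@le_trans _ _ (2 * n%:R)); last by lra.
  apply: le_trans (slot_mean_sqr_increment q).
  apply: (fmean_le slot_law_ge0) => u.
  by rewrite -(real_normK (num_real (Z u))) lerXn2r ?nnegrE ?frob_norm_ge0 ?ZD.
have := @exp_drift _ _ _ slot_law_ge0 slot_law_sum1 Z eta n%:R _ _ (ltW eta0) _ _ EZ EZ2.
have ZDn u : `|Z u| <= n%:R by apply: le_trans (ZD u) _.
move=> /(_ (le_trans etan _) ZDn); rewrite lef_pV2 ?posrE// ler_nat => /(_ isT) H.
rewrite (_ : (fun u => _) = fun u => expR (eta * f) * expR (eta * Z u)); last first.
  by apply/funext => u; rewrite -expRD -mulrDr; congr (expR (_ * _)); rewrite /Z; ring.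
rewrite fmeanZ mulrC.
apply: (@le_trans _ _ ((1 - eta * w / 2) * expR (eta * f))); last by lra.
rewrite ler_wpM2r ?expR_ge0//; apply: le_trans H _.
have : eta ^+ 2 * (2 * N) = eta * w / 4 by rewrite expr2 (mulrC 2) mulrA -(mulrA eta) etaN; field.
by lra.
Qed.

End SlotDrift.

(** * The quadratic form of the parallel component *)

Section ParallelForm.
Variables (R : realType) (n : nat).
Hypothesis n0 : (0 < n)%N.
Implicit Types (x y z u : 'M[R]_n).

Let nR : 1 <= n%:R :> R. Proof. by rewrite ler1n. Qed.

Definition rowsum x i : R := \sum_j x i j.
Definition colsum x j : R := \sum_i x i j.
Definition entrysum x : R := \sum_i \sum_j x i j.

(** [n] times the orthogonal projection of [x] onto [coneS]. *)
Definition parmx x : 'M[R]_n :=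
  \matrix_(i, j) (rowsum x i + colsum x j - entrysum x / n%:R).

Lemma rowsumD x y i : rowsum (x + y) i = rowsum x i + rowsum y i.
Proof. by rewrite /rowsum -big_split; apply: eq_bigr => j _; rewrite mxE. Qed.

Lemma colsumD x y j : colsum (x + y) j = colsum x j + colsum y j.
Proof. by rewrite /colsum -big_split; apply: eq_bigr => i _; rewrite mxE. Qed.

Lemma entrysumD x y : entrysum (x + y) = entrysum x + entrysum y.
Proof. by rewrite /entrysum -big_split; apply: eq_bigr => i _; exact: rowsumD. Qed.

Lemma entrysum_col x : entrysum x = \sum_j colsum x j.
Proof. by rewrite /entrysum exchange_big. Qed.

Lemma parmxD x y : parmx (x + y) = parmx x + parmx y.
Proof. by apply/matrixP => i j; rewrite !mxE rowsumD colsumD entrysumD; ring. Qed.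

Lemma parmxN x : parmx (- x) = - parmx x.
Proof.
have z0 : parmx 0 = 0.
  apply/matrixP => i j; rewrite !mxE /rowsum /colsum /entrysum.
  rewrite !big1 => [|? _|? _|? _]; rewrite ?mxE ?mul0r ?subr0 ?addr0//.
  by rewrite big1// => ? _; rewrite mxE.
by apply/eqP; rewrite -subr_eq0 opprK -parmxD addNr z0.
Qed.

Lemma frob_parmx x y : frob (parmx x) y =
  \sum_i rowsum x i * rowsum y i + \sum_j colsum x j * colsum y j
  - entrysum x * entrysum y / n%:R.
Proof.
have E : frob (parmx x) y = \sum_i \sum_j rowsum x i * y i j +
    \sum_i \sum_j colsum x j * y i j - \sum_i \sum_j entrysum x / n%:R * y i j.
  rewrite -big_split -sumrB; apply: eq_bigr => i _ /=.
  rewrite -big_split -sumrB; apply: eq_bigr => j _ /=.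
  by rewrite mxE; ring.
rewrite E; congr (_ + _ - _).
- by apply: eq_bigr => i _; rewrite mulr_sumr.
- by rewrite exchange_big; apply: eq_bigr => j _; rewrite mulr_sumr.
- by rewrite mulrAC mulr_sumr; apply: eq_bigr => i _; rewrite mulr_sumr.
Qed.

Lemma frob_parmxC x y : frob (parmx x) y = frob (parmx y) x.
Proof.
rewrite !frob_parmx (mulrC (entrysum x)).
by congr (_ + _ - _); apply: eq_bigr => i _; rewrite mulrC.
Qed.

Lemma parmx_coneS z : coneS z -> parmx z = n%:R *: z.
Proof.
move=> [w [w' E]]; apply/matrixP => i j; rewrite !mxE /entrysum.
have rE k : rowsum z k = n%:R * w k + \sum_l w' l.
  rewrite /rowsum; under eq_bigr do rewrite E.
  by rewrite big_split/= sumr_const card_ord mulr_natl.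
have cE l : colsum z l = \sum_k w k + n%:R * w' l.
  rewrite /colsum; under eq_bigr do rewrite E.
  by rewrite big_split/= sumr_const card_ord mulr_natl.
rewrite rE cE (eq_bigr _ (fun k _ => rE k)) big_split/= -mulr_sumr sumr_const card_ord.
by rewrite -(mulr_natl (\sum_l w' l)) E; field; rewrite gt_eqF// ltr0n.
Qed.

Lemma coneS_parmx x : coneS (parmx x).
Proof.
exists (rowsum x), (fun j => colsum x j - entrysum x / n%:R) => i j.
by rewrite mxE addrA.
Qed.

Lemma entrysum_parmx x : entrysum (parmx x) = n%:R * entrysum x.
Proof.
have E : entrysum (parmx x) = \sum_i (n%:R * rowsum x i).
  apply: eq_bigr => i _; under eq_bigr do rewrite mxE.
  rewrite !big_split/= !sumr_const !card_ord -entrysum_col.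
  rewrite -(mulr_natl (rowsum x i)) -[X in _ + X](mulr_natl _ n).
  by field; rewrite gt_eqF// ltr0n.
by rewrite E -mulr_sumr.
Qed.

Lemma rowsum_le x i : `|rowsum x i| <= n%:R * frob_norm x.
Proof.
apply: le_trans (ler_norm_sum _ _ _) _.
apply: le_trans (ler_sum _ (fun j _ => entry_le_frob_norm x i j)) _.
by rewrite sumr_const card_ord mulr_natl.
Qed.

Lemma colsum_le x j : `|colsum x j| <= n%:R * frob_norm x.
Proof.
apply: le_trans (ler_norm_sum _ _ _) _.
apply: le_trans (ler_sum _ (fun i _ => entry_le_frob_norm x i j)) _.
by rewrite sumr_const card_ord mulr_natl.
Qed.

Lemma entrysum_le x : `|entrysum x| <= n%:R * frob_norm x.
Proof. exact: sum_le_frob_norm. Qed.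

Lemma parmx_sub_le x i j : `|(parmx x - n%:R *: x) i j| <= 4 * n%:R * frob_norm x.
Proof.
have f0 := frob_norm_ge0 x.
have T : `|entrysum x / n%:R| <= n%:R * frob_norm x.
  rewrite normrM normfV (ger0_norm (ler0n _ n)) ler_pdivrMr ?ltr0n//.
  apply: le_trans (entrysum_le x) _.
  by rewrite -[leLHS]mulr1 ler_wpM2l// mulr_ge0.
have X : `|n%:R * x i j| <= n%:R * frob_norm x.
  by rewrite normrM (ger0_norm (ler0n _ n)) ler_wpM2l// entry_le_frob_norm.
rewrite !mxE; apply: le_trans (ler_normB _ _) _; apply: le_trans (lerD _ X) (_ : 3 * (n%:R * frob_norm x) + _ <= _).
  apply: le_trans (ler_normB _ _) _; apply: le_trans (lerD (ler_normD _ _) T) _.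
  by have := rowsum_le x i; have := colsum_le x j; lra.
by lra.
Qed.

Lemma frob_parmx_le x : `|frob (parmx x) x| <= 3 * n%:R ^+ 3 * frob_norm x ^+ 2.
Proof.
have f0 := frob_norm_ge0 x.
have sq (t : R) : `|t| <= n%:R * frob_norm x -> `|t * t| <= n%:R ^+ 2 * frob_norm x ^+ 2.
  by move=> h; rewrite normrM -expr2 -exprMn lerXn2r ?nnegrE ?mulr_ge0.
rewrite frob_parmx; apply: le_trans (ler_normB _ _) _.
apply: le_trans (lerD (ler_normD _ _) (lexx _)) _.
have S (F : 'I_n -> R) : (forall i, `|F i| <= n%:R ^+ 2 * frob_norm x ^+ 2) ->
    `|\sum_i F i| <= n%:R ^+ 3 * frob_norm x ^+ 2.
  move=> FP; apply: le_trans (ler_norm_sum _ _ _) _.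
  apply: le_trans (ler_sum _ (fun i _ => FP i)) _.
  by rewrite sumr_const card_ord -[leLHS]mulr_natl mulrA -exprS.
have T : `|entrysum x * entrysum x / n%:R| <= n%:R ^+ 3 * frob_norm x ^+ 2.
  rewrite normrM normfV (ger0_norm (ler0n _ n)) ler_pdivrMr ?ltr0n//.
  apply: le_trans (sq _ (entrysum_le x)) _; rewrite [leRHS]mulrAC -[in leRHS]exprSr.
  by rewrite ler_wpM2r ?sqr_ge0// ler_weXn2l ?nR.
have H1 := S _ (fun i => sq _ (rowsum_le x i)).
have H2 := S _ (fun i => sq _ (colsum_le x i)).
by lra.
Qed.

End ParallelForm.

Section UnusedService.
Variables (R : realType) (n : nat).
Hypothesis n0 : (0 < n)%N.
Implicit Types (q : 'M[nat]_n) (a : arr n) (s : 'S_n).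

Let nR : 1 <= n%:R :> R. Proof. by rewrite ler1n. Qed.

Local Notation U q a s := (entrysum (unused R q a s)).

Lemma unused_le_perm q a s i j : unused R q a s i j <= (s i == j)%:R.
Proof. by rewrite mxE; case: (s i == j); case: eqP => //=. Qed.

Lemma unused_row q a s i : 0 <= rowsum (unused R q a s) i <= 1.
Proof.
apply/andP; split; first by apply: sumr_ge0 => j _; exact: unused_ge0.
by rewrite -(sum_perm_row _ s i); apply: ler_sum => j _; exact: unused_le_perm.
Qed.

Lemma unused_col q a s j : 0 <= colsum (unused R q a s) j <= 1.
Proof.
apply/andP; split; first by apply: sumr_ge0 => i _; exact: unused_ge0.
by rewrite -(sum_perm_col _ s j); apply: ler_sum => i _; exact: unused_le_perm.
Qed.

Lemma unused_total q a s : 0 <= U q a s <= n%:R.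
Proof.
apply/andP; split; first by do 2!apply: sumr_ge0 => ? _; exact: unused_ge0.
rewrite -[leRHS](_ : \sum_(i < n) 1 = _); last by rewrite sumr_const card_ord.
by apply: ler_sum => i _; case/andP: (unused_row q a s i).
Qed.

(** A row or column wastes at most one unit of service, so the squares of the row
and column sums are at most the sums themselves. *)
Lemma frob_parmx_unused_self q a s :
  `|frob (parmx (unused R q a s)) (unused R q a s)| <= 3 * U q a s.
Proof.
have /andP[U0 Un] := unused_total q a s.
have H1 : 0 <= \sum_i rowsum (unused R q a s) i * rowsum (unused R q a s) i <= U q a s.
  apply/andP; split; first by apply: sumr_ge0 => i _; rewrite -expr2 sqr_ge0.
  apply: ler_sum => i _; have /andP[? ?] := unused_row q a s i.
  by rewrite -/(rowsum _ i) -[leRHS]mulr1 ler_wpM2l.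
have H2 : 0 <= \sum_i colsum (unused R q a s) i * colsum (unused R q a s) i <= U q a s.
  rewrite entrysum_col; apply/andP; split.
    by apply: sumr_ge0 => i _; rewrite -expr2 sqr_ge0.
  apply: ler_sum => i _; have /andP[? ?] := unused_col q a s i.
  by rewrite -[leRHS]mulr1 ler_wpM2l.
have H3 : 0 <= U q a s * U q a s / n%:R <= U q a s.
  rewrite divr_ge0 ?mulr_ge0//= ler_pdivrMr ?ltr0n//.
  by rewrite ler_wpM2l.
rewrite frob_parmx ler_norml; apply/andP; split; lra.
Qed.

(** The product of the new queues with the unused service vanishes, so that in
their product along [coneS] only the distance to the cone survives. *)
Lemma frob_parmx_unused q a s :
  `|frob (parmx (real_mx R (nextq q a s))) (unused R q a s)| <=
  4 * n%:R * frob_norm (perpK (real_mx R (nextq q a s))) * U q a s.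
Proof.
set x := real_mx R _; set u := unused R q a s.
have [Sz _] := projK_coneK x.
have -> : frob (parmx x) u = frob (parmx (perpK x) - n%:R *: perpK x) u.
  rewrite /perpK parmxD parmxN (parmx_coneS n0 Sz) scalerBr opprB addrA subrK.
  by rewrite frobBl frobZl frob_nextq_unused mulr0 subr0.
apply: le_trans (ler_norm_sum _ _ _) _; rewrite /entrysum mulr_sumr.
apply: ler_sum => i _; apply: le_trans (ler_norm_sum _ _ _) _; rewrite mulr_sumr.
apply: ler_sum => j _; rewrite normrM (ger0_norm (unused_ge0 _ _ _ _ i j)).
by rewrite ler_wpM2r ?unused_ge0// parmx_sub_le.
Qed.

End UnusedService.

(** A state space for the switch, seen only through its one-step operator [A]:
one step draws a schedule from a law [k] that depends on the state, and
independent arrivals of rate [lam].  The lower bound on the mean weight has a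
gain [w] per unit of distance to the cone and a loss [c], and covers both
classes of algorithms. *)
Record switch_model (R : realType) (n : nat) (lam w c : R) (St : countType)
    (g : St -> 'M[nat]_n) (A : (St -> R) -> St -> R) : Prop := SwitchModel {
  sm_markov : markov_operator A;
  sm_slot : forall x, exists k : 'S_n -> R,
    [/\ forall s, 0 <= k s, \sum_s k s = 1,
        forall phi : 'M[nat]_n -> R, A (fun y => phi (g y)) x =
          fmean (slot_law lam k) (fun u => phi (nextq (g x) u.2 u.1)) &
        total R (g x) / n%:R + w * frob_norm (perpK (real_mx R (g x))) - c <=
          \sum_s k s * weight R (g x) s];
  sm_reach : exists z, forall x, exists N0, forall N, (N0 <= N)%N ->
    exists2 alpha : R, 0 < alpha &
      forall f : St -> R, (forall y, 0 <= f y) -> alpha * f z <= iter N A f x;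
  sm_finite : forall B : set 'M[nat]_n, finite_set B -> finite_set (g @^-1` B) }.

Lemma finite_bounded_matrices n b : finite_set [set q : 'M[nat]_n | forall i j, (q i j <= b)%N].
Proof.
pose h (a : 'M['I_b.+1]_n) : 'M[nat]_n := map_mx (@nat_of_ord _) a.
apply: (@sub_finite_set _ _ (h @` setT)); last exact: finite_image.
move=> q /= qb; exists (\matrix_(i, j) inord (q i j)) => //.
by apply/matrixP => i j; rewrite !mxE inordK// ltnS.
Qed.

Section SwitchModelAnalysis.
Variables (R : realType) (n : nat) (eps w c : R) (St : countType).
Variables (g : St -> 'M[nat]_n) (A : (St -> R) -> St -> R).
Hypotheses (n0 : (0 < n)%N) (eps01 : 0 < eps < 1) (w01 : 0 < w <= 1) (c0 : 0 <= c).

Local Notation lam := ((1 - eps) / n%:R).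
Hypothesis model : switch_model lam w c g A.

Local Notation Qn x := (frob_norm (real_mx R (g x))).
Local Notation perp x := (frob_norm (perpK (real_mx R (g x)))).

Let nR : 1 <= n%:R :> R. Proof. by rewrite ler1n. Qed.
Let HA := sm_markov model.

Let lam0 : 0 <= lam.
Proof. by case/andP: eps01 => ? ?; rewrite divr_ge0// subr_ge0 ltW. Qed.

Let n_lam : n%:R * lam = 1 - eps.
Proof. by rewrite mulrC divfK// gt_eqF// ltr0n. Qed.

Let lam_n : n%:R * lam <= 1.
Proof. by case/andP: eps01 => ? ?; rewrite n_lam; lra. Qed.

Let eps_n : 0 < eps / n%:R <= 1.
Proof.
case/andP: eps01 => ? ?; rewrite divr_gt0 ?ltr0n//= ler_pdivrMr ?ltr0n// mul1r.
by have := nR; lra.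
Qed.

(** * Positive recurrence *)

Definition lyap (q : 'M[nat]_n) : R :=
  expR (rate n (eps / n%:R) c * frob_norm (real_mx R q)).

Let V x := lyap (g x).

Let V0 x : 0 <= V x. Proof. exact: expR_ge0. Qed.

Let rho : R := 1 - rate n (eps / n%:R) c * (eps / n%:R) / 2.

Let rho01 : 0 <= rho < 1.
Proof.
have /andP[e0 e1] := eps_n.
have r0 := rate_gt0 n0 e0 c0.
have r1 := rate_le1 n0 eps_n c0.
by apply/andP; split; rewrite /rho; nra.
Qed.

(** The queues drift towards zero because the mean weight of the schedule exceeds
that of the arrivals by [eps / n] times the total queue length. *)
Lemma lyap_drift x : A V x <= rho * V x + 3.
Proof.
have [k [k0 k1 AE W]] := sm_slot model x.
rewrite (AE lyap).
have drift : fmean (slot_law lam k) (fun u => frob (real_mx R (g x))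
    (increment R (g x) u.2 u.1)) <= - (eps / n%:R) * Qn x + c.
  have -> : (fun u => frob (real_mx R (g x)) (increment R (g x) u.2 u.1)) =
      (fun u : 'S_n * arr n => frob (real_mx R (g x)) (arrmx R u.2 - perm_mx u.1)).
    by apply/funext => u; rewrite /increment frobDr frob_queue_unused addr0.
  rewrite slot_mean_frob// -/(weight R (g x) _).
  have -> : \sum_i \sum_j real_mx R (g x) i j = total R (g x).
    by do 2!apply: eq_bigr => ? _; rewrite mxE.
  have /andP[e0 _] := eps_n; have /andP[w0 _] := w01.
  have h1 := ler_wpM2l (ltW e0) (frob_norm_le_total R (g x)).
  have h2 := mulr_ge0 (ltW w0) (frob_norm_ge0 (perpK (real_mx R (g x)))).
  have h3 : lam * total R (g x) = total R (g x) / n%:R - eps / n%:R * total R (g x).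
    by field; rewrite gt_eqF// ltr0n.
  by rewrite h3; lra.
have := slot_exp_drift n0 lam0 lam_n k0 k1 eps_n c0 drift.
by rewrite /lyap; under eq_fun do rewrite -real_nextq.
Qed.

Lemma lyap_bounded_entries (M : R) :
  exists b, forall q, lyap q <= M -> forall i j, (q i j <= b)%N.
Proof.
have /andP[e0 _] := eps_n; have r0 := rate_gt0 n0 e0 c0.
exists (Num.bound (M / rate n (eps / n%:R) c)) => q qM i j.
have le1 : frob_norm (real_mx R q) <= M / rate n (eps / n%:R) c.
  rewrite ler_pdivlMr// mulrC; apply: le_trans qM.
  by apply: le_trans (expR_ge1Dx _); rewrite lerDr.
rewrite -(ler_nat R); apply: ltW; apply: le_lt_trans (archi_boundP _).
  by have := entry_le_frob_norm (real_mx R q) i j; rewrite mxE ger0_norm// => /le_trans; apply.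
by apply: le_trans le1; exact: frob_norm_ge0.
Qed.

(** The sublevel sets of the Lyapunov function are finite, so that the minorization
at one common state holds uniformly on them. *)
Lemma switch_ergodic : exists L, limit_functional A V L.
Proof.
suff H f : exists l : R, dominated V f -> forall x, iter t A f x @[t --> \oo] --> l.
  by have [L LP] := choice H; exists L.
have [[c' fc]|nd] := pselect (dominated V f); last by exists 0.
have [l lP] : exists l : R, forall x, iter t A f x @[t --> \oo] --> l; last by exists l.
apply: (geometric_ergodicity HA V0 rho01 _ lyap_drift _ fc) => // M.
have [b bP] := lyap_bounded_entries M.
have [z zP] := sm_reach model.
have /finite_seqP[xs xsE] := sm_finite model (finite_bounded_matrices n b).
suff [N1 N1P] : exists N1, forall N, (N1 <= N)%N -> exists2 alpha : R, 0 < alpha &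
    forall x, x \in xs -> forall f : St -> R, (forall y, 0 <= f y) ->
      alpha * f z <= iter N A f x.
  have [alpha a0 aP] := N1P N1.+1 (leqnSn _).
  exists N1.+1, alpha, z; split => // x Vx; apply: aP.
  suff : [set` xs] x by [].
  by rewrite -xsE; exact: bP.
elim: {xsE} xs => [|x xs [N1 IH]]; first by exists 0%N => N _; exists 1.
have [N2 N2P] := zP x; exists (maxn N1 N2) => N; rewrite geq_max => /andP[h1 h2].
have [a1 a10 a1P] := IH N h1; have [a2 a20 a2P] := N2P N h2.
exists (Num.min a1 a2); first by rewrite lt_min a10.
move=> y; rewrite inE => /predU1P[->|ys] h h0.
  by apply: le_trans (a2P h h0); rewrite ler_wpM2r// ge_min lexx orbT.
by apply: le_trans (a1P y ys h h0); rewrite ler_wpM2r// ge_min lexx.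
Qed.

Lemma dominated_step f : dominated V f -> dominated V (A f).
Proof.
move=> [c' fc]; exists (c' * 4) => x.
have c'0 : 0 <= c'.
  have := le_trans (normr_ge0 _) (fc x); rewrite pmulr_lge0//.
  by rewrite ltr_pwDl.
apply: le_trans (mo_norm HA x fc) _.
rewrite (mo_scale HA) -mulrA ler_wpM2l//.
rewrite (mo_add HA (fun=> 1) V) (mo_cst HA).
have /andP[_ r1] := rho01.
have h := ler_wpM2r (V0 x) (ltW r1).
by have := lyap_drift x; have := V0 x; lra.
Qed.

Lemma dominated_norm_pow j : dominated V (fun x => Qn x ^+ j).
Proof.
have /andP[e0 _] := eps_n; have r0 := rate_gt0 n0 e0 c0.
set r := rate _ _ _ in r0; case: j => [|j].
  by under eq_fun do rewrite expr0; exact: dominated_cst.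
exists (j.+1`!%:R / r ^+ j.+1) => x.
have q0 : 0 <= Qn x ^+ j.+1 by rewrite exprn_ge0// frob_norm_ge0.
have f0 : 0 < j.+1`!%:R :> R by rewrite ltr0n fact_gt0.
have H : 1 + (r * Qn x) ^+ j.+1 / j.+1`!%:R <= V x.
  by apply: expR_ge1Dxn; rewrite mulr_ge0 ?(ltW r0)// frob_norm_ge0.
have : (r * Qn x) ^+ j.+1 <= V x * j.+1`!%:R by rewrite -ler_pdivrMr//; lra.
by rewrite exprMn ger0_norm// mulrAC ler_pdivlMr ?exprn_gt0//; lra.
Qed.

Lemma dominated_total : dominated V (fun x => total R (g x)).
Proof.
apply: (dominated_le (h := fun x => n%:R * Qn x ^+ 1)).
  by apply: dominated_scale => //; exact: dominated_norm_pow.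
by move=> x; rewrite expr1 total_frob frob_const mul1r; exact: sum_le_frob_norm.
Qed.

Lemma dominated_perp_pow j : dominated V (fun x => perp x ^+ j).
Proof.
apply: (dominated_le (dominated_norm_pow j)) => x.
rewrite ger0_norm ?exprn_ge0 ?frob_norm_ge0//.
by rewrite lerXn2r ?nnegrE ?frob_norm_ge0// perpK_le_norm.
Qed.

(** * The stationary expectation *)

Section Stationary.
Variables (L : (St -> R) -> R) (x0 : St).
Hypothesis HL : limit_functional A V L.

(** State space collapse.  The projection is the nearest point, so the distance of
the new queues to the cone is at most their distance to the old projection, and
its exponential contracts; the distance to the cone has exponential tails at a
scale of order [(n + c) / w], which does not involve [eps]. *)
Lemma collapse_moments m : eps <= w / 4 ->
  L (fun x => perp x ^+ m) <= m`!%:R * 12 / (w * rate n (w / 2) c ^+ m.+1).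
Proof.
move=> eps_w; have /andP[w0 w1] := w01.
have w2 : 0 < w / 2 <= 1 by apply/andP; split; lra.
have w20 : 0 < w / 2 by lra.
have r0 := rate_gt0 n0 w20 c0.
set r := rate n (w / 2) c in r0 *.
have r1 : r <= 1 by apply: rate_le1.
have W_drift x : A (fun y => expR (r * perp y)) x <=
    (1 - r * w / 4) * expR (r * perp x) + 3.
  have [k [k0 k1 AE W]] := sm_slot model x.
  rewrite (AE (fun q => expR (r * frob_norm (perpK (real_mx R q))))).
  set q := real_mx R (g x) in W *; set z := projK q; set y := perpK q in W *.
  have [Sz z0] : coneK z := projK_coneK q.
  have drift : fmean (slot_law lam k) (fun u => frob y (increment R (g x) u.2 u.1)) <=
      - (w / 2) * frob_norm y + c.
    apply: (@le_trans _ _ (fmean (slot_law lam k) (fun u : 'S_n * arr n =>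
        frob q (arrmx R u.2 - perm_mx u.1) - frob z (arrmx R u.2 - perm_mx u.1)))).
      apply: fmean_le => [u|u]; first by rewrite mulr_ge0// bern_ge0// lam0/=; move: nR lam_n lam0; nra.
      rewrite /y /perpK -/q -/z frobBl /increment frobDr frob_queue_unused addr0 lerD2l lerN2.
      rewrite [leRHS]frobDr lerDl; apply: sumr_ge0 => i _; apply: sumr_ge0 => j _.
      by rewrite mulr_ge0// unused_ge0.
    rewrite fmeanB !slot_mean_frob//.
    have -> : \sum_s k s * frob z (perm_mx s) = (\sum_i \sum_j z i j) / n%:R.
      rewrite -(coneS_frob_perm (1%g) Sz) mulrAC divff ?gt_eqF ?ltr0n// mul1r.
      rewrite -[RHS]mul1r -k1 mulr_suml; apply: eq_bigr => s _; congr (_ * _).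
      by apply: (mulfI (lt0r_neq0 (lt_le_trans ltr01 nR))); rewrite !coneS_frob_perm.
    have -> : \sum_i \sum_j q i j = total R (g x).
      by do 2!apply: eq_bigr => ? _; rewrite mxE.
    have e_y : \sum_i \sum_j y i j = total R (g x) - \sum_i \sum_j z i j.
      rewrite /total -sumrB; apply: eq_bigr => i _; rewrite -sumrB.
      by apply: eq_bigr => j _; rewrite !mxE.
    have := sum_le_frob_norm y; rewrite e_y ler_norml => /andP[Hy _].
    have /andP[e0 _] := eps01; have /andP[en0 _] := eps_n.
    have h1 := ler_wpM2l (ltW en0) Hy.
    have h2 : eps / n%:R * - (n%:R * frob_norm y) = - (eps * frob_norm y).
      by field; rewrite gt_eqF// ltr0n.
    rewrite h2 in h1.
    have h3 := ler_wpM2r (frob_norm_ge0 y) eps_w.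
    rewrite /weight -/q in W.
    have h4 (t : R) : lam * t = t / n%:R - eps / n%:R * t by field; rewrite gt_eqF// ltr0n.
    rewrite !h4 => {h4}.
    have h5 := mulr_ge0 (ltW w0) (frob_norm_ge0 y).
    by move: h1 h3 W h5; rewrite mulrBr; lra.
  have := slot_exp_drift n0 lam0 lam_n k0 k1 w2 c0 drift.
  rewrite -/r (_ : r * (w / 2) / 2 = r * w / 4); last by field.
  apply: le_trans; apply: fmean_le => [u|u].
    by rewrite mulr_ge0// bern_ge0// lam0/=; move: nR lam_n lam0; nra.
  rewrite ler_expR ler_wpM2l ?(ltW r0)// real_nextq.
  apply: le_trans (perpK_le _ (projK_coneK q)) _.
  by rewrite /y /perpK -/z addrAC.
have k01 : 0 < r * w / 4 <= 1.
  by apply/andP; split; [rewrite divr_gt0// mulr_gt0|nra].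
have m0 : 0 < m`!%:R :> R by rewrite ltr0n fact_gt0.
have rm0 : 0 < r ^+ m by rewrite exprn_gt0.
have dom : dominated V (fun x => r ^+ m / m`!%:R * perp x ^+ m).
  by apply: dominated_scale => //; exact: dominated_perp_pow.
have le_exp x : r ^+ m / m`!%:R * perp x ^+ m <= expR (r * perp x).
  have p0 : 0 <= r * perp x by rewrite mulr_ge0 ?(ltW r0)// frob_norm_ge0.
  rewrite mulrAC -exprMn; case: (m) => [|m'].
    by rewrite expr0 divr1; apply: le_trans (expR_ge1Dx _); rewrite lerDl.
  by apply: le_trans (expR_ge1Dxn m' p0); rewrite lerDr.
have := limit_drift x0 HA HL k01 (ler0n R 3) W_drift dom le_exp.
rewrite (limit_scale x0 HA V0 HL _ (dominated_perp_pow m)) => H.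
have -> : m`!%:R * 12 / (w * r ^+ m.+1) = m`!%:R / r ^+ m * (3 / (r * w / 4)).
  by rewrite exprS; field; rewrite !gt_eqF.
rewrite -ler_pdivrMl ?divr_gt0//.
by rewrite invf_div.
Qed.

End Stationary.

End SwitchModelAnalysis.

(** * The balance of the quadratic form *)

Section SlotVariance.
Variables (R : realType) (n : nat) (eps : R) (k : 'S_n -> R).
Hypotheses (n0 : (0 < n)%N) (eps01 : 0 < eps < 1).
Hypotheses (k0 : forall s, 0 <= k s) (k1 : \sum_s k s = 1).

Local Notation lam := ((1 - eps) / n%:R).
Local Notation E := (fmean (slot_law lam k)).

Let nR : 1 <= n%:R :> R. Proof. by rewrite ler1n. Qed.

Let n_lam : n%:R * lam = 1 - eps.
Proof. by rewrite mulrC divfK// gt_eqF// ltr0n. Qed.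

Lemma mean_sqr_arrivals (c : 'I_n * 'I_n -> R) b :
  fmean (bern lam) (fun a => (\sum_k c k * ((a k)%:R - lam) - b) ^+ 2) =
  lam * (1 - lam) * \sum_k c k ^+ 2 + b ^+ 2.
Proof.
have E0 : fmean (bern lam) (fun a : arr n => \sum_k c k * ((a k)%:R - lam)) = 0.
  rewrite fmean_sum big1// => l _; rewrite fmeanZ fmeanB mean_arrival.
  by rewrite (fmean_cst (bern_sum1 _ _)) subrr mulr0.
rewrite -variance_arrivals.
transitivity (fmean (bern lam) (fun a : arr n =>
    (\sum_k c k * ((a k)%:R - lam)) ^+ 2 +
    (- 2 * b) * (\sum_k c k * ((a k)%:R - lam)) + b ^+ 2)).
  by congr fmean; apply/funext => a; ring.
by rewrite !fmeanD fmeanZ E0 mulr0 addr0 (fmean_cst (bern_sum1 _ _)).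
Qed.

Lemma sum_row_pair_index i (h : 'I_n * 'I_n -> R) :
  \sum_k (k.1 == i)%:R * h k = \sum_j h (i, j).
Proof.
transitivity (\sum_i' \sum_j (i' == i)%:R * h (i', j)).
  by rewrite pair_bigA; apply: eq_bigr => -[i' j].
rewrite (bigD1 i)//=.
rewrite [X in _ + X]big1 ?addr0 => [|i' /negbTE ->].
  by apply: eq_bigr => j _; rewrite eqxx mul1r.
by rewrite big1// => j _; rewrite mul0r.
Qed.

Lemma sum_col_pair_index j (h : 'I_n * 'I_n -> R) :
  \sum_k (k.2 == j)%:R * h k = \sum_i h (i, j).
Proof.
transitivity (\sum_i \sum_j' (j' == j)%:R * h (i, j')).
  by rewrite pair_bigA; apply: eq_bigr => -[i j'].
apply: eq_bigr => i _; rewrite (bigD1 j)//= eqxx mul1r big1 ?addr0// => j' /negbTE ->.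
by rewrite mul0r.
Qed.

(** The asymptotically relevant constant, from the variances of the row sums, the
column sums and the total of the arrivals. *)
Definition slot_variance : R := (2 * n%:R - 1) * (1 - eps) * (1 - lam) + n%:R * eps ^+ 2.

(** The row and column sums of a schedule are constant, so only the arrivals
contribute to the variance. *)
Lemma slot_mean_variance :
  E (fun u => frob (parmx (arrmx R u.2 - perm_mx u.1)) (arrmx R u.2 - perm_mx u.1)) =
  slot_variance.
Proof.
pose F (a : arr n) : R :=
  \sum_i (\sum_k (k.1 == i)%:R * ((a k)%:R - lam) - eps) ^+ 2 +
  \sum_j (\sum_k (k.2 == j)%:R * ((a k)%:R - lam) - eps) ^+ 2 -
  n%:R^-1 * (\sum_k 1 * ((a k)%:R - lam) - n%:R * eps) ^+ 2.
have Sn (t : R) : \sum_(i < n) t = n%:R * t by rewrite sumr_const card_ord mulr_natl.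
have rE (a : arr n) (s : 'S_n) i : rowsum (arrmx R a - perm_mx s) i =
    \sum_k (k.1 == i)%:R * ((a k)%:R - lam) - eps.
  rewrite sum_row_pair_index sumrB Sn n_lam /rowsum.
  under eq_bigr do rewrite !mxE; rewrite sumrB sum_perm_row.
  by rewrite opprB addrA addrAC addrK.
have cE (a : arr n) (s : 'S_n) j : colsum (arrmx R a - perm_mx s) j =
    \sum_k (k.2 == j)%:R * ((a k)%:R - lam) - eps.
  rewrite sum_col_pair_index sumrB Sn n_lam /colsum.
  under eq_bigr do rewrite !mxE; rewrite sumrB sum_perm_col.
  by rewrite opprB addrA addrAC addrK.
have tE (a : arr n) (s : 'S_n) : entrysum (arrmx R a - perm_mx s) =
    \sum_k 1 * ((a k)%:R - lam) - n%:R * eps.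
  rewrite /entrysum -/(rowsum _ _); under eq_bigr do rewrite -/(rowsum _ _) rE.
  rewrite sumrB Sn; congr (_ - _).
  under eq_bigr do rewrite sum_row_pair_index.
  by rewrite pair_bigA/=; apply: eq_bigr => -[i j] _; rewrite mul1r.
have -> : (fun u : 'S_n * arr n => frob (parmx (arrmx R u.2 - perm_mx u.1))
    (arrmx R u.2 - perm_mx u.1)) = fun u => F u.2.
  apply/funext => -[s a] /=; rewrite frob_parmx /F tE; congr (_ + _ - _).
  - by apply: eq_bigr => i _; rewrite rE expr2.
  - by apply: eq_bigr => j _; rewrite cE expr2.
  - by rewrite -expr2 mulrC.
rewrite slot_law_snd// /F fmeanB fmeanD !fmean_sum fmeanZ.
have row1 i : \sum_(k : 'I_n * 'I_n) ((k.1 == i)%:R : R) ^+ 2 = n%:R.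
  rewrite -[RHS]mulr1 -Sn -(sum_row_pair_index i (fun=> 1)).
  by apply: eq_bigr => l _; case: (_ == _); rewrite ?expr0n/= ?expr1n ?mulr1 ?mul0r.
have col1 j : \sum_(k : 'I_n * 'I_n) ((k.2 == j)%:R : R) ^+ 2 = n%:R.
  rewrite -[RHS]mulr1 -Sn -(sum_col_pair_index j (fun=> 1)).
  by apply: eq_bigr => l _; case: (_ == _); rewrite ?expr0n/= ?expr1n ?mulr1 ?mul0r.
have tot1 : \sum_(k : 'I_n * 'I_n) (1 : R) ^+ 2 = n%:R ^+ 2.
  by rewrite (eq_bigr (fun=> 1)) => [|l _]; rewrite ?expr1n// sumr_const card_prod card_ord natrM expr2.
have rowm i : fmean (bern lam) (fun a : arr n => (\sum_k (k.1 == i)%:R * ((a k)%:R - lam) - eps) ^+ 2)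
    = lam * (1 - lam) * n%:R + eps ^+ 2 by rewrite (mean_sqr_arrivals (fun k => (k.1 == i)%:R)) row1.
have colm j : fmean (bern lam) (fun a : arr n => (\sum_k (k.2 == j)%:R * ((a k)%:R - lam) - eps) ^+ 2)
    = lam * (1 - lam) * n%:R + eps ^+ 2 by rewrite (mean_sqr_arrivals (fun k => (k.2 == j)%:R)) col1.
rewrite (eq_bigr _ (fun i _ => rowm i)) (eq_bigr _ (fun j _ => colm j)).
rewrite (mean_sqr_arrivals (fun=> 1)) tot1 !Sn /slot_variance.
have nn : n%:R != 0 :> R by rewrite gt_eqF// ltr0n.
by field.
Qed.

End SlotVariance.

(** The cross term with [u] is taken at the endpoint [x + d + u], where it is
small if [u] is the unused service and [x + d + u] are the new queues. *)
Lemma frob_parmx_increment (R : realType) (n : nat) (x d u : 'M[R]_n) :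
  frob (parmx (x + d + u)) (x + d + u) =
  frob (parmx x) x + 2 * frob (parmx x) d + frob (parmx d) d +
  (2 * frob (parmx (x + d + u)) u - frob (parmx u) u).
Proof.
rewrite !parmxD !(frobDl, frobDr).
by rewrite (frob_parmxC d x) (frob_parmxC u x) (frob_parmxC u d); ring.
Qed.

Section StationaryIdentity.
Variables (R : realType) (n : nat) (eps w c : R) (St : countType).
Variables (g : St -> 'M[nat]_n) (A : (St -> R) -> St -> R).
Hypotheses (n0 : (0 < n)%N) (eps01 : 0 < eps < 1) (w01 : 0 < w <= 1) (c0 : 0 <= c).

Local Notation lam := ((1 - eps) / n%:R).
Hypothesis model : switch_model lam w c g A.

Local Notation V := (fun x => lyap eps c (g x)).
Local Notation X x := (real_mx R (g x)).
Local Notation perp x := (frob_norm (perpK (X x))).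
Local Notation Q x := (total R (g x)).

Variables (L : (St -> R) -> R) (x0 : St).
Hypothesis HL : limit_functional A V L.

Let nR : 1 <= n%:R :> R. Proof. by rewrite ler1n. Qed.
Let HA := sm_markov model.
Let V0 x : 0 <= V x. Proof. exact: expR_ge0. Qed.
Let lam0 : 0 <= lam.
Proof. by case/andP: eps01 => ? ?; rewrite divr_ge0// subr_ge0 ltW. Qed.
Let n_lam : n%:R * lam = 1 - eps.
Proof. by rewrite mulrC divfK// gt_eqF// ltr0n. Qed.
Let lam01 : 0 <= lam <= 1.
Proof. by case/andP: eps01 => ? ?; rewrite lam0/=; move: nR n_lam lam0; nra. Qed.

(** The mean unused service, expressed through the balance of the queues. *)
Let EU x : R := A (fun y => Q y) x - Q x + n%:R * eps.

Let Vp x : R := frob (parmx (X x)) (X x).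

Let total_entrysum (q : 'M[nat]_n) : total R q = entrysum (real_mx R q).
Proof. by do 2!apply: eq_bigr => ? _; rewrite mxE. Qed.

(** The correction term is the unused service times the distance to the cone; the
distance is cut at [K], and above [K] it is dominated by a higher power. *)
Lemma one_step_identity m (K : R) x : 0 < K ->
  `|A Vp x - Vp x + 2 * eps * Q x - slot_variance n eps| <=
  8 * n%:R * (K * EU x + n%:R / K ^+ m * A (fun y => perp y ^+ m.+1) x) + 3 * EU x.
Proof.
move=> K0; have [k [k0 k1 AE _]] := sm_slot model x.
have p0 u : 0 <= slot_law lam k u by rewrite mulr_ge0// bern_ge0.
pose d (u : 'S_n * arr n) := arrmx R u.2 - perm_mx u.1.
pose v (u : 'S_n * arr n) := unused R (g x) u.2 u.1.
pose q' (u : 'S_n * arr n) := real_mx R (nextq (g x) u.2 u.1).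
have q'E u : q' u = X x + d u + v u by rewrite /q' real_nextq addrA.
have EUE : EU x = fmean (slot_law lam k) (fun u => entrysum (v u)).
  rewrite /EU (AE (fun q => total R q)).
  have -> : (fun u : 'S_n * arr n => total R (nextq (g x) u.2 u.1)) = fun u =>
      Q x + (entrysum (d u) + entrysum (v u)).
    by apply/funext => u; rewrite !total_entrysum -/(q' u) q'E 2!entrysumD -addrA.
  rewrite fmeanD (fmean_cst (slot_law_sum1 _ k1)) fmeanD.
  have -> : fmean (slot_law lam k) (fun u => entrysum (d u)) = - (n%:R * eps).
    rewrite (_ : (fun u => _) = fun u => frob (const_mx 1) (d u)); last first.
      by apply/funext => u; rewrite frobC frob_const mul1r.
    rewrite slot_mean_frob//.
    have -> : \sum_s k s * frob (const_mx 1) (perm_mx s) = n%:R.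
      under eq_bigr do rewrite frob_perm; under eq_bigr do under eq_bigr do rewrite mxE.
      by under eq_bigr do rewrite sumr_const card_ord; rewrite -mulr_suml k1 mul1r.
    under eq_bigr do under eq_bigr do rewrite mxE.
    under eq_bigr do rewrite sumr_const card_ord.
    by rewrite sumr_const card_ord -(mulr_natl n%:R) mulrA (mulrC lam) n_lam; ring.
  by ring.
have VpE : A Vp x = Vp x - 2 * eps * Q x + slot_variance n eps +
    fmean (slot_law lam k) (fun u => 2 * frob (parmx (q' u)) (v u) - frob (parmx (v u)) (v u)).
  rewrite (AE (fun q => frob (parmx (real_mx R q)) (real_mx R q))).
  have -> : (fun u : 'S_n * arr n => frob (parmx (real_mx R (nextq (g x) u.2 u.1)))
      (real_mx R (nextq (g x) u.2 u.1))) = fun u => Vp x + 2 * frob (parmx (X x)) (d u) +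
      frob (parmx (d u)) (d u) +
      (2 * frob (parmx (q' u)) (v u) - frob (parmx (v u)) (v u)).
    by apply/funext => u; rewrite -/(q' u) q'E frob_parmx_increment.
  rewrite !fmeanD (fmean_cst (slot_law_sum1 _ k1)) fmeanZ slot_mean_variance//.
  rewrite slot_mean_frob// -/(entrysum (parmx _)) entrysum_parmx//.
  have -> : \sum_s k s * frob (parmx (X x)) (perm_mx s) = entrysum (X x).
    rewrite -[RHS]mul1r -k1 mulr_suml; apply: eq_bigr => s _; congr (_ * _).
    apply: (mulfI (lt0r_neq0 (lt_le_trans ltr01 nR))).
    rewrite coneS_frob_perm; [exact: entrysum_parmx|exact: coneS_parmx].
  rewrite -total_entrysum.
  by rewrite mulrA (mulrC lam) n_lam; ring.
have -> : A Vp x - Vp x + 2 * eps * Q x - slot_variance n eps =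
    fmean (slot_law lam k) (fun u => 2 * frob (parmx (q' u)) (v u) - frob (parmx (v u)) (v u)).
  by rewrite VpE; ring.
rewrite EUE (AE (fun q => frob_norm (perpK (real_mx R q)) ^+ m.+1)).
rewrite /fmean; apply: le_trans (ler_norm_sum _ _ _) _.
apply: (@le_trans _ _ (fmean (slot_law lam k) (fun u =>
   8 * n%:R * (K * entrysum (v u) + n%:R / K ^+ m *
     (frob_norm (perpK (q' u)) ^+ m.+1)) + 3 * entrysum (v u)))); last first.
  by rewrite fmeanD !fmeanZ fmeanD !fmeanZ.
apply: ler_sum => u _; rewrite normrM (ger0_norm (p0 u)); apply: ler_wpM2l => //.
have /andP[U0 Un] := unused_total R (g x) u.2 u.1; rewrite -/(v u) in U0 Un.
have h1 := frob_parmx_unused R n0 (g x) u.2 u.1.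
have h2 := frob_parmx_unused_self R n0 (g x) u.2 u.1.
rewrite -/(q' u) -/(v u) in h1 h2.
apply: le_trans (ler_normB _ _) _; rewrite normrM (ger0_norm (ler0n R 2)).
apply: lerD => //.
set f := frob_norm _ in h1 *; set U := entrysum _ in h1 U0 Un *.
have f0 : 0 <= f by exact: frob_norm_ge0.
have fU : f * U <= K * U + n%:R / K ^+ m * f ^+ m.+1.
  have Km : 0 < K ^+ m by rewrite exprn_gt0.
  have [fK|Kf] := leP f K.
    apply: (@le_trans _ _ (K * U)); first by rewrite ler_wpM2r.
    by rewrite lerDl mulr_ge0 ?divr_ge0 ?exprn_ge0// ltW.
  apply: (@le_trans _ _ (f * n%:R)); first by rewrite ler_wpM2l.
  apply: (@le_trans _ _ (n%:R / K ^+ m * f ^+ m.+1)); last by rewrite lerDr mulr_ge0// ltW.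
  rewrite mulrC -mulrA ler_wpM2l// exprS mulrCA -[leLHS]mulr1 ler_wpM2l//.
  by rewrite ler_pdivlMl// mulr1 lerXn2r ?nnegrE// ltW.
have := ler_wpM2l (mulr_ge0 (ler0n R 8) (ler0n R n)) fU; lra.
Qed.

(** Under the stationary expectation the balance terms of the form and of the total
queue vanish; the latter gives the unused service the mean [n * eps]. *)
Theorem heavy_traffic_estimate m (K : R) : 0 < K ->
  `|eps / n%:R * L (fun x => Q x) - slot_variance n eps / (2 * n%:R)| <=
  4 * K * n%:R * eps + 4 * n%:R / K ^+ m * L (fun x => perp x ^+ m.+1) + 3 / 2 * eps.
Proof.
move=> K0.
have domA := dominated_step n0 eps01 w01 c0 model.
have dQ : dominated V (fun x => Q x) by apply: dominated_total.
have dP : dominated V (fun x => perp x ^+ m.+1) by apply: dominated_perp_pow.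
have dV : dominated V Vp.
  apply: (dominated_le (h := fun x => 3 * n%:R ^+ 3 * frob_norm (X x) ^+ 2)).
    by apply: dominated_scale => //; exact: dominated_norm_pow.
  by move=> x; exact: frob_parmx_le.
pose dc := dominated_cst V0.
have LEU : L EU = n%:R * eps.
  have -> : EU = fun x => -1 * Q x + (A (fun y => Q y) x + n%:R * eps).
    by apply/funext => x; rewrite /EU; ring.
  rewrite (limit_lin x0 HA HL)//; last exact: dominated_add (domA _ dQ) (dc _).
  rewrite (limit_add x0 HA HL (domA _ dQ) (dc _)) (limit_inv x0 HL dQ (domA _ dQ)).
  by rewrite (limit_cst x0 HA V0 HL); ring.
have dEU : dominated V EU.
  have -> : EU = fun x => -1 * Q x + (A (fun y => Q y) x + n%:R * eps).
    by apply/funext => x; rewrite /EU; ring.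
  by apply: dominated_lin => //; apply: dominated_add (domA _ dQ) (dc _).
pose D x := A Vp x - Vp x + 2 * eps * Q x - slot_variance n eps.
pose B x := 8 * n%:R * (K * EU x + n%:R / K ^+ m * A (fun y => perp y ^+ m.+1) x) + 3 * EU x.
have DB x : `|D x| <= B x by exact: one_step_identity.
have DE : D = fun x => -1 * Vp x + (A Vp x + (2 * eps * Q x + - slot_variance n eps)).
  by apply/funext => x; rewrite /D; ring.
have dQc : dominated V (fun x => 2 * eps * Q x + - slot_variance n eps).
  exact: (dominated_lin (2 * eps) dQ (dc _)).
have dAV := domA _ dV.
have dAP := domA _ dP.
have dD : dominated V D.
  by rewrite DE; apply: dominated_lin => //; apply: dominated_add.
have LD : L D = 2 * eps * L (fun x => Q x) - slot_variance n eps.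
  rewrite DE (limit_lin x0 HA HL)//; last exact: dominated_add.
  rewrite (limit_add x0 HA HL)// (limit_inv x0 HL)//.
  rewrite (limit_lin x0 HA HL _ dQ (dc _)).
  by rewrite (limit_cst x0 HA V0 HL); ring.
have BE : B = fun x => (8 * n%:R * K + 3) * EU x +
    8 * n%:R * (n%:R / K ^+ m) * A (fun y => perp y ^+ m.+1) x.
  by apply/funext => x; rewrite /B; ring.
have dAP' : dominated V (fun x => 8 * n%:R * (n%:R / K ^+ m) * A (fun y => perp y ^+ m.+1) x).
  exact: dominated_scale.
have dB : dominated V B by rewrite BE; apply: dominated_lin.
have LB : L B = (8 * n%:R * K + 3) * (n%:R * eps) +
    8 * n%:R * (n%:R / K ^+ m) * L (fun x => perp x ^+ m.+1).
  rewrite BE (limit_lin x0 HA HL)// LEU (limit_scale x0 HA V0 HL)//.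
  by rewrite (limit_inv x0 HL).
have L1 : L D <= L B.
  by apply: (limit_le x0 HA HL) => // x; apply: le_trans (DB x); rewrite ler_norm.
have L2 : - L D <= L B.
  rewrite -mulN1r -(limit_scale x0 HA V0 HL)//; apply: (limit_le x0 HA HL) => //.
    exact: dominated_scale.
  by move=> x; rewrite mulN1r; apply: le_trans (DB x); rewrite -normrN ler_norm.
have LDB : `|L D| <= L B by rewrite ler_norml; apply/andP; split; lra.
have nn : 0 < n%:R :> R by rewrite ltr0n.
have -> : eps / n%:R * L (fun x => Q x) - slot_variance n eps / (2 * n%:R) =
    L D / (2 * n%:R) by rewrite LD; field; rewrite gt_eqF.
have -> : 4 * K * n%:R * eps + 4 * n%:R / K ^+ m * L (fun x => perp x ^+ m.+1) + 3 / 2 * eps =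
    L B / (2 * n%:R) by rewrite LB; field; rewrite !gt_eqF ?exprn_gt0.
rewrite normrM normfV (ger0_norm (_ : 0 <= 2 * n%:R)) ?mulr_ge0//.
by rewrite ler_pM2r ?invr_gt0 ?mulr_gt0.
Qed.

End StationaryIdentity.

(** * Discrete random variables *)

Section DiscreteRandomVariables.
Context {R : realType} {d : measure_display} {T : measurableType d}.
Variables (U : countType) (Y : T -> U).
Hypothesis Yrv : discrete_rv Y.

Lemma discrete_rv_preimage (B : set U) : measurable (Y @^-1` B).
Proof.
have -> : Y @^-1` B = \bigcup_k [set w | B (Y w) /\ pickle (Y w) = k].
  by apply/seteqP; split => [w /= Bw|w [k _ []]//]; exists (pickle (Y w)).
apply: bigcup_measurable => k _.
case E : (@unpickle U k) => [u|]; last first.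
  rewrite (_ : [set w | _] = set0)//; apply/seteqP; split => // w /= [_ wk].
  by move: E; rewrite -wk pickleK.
have [Bu|nBu] := pselect (B u /\ pickle u = k); last first.
  rewrite (_ : [set w | _] = set0)//; apply/seteqP; split => // w /= [Bw wk].
  by move: E; rewrite -wk pickleK => -[Yu]; apply: nBu; rewrite -Yu.
rewrite (_ : [set w | _] = Y @^-1` [set u])//; apply/seteqP; split => w /=.
  by move=> [_ wk]; move: E; rewrite -wk pickleK => -[].
by move=> ->.
Qed.

Lemma discrete_rv_measurable (f : U -> R) : measurable_fun setT (fun w => f (Y w)).
Proof.
move=> _ B mB; rewrite setTI.
exact: (discrete_rv_preimage (f @^-1` B)).
Qed.

End DiscreteRandomVariables.

Section BoundedExpectation.
Context {R : realType} {d : measure_display} {T : measurableType d}.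
Variable P : probability T R.

Lemma expectationE (X : T -> R) : ('E_P[X] = \int[P]_w (X w)%:E)%E.
Proof. by rewrite unlock. Qed.

Lemma bounded_integrable (X : T -> R) (M : R) D : measurable D ->
  measurable_fun setT X -> (forall w, `|X w| <= M) ->
  P.-integrable D (fun w => (X w)%:E).
Proof.
move=> mD mX XM.
apply: (@le_integrable _ _ _ P D mD _ (fun=> M%:E)).
- exact/measurable_EFinP/(measurable_funS measurableT).
- by move=> w _; rewrite lee_fin (le_trans (XM w))// ler_norm.
- exact: finite_measure_integrable_cst.
Qed.

End BoundedExpectation.

(** * From limits of expectations to a stationary law *)

Section StationaryLaw.
Variables (R : realType) (n : nat) (St : countType) (g : St -> 'M[nat]_n).
Variables (A : (St -> R) -> St -> R) (V : St -> R) (L : (St -> R) -> R) (x0 : St).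
Hypotheses (HA : markov_operator A) (V0 : forall x, 0 <= V x).
Hypothesis HL : limit_functional A V L.

Local Notation Q x := (total R (g x)).

(** Growth strictly below that of [V], at the scale of the total queue; it makes
the tails negligible uniformly in time. *)
Definition tight (phi : 'M[nat]_n -> R) :=
  exists C : R, forall x, (1 + Q x) * `|phi (g x)| <= C * (1 + V x).

Hypothesis tight1 : tight (fun=> 1).

Let Q0 x : 0 <= Q x. Proof. by do 2!apply: sumr_ge0 => ? _. Qed.

Lemma tight_dominated phi : tight phi -> dominated V (fun x => phi (g x)).
Proof.
move=> [C HC]; exists C => x; apply: le_trans (HC x).
by rewrite -[leLHS]mul1r ler_wpM2r// lerDl.
Qed.

Definition law_mass (k : nat) : R := L (fun x => (pickle (g x) == k)%:R).

Let dom_ind (b : St -> bool) phi : tight phi ->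
  dominated V (fun x => (b x)%:R * phi (g x)).
Proof.
move=> /tight_dominated[C HC]; exists C => x; apply: le_trans (HC x).
by case: (b x); rewrite ?mul1r// mul0r normr0.
Qed.

Let dom_ind1 (b : St -> bool) : dominated V (fun x => (b x)%:R).
Proof. by have := dom_ind b tight1; under eq_fun do rewrite mulr1. Qed.

Lemma law_mass_ge0 k : 0 <= law_mass k.
Proof. by apply: (limit_ge0 x0 HA V0 HL) => //; exact: dom_ind1. Qed.

Definition decode_matrix (k : nat) : 'M[nat]_n := odflt (const_mx 0%N) (unpickle k).

Local Notation decode := decode_matrix.

Let partial_sum phi N : tight phi -> \sum_(0 <= k < N) law_mass k * phi (decode k) =
  L (fun x => (pickle (g x) < N)%N%:R * phi (g x)).
Proof.
move=> tphi; elim: N => [|N IH].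
  rewrite big_geq// (_ : (fun x => _) = fun=> 0) ?(limit_cst x0 HA V0 HL)//.
  by apply/funext => x; rewrite ltn0 mul0r.
rewrite big_nat_recr//= IH /law_mass mulrC addrC.
rewrite -(limit_lin x0 HA HL _ (dom_ind1 _) (dom_ind _ tphi)); congr L.
apply/funext => x; rewrite ltnS (leq_eqVlt (pickle (g x)) N).
case: eqP => [E|_] /=; last by rewrite mulr0 add0r.
by rewrite mulr1 mul1r /decode_matrix -E pickleK ltnn mul0r addr0.
Qed.

Let partial_cvg phi : (forall q, 0 <= phi q) -> tight phi ->
  (\sum_(0 <= k < N) law_mass k * phi (decode k)) @[N --> \oo] --> L (fun x => phi (g x)).
Proof.
move=> phi0 tphi; have [C HC] := tphi.
have dV : dominated V V by exists 1 => x; rewrite mul1r ger0_norm// lerDr.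
have LV0 : 0 <= L V by exact: (limit_ge0 x0 HA V0 HL).
have C0 : 0 <= C.
  have /(le_trans _) := HC x0; move=> /(_ 0); rewrite mulr_ge0 ?addr_ge0// => /(_ isT).
  by rewrite pmulr_lge0// ltr_pwDl.
apply/cvgrPdist_le => e e0.
pose b := Num.bound (C * (1 + L V) / e).
have bP : C * (1 + L V) / e < b%:R.
  by apply: archi_boundP; rewrite divr_ge0 ?(ltW e0)// mulr_ge0// addr_ge0.
have /finite_seqP[qs qsE] := finite_bounded_matrices n b.
exists (\max_(q <- qs) (pickle q)).+1 => // N /= Nmax.
have far x : (N <= pickle (g x))%N -> b%:R <= Q x.
  move=> Nx; apply: contrapT => /negP; rewrite -ltNge => Qb.
  have : g x \in qs.
    suff : [set` qs] (g x) by [].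
    rewrite -qsE /= => i j; rewrite -(ler_nat R); apply: le_trans (ltW Qb).
    rewrite /total (bigD1 i)//= (bigD1 j)//= -addrA lerDl addr_ge0 ?sumr_ge0// => *.
    exact: sumr_ge0.
  move=> gx; have : (pickle (g x) <= \max_(q <- qs) (pickle q))%N.
    by rewrite (big_rem _ gx)/= leq_maxl.
  by move=> h; have := leq_trans Nmax (leq_trans Nx h); rewrite ltnn.
rewrite partial_sum//.
have -> : L (fun x => phi (g x)) - L (fun x => (pickle (g x) < N)%N%:R * phi (g x)) =
    L (fun x => (N <= pickle (g x))%N%:R * phi (g x)).
  apply/eqP; rewrite subr_eq addrC -(limit_add x0 HA HL (dom_ind _ tphi) (dom_ind _ tphi)).
  apply/eqP; congr L; apply/funext => x; rewrite ltnNge.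
  by case: (_ <= _)%N; rewrite ?mul1r ?mul0r ?addr0 ?add0r.
rewrite ger0_norm; last first.
  apply: (limit_ge0 x0 HA V0 HL); first exact: dom_ind.
  by move=> x; rewrite mulr_ge0.
have b1 : 0 < 1 + b%:R :> R by rewrite ltr_pwDl.
apply: (@le_trans _ _ (L (fun x => C / (1 + b%:R) * V x + C / (1 + b%:R)))).
  apply: (limit_le x0 HA HL); [exact: dom_ind| |].
    exact: (dominated_lin _ dV (dominated_cst V0 _)).
  move=> x; have CV : 0 <= C / (1 + b%:R) * (1 + V x).
    by rewrite !mulr_ge0 ?invr_ge0 ?addr_ge0.
  rewrite -[leRHS](_ : C / (1 + b%:R) * (1 + V x) = _); last by ring.
  case: (leqP N (pickle (g x))) => Nx; rewrite ?mul0r// mul1r.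
  rewrite mulrAC ler_pdivlMr//; apply: le_trans (HC x).
  by rewrite ger0_norm// mulrC ler_wpM2r// lerD2l far.
rewrite (limit_lin x0 HA HL _ dV (dominated_cst V0 _)) (limit_cst x0 HA V0 HL).
rewrite -[leLHS](_ : C * (1 + L V) / (1 + b%:R) = _); last by field; rewrite gt_eqF.
rewrite ler_pdivrMr//; rewrite ltr_pdivrMr// in bP.
by apply: ltW (lt_le_trans bP _); rewrite mulrC ler_wpM2l ?(ltW e0)// lerDr.
Qed.

Let masses (k : nat) : {measure set nat -> \bar R} :=
  mscale (NngNum (law_mass_ge0 k)) (dirac k).

Definition law_measure : set nat -> \bar R := mseries masses 0.

HB.instance Definition _ := Measure.on law_measure.

Let integral_law phi : (forall q, 0 <= phi q) -> tight phi ->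
  (\int[law_measure]_k (phi (decode k))%:E)%E = (L (fun x => phi (g x)))%:E.
Proof.
move=> phi0 tphi.
have mphi : measurable_fun setT (fun k : nat => (phi (decode k))%:E) by [].
rewrite ge0_integral_measure_series//; last by move=> *; rewrite lee_fin.
have E k : (\int[masses k]_x (phi (decode x))%:E = (law_mass k * phi (decode k))%:E)%E.
  rewrite ge0_integral_mscale//; last by move=> *; rewrite lee_fin.
  by rewrite integral_dirac//= diracT mul1e EFinM.
under eq_eseriesr do rewrite E.
apply: cvg_lim => //.
under eq_fun do rewrite sumEFin.
by apply/cvg_EFin; [exact: nearW|exact: partial_cvg].
Qed.

Let law_measureT : law_measure setT = 1%E.
Proof.
have := integral_law (fun=> ler01) tight1.
by rewrite integral_cst// mul1e (limit_cst x0 HA V0 HL).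
Qed.

HB.instance Definition _ := @Measure_isProbability.Build _ nat R law_measure law_measureT.

Definition law_probability : probability nat R := law_measure.

Lemma decode_rv : discrete_rv decode. Proof. by []. Qed.

(** A random matrix whose expectations are the limits [L]. *)
Definition law_matrix : random_matrix R n :=
  @RandomMatrix R n _ _ law_probability decode decode_rv.

Lemma law_matrix_expectation phi : (forall q, 0 <= phi q) -> tight phi ->
  ('E_(rm_P law_matrix)[fun w => phi (rm_val law_matrix w)])%E =
  (L (fun x => phi (g x)))%:E.
Proof. by move=> phi0 tphi; rewrite expectationE; exact: integral_law. Qed.

End StationaryLaw.

(** The steady state concerns the law of the queues alone, so this is all that is
retained of the process behind [A]. *)
Definition tracks (R : realType) (n : nat) (sw : switch R n) (St : countType)
    (g : St -> 'M[nat]_n) (A : (St -> R) -> St -> R) (X0 : sw_T sw -> St) : Prop :=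
  discrete_rv X0 /\
  forall t (phi : 'M[nat]_n -> R) (M : R), (forall q, `|phi q| <= M) ->
    ('E_(sw_P sw)[fun w => phi (queue t w)] =
     'E_(sw_P sw)[fun w => iter t A (fun x => phi (g x)) (X0 w)])%E.

Definition has_model (R : realType) (n : nat) (sw : switch R n) (eps w c : R) : Prop :=
  exists (St : countType) (g : St -> 'M[nat]_n) (A : (St -> R) -> St -> R)
    (X0 : sw_T sw -> St), switch_model ((1 - eps) / n%:R) w c g A /\ tracks g A X0.

(** The truncation level [K] and the order [m] of the moment are free, because they
are chosen only when [n] varies. *)
Definition steady_estimate (R : realType) (n : nat) (sw : switch R n) (eps w c : R) :=
  exists qbar : random_matrix R n, steady_state sw qbar /\
  exists l : R, mean_total_queue qbar = l%:E /\
  (eps <= w / 4 -> forall m (K : R), 0 < K ->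
    `|eps / n%:R * l - slot_variance n eps / (2 * n%:R)| <=
    4 * K * n%:R * eps +
    4 * n%:R / K ^+ m * (m.+1`!%:R * 12 / (w * rate n (w / 2) c ^+ m.+2)) +
    3 / 2 * eps).

Lemma expectation_cvg_bounded (R : realType) d (T : measurableType d)
    (P : probability T R) (u : nat -> T -> R) (l M : R) :
  (forall t, measurable_fun setT (u t)) -> (forall t w, `|u t w| <= M) ->
  (forall w, u t w @[t --> \oo] --> l) -> ('E_P[u t])%E @[t --> \oo] --> l%:E.
Proof.
move=> mu uM ul.
have [|||||_ _] := @dominated_convergence _ _ _ P setT measurableT
    (fun t w => (u t w)%:E) (fun=> l%:E) (fun=> M%:E).
- by move=> t; exact/measurable_EFinP.
- exact: measurable_cst.
- by apply/nearW => w _; apply/cvg_EFin; [exact: nearW|exact: ul].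
- exact: finite_measure_integrable_cst.
- by apply/nearW => w t _; rewrite lee_fin.
have -> : (\int[P]__ l%:E = l%:E)%E by rewrite -[RHS](expectation_cst P l) expectationE.
suff -> : (fun t => 'E_P[u t])%E = (fun t => \int[P]_w (u t w)%:E)%E by [].
by apply/funext => t; rewrite expectationE.
Qed.

Section SteadyState.
Variables (R : realType) (n : nat) (sw : switch R n) (eps w c : R) (St : countType).
Variables (g : St -> 'M[nat]_n) (A : (St -> R) -> St -> R) (X0 : sw_T sw -> St).
Hypotheses (n0 : (0 < n)%N) (eps01 : 0 < eps < 1) (w01 : 0 < w <= 1) (c0 : 0 <= c).
Hypothesis model : switch_model ((1 - eps) / n%:R) w c g A.
Hypothesis track : tracks g A X0.

(** The moment bound is substituted into the stationary balance.  The total queue is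
unbounded, hence its expectation under the limit law is recovered from the tail
bounds of the Lyapunov function. *)
Theorem switch_steady_state : steady_estimate sw eps w c.
Proof.
have HA := sm_markov model.
have [L HL] := switch_ergodic n0 eps01 w01 c0 model.
have [x0 _] := sm_reach model.
set V := (fun x : St => _) in HL.
have V0 x : 0 <= V x by exact: expR_ge0.
have Q0 x : 0 <= total R (g x) by do 2!apply: sumr_ge0 => ? _.
have [C HC] := dominated_total g n0 eps01 c0.
have C0 : 0 <= C.
  have := le_trans (normr_ge0 _) (HC x0); rewrite pmulr_lge0//.
  by rewrite ltr_pwDl// expR_ge0.
have tight1 : tight g V (fun=> 1).
  exists (1 + C) => x; rewrite normr1 mulr1 mulrDl mul1r; apply: lerD.
    by rewrite lerDl.
  by apply: le_trans (HC x); rewrite ler_norm.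
have tight_bounded (phi : 'M[nat]_n -> R) M : (forall q, `|phi q| <= M) -> tight g V phi.
  move=> phiM; have [C' HC'] := tight1; exists (M * C') => x.
  have M0 : 0 <= M := le_trans (normr_ge0 _) (phiM (g x)).
  rewrite mulrC -mulrA; apply: le_trans (_ : M * (1 + total R (g x)) <= _).
    by rewrite ler_wpM2r// addr_ge0.
  by rewrite ler_wpM2l//; have := HC' x; rewrite normr1 mulr1.
pose qbar := law_matrix x0 HA V0 HL tight1.
have E_bounded (phi : 'M[nat]_n -> R) M : (forall q, `|phi q| <= M) ->
    ('E_(rm_P qbar)[fun w => phi (rm_val qbar w)] = (L (fun x => phi (g x)))%:E)%E.
  move=> phiM; have M0 : 0 <= M := le_trans (normr_ge0 _) (phiM (g x0)).
  have tphi := tight_bounded _ _ phiM.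
  have phi0 q : 0 <= phi q + M.
    by have := phiM q; rewrite ler_norml => /andP[? _]; lra.
  have phi'M q : `|phi q + M| <= M + M.
    by apply: le_trans (ler_normD _ _) _; rewrite (ger0_norm M0) lerD2r.
  have := law_matrix_expectation x0 HA V0 HL tight1 phi0 (tight_bounded _ _ phi'M).
  rewrite -/qbar (limit_add x0 HA HL)//; [|exact: tight_dominated tphi|exact: dominated_cst].
  rewrite (limit_cst x0 HA V0 HL) expectationE.
  under eq_integral do rewrite EFinD.
  rewrite integralD//=; last 2 first.
  - by apply: (bounded_integrable _ (M := M)).
  - exact: finite_measure_integrable_cst.
  rewrite -!expectationE (expectation_cst _ M) EFinD => H.
  by have := congr1 (fun z => z - M%:E)%E H; rewrite !addeK.
exists qbar; split.
  move=> f [M fM]; rewrite (E_bounded _ _ fM).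
  have [X0rv trackE] := track.
  under eq_fun do rewrite (trackE _ _ _ fM).
  apply: (@expectation_cvg_bounded _ _ _ _ _ _ M).
  - by move=> t; exact: (discrete_rv_measurable X0rv).
  - move=> t w'; rewrite -(mo_cst (markov_iter HA t) M (X0 w')).
    by apply: (mo_norm (markov_iter HA t)).
  - by move=> w'; apply/HL/tight_dominated => //; exact: (tight_bounded _ _ fM).
exists (L (fun x => total R (g x))); split.
  apply: (law_matrix_expectation x0 HA V0 HL tight1) => [q|].
    by do 2!apply: sumr_ge0 => ? _.
  have [C1 H1] := dominated_norm_pow g n0 eps01 c0 1.
  have [C2 H2] := dominated_norm_pow g n0 eps01 c0 2.
  exists (n%:R * C1 + n%:R ^+ 2 * C2) => x.
  have tn : total R (g x) <= n%:R * frob_norm (real_mx R (g x)).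
    rewrite total_frob frob_const mul1r; apply: le_trans (sum_le_frob_norm _).
    exact: ler_norm.
  have f0 := frob_norm_ge0 (real_mx R (g x)).
  rewrite ger0_norm// mulrDl mul1r.
  have -> : (n%:R * C1 + n%:R ^+ 2 * C2) * (1 + V x) =
    n%:R * (C1 * (1 + V x)) + n%:R ^+ 2 * (C2 * (1 + V x)) by ring.
  apply: lerD.
    apply: le_trans tn _; rewrite ler_wpM2l//; apply: le_trans (H1 x).
    by rewrite expr1 ler_norm.
  apply: le_trans (_ : n%:R ^+ 2 * frob_norm (real_mx R (g x)) ^+ 2 <= _).
    by rewrite -exprMn expr2 ler_pM.
  rewrite ler_wpM2l ?exprn_ge0//; apply: le_trans (H2 x); exact: ler_norm.
move=> eps_w m K K0.
apply: le_trans (heavy_traffic_estimate n0 eps01 w01 c0 model x0 HL m K0) _.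
rewrite lerD2r lerD2l ler_wpM2l ?divr_ge0 ?mulr_ge0 ?exprn_ge0 ?(ltW K0)//.
exact: (collapse_moments n0 eps01 w01 c0 model x0 HL m.+1 eps_w).
Qed.

End SteadyState.

(** * The limit of large switches *)

Section Asymptotics.
Variable R : realType.
Implicit Types (a b x : R).

Lemma powR_nat_cvg0 x : x < 0 -> (fun n : nat => n%:R `^ x : R) @ \oo --> (0 : R).
Proof.
move=> x0; apply/cvgrPdist_lt => e e0.
pose B := (e^-1) `^ (- x)^-1.
have nx : 0 < - x by rewrite oppr_gt0.
exists (Num.bound B).+1 => // n /= Bn.
have Bn' : B < n%:R.
  apply: lt_trans (archi_boundP (powR_ge0 _ _)) _.
  by rewrite ltr_nat.
have n0 : 0 < n%:R :> R by apply: le_lt_trans Bn'; exact: powR_ge0.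
rewrite sub0r normrN ger0_norm ?powR_ge0// -(opprK x) powRN.
rewrite invf_plt ?posrE ?powR_gt0//.
have <- : B `^ (- x) = e^-1.
  by rewrite /B -powRrM mulVf ?gt_eqF// powRr1// invr_ge0 ltW.
by apply: gt0_ltr_powR => //; rewrite nnegrE ?powR_ge0// ltW.
Qed.

Lemma bigO_powR_bound (u : nat -> R) a :
  u =O_\oo (fun n : nat => n%:R `^ a) ->
  exists2 C : R, 0 < C & \forall n \near \oo, `|u n| <= C * n%:R `^ a.
Proof.
move=> /eqO_exP[C C0 H]; exists C => //; near=> n.
have : `|u n| <= C * `|n%:R `^ a| by near: n.
by rewrite (ger0_norm (powR_ge0 _ _)).
Unshelve. all: by end_near. Qed.

Lemma bigTheta_powR_bound (u : nat -> R) a :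
  u \is 'Theta_\oo (fun n : nat => n%:R `^ a) ->
  exists2 C : R, 0 < C & \forall n \near \oo, `|u n| <= C * n%:R `^ a.
Proof.
move=> /asboolP[[C1 C] /= /andP[_ C0] H]; exists C => //; near=> n.
have [_] : C1 * `|n%:R `^ a| <= `|u n| /\ `|u n| <= C * `|n%:R `^ a| by near: n.
by rewrite (ger0_norm (powR_ge0 _ _)).
Unshelve. all: by end_near. Qed.

Variables (beta : R) (eps : nat -> R) (sw : forall n, switch R n) (n1 : nat).
Hypotheses (n1_gt0 : (0 < n1)%N) (eps01 : forall n, (0 < n)%N -> 0 < eps n < 1).
Hypothesis epsTheta : eps \is 'Theta_\oo (fun n : nat => n%:R `^ (- beta)).

(** With the truncation level [K] a power of [n] slightly above the collapse
scale [n `^ (a + b)], the first error term vanishes because [beta > 1 + a + b],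
and the second one for a moment of sufficiently high order [m]. *)
Theorem heavy_traffic_of_estimates (w c : nat -> R) a b (C : R) :
  0 <= a -> 1 <= b -> 1 + a + b < beta -> 1 <= C ->
  (forall n, (n1 <= n)%N -> 0 < w n <= 1 /\ 0 <= c n) ->
  (\forall n \near \oo, (w n)^-1 <= C * n%:R `^ a /\ n%:R + c n <= C * n%:R `^ b) ->
  (forall n, (n1 <= n)%N -> steady_estimate (sw n) (eps n) (w n) (c n)) ->
  heavy_traffic_limit n1 eps sw.
Proof.
move=> a0 b1 beta_gt C1 wc scale est.
have C0 : 0 < C by lra.
have [Ce Ce0 epsC] := bigTheta_powR_bound epsTheta.
pose junk n : random_matrix R n :=
  @RandomMatrix R n _ nat (dirac 0%N) (fun=> const_mx 0%N) (fun=> I).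
have [qbar qbarP] : exists qbar : forall n, random_matrix R n, forall n, (n1 <= n)%N ->
    steady_state (sw n) (qbar n) /\ exists l : R, mean_total_queue (qbar n) = l%:E /\
    (eps n <= w n / 4 -> forall m (K : R), 0 < K ->
    `|eps n / n%:R * l - slot_variance n (eps n) / (2 * n%:R)| <=
    4 * K * n%:R * eps n +
    4 * n%:R / K ^+ m * (m.+1`!%:R * 12 / (w n * rate n (w n / 2) (c n) ^+ m.+2)) +
    3 / 2 * eps n).
  suff H n : exists qbar : random_matrix R n, (n1 <= n)%N -> steady_state (sw n) qbar /\
    exists l : R, mean_total_queue qbar = l%:E /\
    (eps n <= w n / 4 -> forall m (K : R), 0 < K ->
    `|eps n / n%:R * l - slot_variance n (eps n) / (2 * n%:R)| <=
    4 * K * n%:R * eps n +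
    4 * n%:R / K ^+ m * (m.+1`!%:R * 12 / (w n * rate n (w n / 2) (c n) ^+ m.+2)) +
    3 / 2 * eps n).
    exists (fun n => projT1 (cid (H n))) => n; exact: (projT2 (cid (H n))).
  case: (leqP n1 n) => n1n; last by exists (junk n).
  by have [q qP] := est n n1n; exists q.
exists qbar; split=> [n n1n|]; first by have [] := qbarP n n1n.
have [l lP] : exists l : nat -> R, forall n, (n1 <= n)%N ->
    mean_total_queue (qbar n) = (l n)%:E /\
    (eps n <= w n / 4 -> forall m (K : R), 0 < K ->
    `|eps n / n%:R * l n - slot_variance n (eps n) / (2 * n%:R)| <=
    4 * K * n%:R * eps n +
    4 * n%:R / K ^+ m * (m.+1`!%:R * 12 / (w n * rate n (w n / 2) (c n) ^+ m.+2)) +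
    3 / 2 * eps n).
  suff H n : exists l : R, (n1 <= n)%N -> mean_total_queue (qbar n) = l%:E /\
    (eps n <= w n / 4 -> forall m (K : R), 0 < K ->
    `|eps n / n%:R * l - slot_variance n (eps n) / (2 * n%:R)| <=
    4 * K * n%:R * eps n +
    4 * n%:R / K ^+ m * (m.+1`!%:R * 12 / (w n * rate n (w n / 2) (c n) ^+ m.+2)) +
    3 / 2 * eps n) by have [l lP] := choice H; exists l.
  case: (leqP n1 n) => n1n; last by exists 0.
  by have [_ [l lP]] := qbarP n n1n; exists l.
pose delta := (beta - 1 - a - b) / 2.
have d0 : 0 < delta by rewrite divr_gt0//; lra.
pose s := a + b + delta.
pose m := Num.bound ((1 + a + 2 * (a + b)) / delta).
have mP : 1 + a + 2 * (a + b) - delta * m%:R < 0.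
  have : (1 + a + 2 * (a + b)) / delta < m%:R.
    by apply: archi_boundP; rewrite divr_ge0 ?(ltW d0)//; lra.
  by rewrite ltr_pdivrMr//; lra.
pose D : R := 4 * (m.+1`!%:R * 12 * C * (16 * C ^+ 2) ^+ m.+2).
pose err (n : nat) : R := 4 * Ce * n%:R `^ (1 + s - beta) +
  D * n%:R `^ (1 + a + 2 * (a + b) - delta * m%:R) + 3 / 2 * Ce * n%:R `^ (- beta).
pose main (n : nat) : R := slot_variance n (eps n) / (2 * n%:R).
have err0 : err @ \oo --> (0 : R).
  have -> : 0 = 4 * Ce * 0 + D * 0 + 3 / 2 * Ce * 0 :> R by ring.
  by apply: cvgD; [apply: cvgD|]; apply: cvgMr; apply: powR_nat_cvg0 => //; rewrite /s /delta; lra.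
have eps_to0 : eps n @[n --> \oo] --> (0 : R).
  have h : Ce * n%:R `^ (- beta) @[n --> \oo] --> (0 : R).
    by rewrite -(mulr0 Ce); apply: cvgMr; apply: powR_nat_cvg0; lra.
  apply/cvgrPdist_lt => e e0; near=> n.
  rewrite sub0r normrN; apply: le_lt_trans (_ : Ce * n%:R `^ (- beta) < e).
    by near: n.
  have : `|0 - Ce * n%:R `^ (- beta)| < e by near: n; move/cvgrPdist_lt : h; exact.
  by rewrite sub0r normrN ger0_norm// mulr_ge0 ?powR_ge0// ltW.
have inv0 : (n%:R^-1 : R) @[n --> \oo] --> (0 : R).
  have : n%:R `^ (- 1) @[n --> \oo] --> (0 : R) by apply: powR_nat_cvg0; lra.
  by under eq_fun do rewrite powRN powRr1//.
have main1 : main @ \oo --> (1 : R).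
  pose f (n : nat) : R := (1 - 2^-1 * n%:R^-1) * (1 - eps n) * (1 - (1 - eps n) * n%:R^-1)
     + 2^-1 * (eps n * eps n).
  have f1 : f @ \oo --> (1 : R).
    have -> : 1 = (1 - 2^-1 * 0) * (1 - 0) * (1 - (1 - 0) * 0) + 2^-1 * (0 * 0) :> R by ring.
    have c1 : (fun=> 1 : R) @ \oo --> (1 : R) by exact: cvg_cst.
    have e1 : (1 - eps n) @[n --> \oo] --> (1 - 0 : R) by exact: cvgB c1 eps_to0.
    apply: cvgD; last by apply: cvgMr; exact: (cvgM eps_to0 eps_to0).
    apply: cvgM; last by apply: cvgB c1 _; exact: cvgM e1 inv0.
    by apply: cvgM e1; apply: cvgB c1 _; apply: cvgMr inv0.
  apply: cvg_trans f1; apply: near_eq_cvg; near=> n.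
  have n0 : n%:R != 0 :> R by rewrite pnatr_eq0 -lt0n; near: n; exists 1%N.
  by rewrite /f /main /slot_variance; field.
have bound : \forall n \near \oo, `|eps n / n%:R * l n - main n| <= err n.
  near=> n.
  have n1n : (n1 <= n)%N by near: n; exists n1.
  have n0 : (0 < n)%N by exact: leq_trans n1n.
  have [w_n c_n] : (w n)^-1 <= C * n%:R `^ a /\ n%:R + c n <= C * n%:R `^ b.
    by near: n.
  have eC : `|eps n| <= Ce * n%:R `^ (- beta) by near: n.
  have /andP[e0 e1] := eps01 n0.
  rewrite (gtr0_norm e0) in eC.
  have [/andP[w0 w1] c0] := wc n n1n.
  have [_ H] := lP n n1n.
  have nR : 1 <= n%:R :> R by rewrite ler1n.
  have n0R : 0 < n%:R :> R by rewrite ltr0n.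
  have n_neq0 : n%:R != 0 :> R by rewrite gt_eqF.
  have pD x y : n%:R `^ (x + y) = n%:R `^ x * n%:R `^ y :> R.
    by rewrite powRD// n_neq0 implybT.
  have p0 x : 0 < n%:R `^ x :> R by exact: powR_gt0.
  have small : eps n <= w n / 4.
    apply: le_trans eC _; rewrite ler_pdivlMr// -[leRHS]invrK -div1r ler_pdivlMr ?invr_gt0//.
    apply: le_trans (_ : Ce * n%:R `^ (- beta) * 4 * (C * n%:R `^ a) <= _).
      by rewrite ler_wpM2l// !mulr_ge0 ?(ltW (p0 _))// ltW.
    have -> : Ce * n%:R `^ (- beta) * 4 * (C * n%:R `^ a) = 4 * Ce * C * n%:R `^ (a - beta).
      by rewrite pD; ring.
    have : `|0 - 4 * Ce * C * n%:R `^ (a - beta)| < 1.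
      near: n; have : 4 * Ce * C * n%:R `^ (a - beta) @[n --> \oo] --> (0 : R).
        by rewrite -(mulr0 (4 * Ce * C)); apply: cvgMr; apply: powR_nat_cvg0; lra.
      by move/cvgrPdist_lt; apply.
    by rewrite sub0r normrN => /ltW; apply: le_trans; rewrite ler_norm.
  have {H} := H small m _ (p0 s); rewrite -/(main n) => /le_trans; apply.
  apply: lerD; last by rewrite -[leRHS]mulrA ler_wpM2l.
  apply: lerD.
    have -> : 4 * Ce * n%:R `^ (1 + s - beta) = 4 * n%:R `^ s * n%:R * (Ce * n%:R `^ (- beta)).
      by rewrite !pD (powRr1 (ltW n0R)); ring.
    by rewrite ler_wpM2l// !mulr_ge0// ltW.
  (* The inverse of the decay rate has order [n `^ (a + b)]. *)
  have rate_inv : (rate n (w n / 2) (c n))^-1 <= 16 * C ^+ 2 * n%:R `^ (a + b).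
    have -> : (rate n (w n / 2) (c n))^-1 = 16 * ((w n)^-1 * (n%:R + c n)).
      by rewrite /rate; field; rewrite !gt_eqF// ltr_pwDl.
    have -> : 16 * C ^+ 2 * n%:R `^ (a + b) = 16 * ((C * n%:R `^ a) * (C * n%:R `^ b)).
      by rewrite pD; ring.
    by rewrite ler_wpM2l// ler_pM// ?invr_ge0 ?addr_ge0// ltW.
  have r0 : 0 < rate n (w n / 2) (c n) by apply: rate_gt0 => //; lra.
  have -> : D * n%:R `^ (1 + a + 2 * (a + b) - delta * m%:R) =
      4 * n%:R / (n%:R `^ s) ^+ m * (m.+1`!%:R * 12 *
      (C * n%:R `^ a) * (16 * C ^+ 2 * n%:R `^ (a + b)) ^+ m.+2).
    have pX x k : (n%:R `^ x) ^+ k = n%:R `^ (x * k%:R) :> R.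
      by rewrite powRrM powR_mulrn// powR_ge0.
    rewrite exprMn !pX -powRN /D.
    have -> : n%:R `^ (1 + a + 2 * (a + b) - delta * m%:R) =
       n%:R * n%:R `^ (- (s * m%:R)) * n%:R `^ a * n%:R `^ ((a + b) * m.+2%:R) :> R.
      rewrite -{2}(powRr1 (ltW n0R)) -!pD; congr (_ `^ _).
      by rewrite /s -(natr1 m.+1) -natr1; ring.
    by ring.
  rewrite ler_wpM2l ?mulr_ge0 ?invr_ge0 ?exprn_ge0 ?powR_ge0//.
  rewrite invfM [leLHS]mulrA -exprVn ler_pM//.
  - by rewrite mulr_ge0 ?mulr_ge0 ?invr_ge0 ?(ltW w0).
  - by rewrite exprn_ge0// invr_ge0 ltW.
  - by rewrite ler_wpM2l.
  - by rewrite lerXn2r ?nnegrE ?invr_ge0 ?(ltW r0)// !mulr_ge0 ?exprn_ge0 ?powR_ge0// ltW.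
have real_lim : eps n / n%:R * l n @[n --> \oo] --> (1 : R).
  apply/cvgrPdist_le => e e0; near=> n.
  have h1 : `|eps n / n%:R * l n - main n| <= err n by near: n.
  have e2 : 0 < e / 2 by rewrite divr_gt0.
  have h2 : `|0 - err n| <= e / 2 by near: n; move/cvgrPdist_le : err0; apply; rewrite divr_gt0.
  have h3 : `|1 - main n| <= e / 2 by near: n; move/cvgrPdist_le : main1; apply; rewrite divr_gt0.
  have -> : 1 - eps n / n%:R * l n = (1 - main n) - (eps n / n%:R * l n - main n) by ring.
  apply: le_trans (ler_normB _ _) _; rewrite sub0r normrN in h2.
  have := ler_norm (err n); lra.
have : (eps n / n%:R * l n)%:E @[n --> \oo] --> 1%:E.
  by apply/cvg_EFin; [exact: nearW|exact: real_lim].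
apply: cvg_trans; apply: near_eq_cvg; near=> n.
have n1n : (n1 <= n)%N by near: n; exists n1.
by have [-> _] := lP n n1n; rewrite EFinM.
Unshelve. all: by end_near. Qed.

End Asymptotics.

(** * The probability of one slot *)

Section DiscreteIntegrals.
Context {R : realType} {d : measure_display} {T : measurableType d}.
Variable P : probability T R.

Definition pr (B : set T) : R := fine (P B).

Lemma pr_fin B : measurable B -> P B = (pr B)%:E.
Proof. by move=> mB; rewrite /pr fineK// fin_num_measure. Qed.

Lemma pr_ge0 B : 0 <= pr B.
Proof. exact: fine_ge0. Qed.

Lemma integral_finite_support (U : countType) (Y : T -> U) (B : set T) (s : seq U)
    (F : U -> R) : discrete_rv Y -> measurable B -> uniq s ->
  P (B `&` Y @^-1` [set u | u \notin s]) = 0%E ->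
  (\int[P]_(w in B) (F (Y w))%:E =
   (\sum_(u <- s) F u * pr (B `&` Y @^-1` [set u]))%:E)%E.
Proof.
move=> Yrv mB us null.
pose F' u : R := \sum_(v <- s) F v * (u == v)%:R.
have F'E u : u \in s -> F' u = F u.
  move=> uin; rewrite /F' (bigD1_seq u)//= eqxx mulr1 big1 ?addr0// => v.
  by rewrite eq_sym => /negbTE ->; rewrite mulr0.
have -> : (\int[P]_(w in B) (F (Y w))%:E = \int[P]_(w in B) (F' (Y w))%:E)%E.
  apply: ae_eq_integral => //.
  - apply/measurable_EFinP/(measurable_funS measurableT) => //.
    exact: discrete_rv_measurable.
  - apply/measurable_EFinP/(measurable_funS measurableT) => //.
    exact: discrete_rv_measurable.
  exists (B `&` Y @^-1` [set u | u \notin s]); split => //.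
    by apply: measurableI => //; exact: discrete_rv_preimage.
  move=> w /= /not_implyP[Bw H]; split => //; apply: contra_notN H => uin.
  by rewrite F'E.
rewrite /F'.
have ind v : P.-integrable B (fun w => (F v * (Y w == v)%:R)%:E).
  apply: (@bounded_integrable _ _ _ _ _ (`|F v|)) => //.
    exact: (discrete_rv_measurable Yrv (fun u => F v * (u == v)%:R)).
  by move=> w; case: (_ == _); rewrite ?mulr1// mulr0 normr0.
under eq_integral do rewrite -sumEFin.
rewrite (integral_sum mB ind) -sumEFin; apply: eq_bigr => v _.
under eq_integral do rewrite EFinM.
rewrite integralZl//; last first.
  apply: (@bounded_integrable _ _ _ _ _ (1)) => //.
    exact: (discrete_rv_measurable Yrv (fun u => (u == v)%:R)).
  by move=> w; case: (_ == _); rewrite ?normr1 ?normr0.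
have mBv : measurable (B `&` Y @^-1` [set v]) by apply: measurableI => //; exact: Yrv.
rewrite EFinM -(pr_fin mBv).
congr (_ * _)%E; rewrite setIC -(integral_indic P mB (Yrv v)).
apply: eq_integral => w _; rewrite indicE; congr (_%:R%:E).
by case: eqP => [?|?]; [rewrite mem_set|rewrite memNset].
Qed.

Lemma expectation_countable (U : countType) (X : T -> U) (h : T -> R) (k : U -> R) (M : R) :
  discrete_rv X -> measurable_fun setT h -> (forall w, `|h w| <= M) ->
  (forall x, `|k x| <= M) ->
  (forall x, (\int[P]_(w in X @^-1` [set x]) (h w)%:E = (k x * pr (X @^-1` [set x]))%:E)%E) ->
  ('E_P[h] = 'E_P[fun w => k (X w)])%E.
Proof.
move=> Xrv mh hM kM H.
pose F i : set T := X @^-1` [set x | pickle x = i].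
have FT : \bigcup_i F i = setT by apply/seteqP; split => // w _; exists (pickle (X w)).
have mF i : measurable (F i) by exact: discrete_rv_preimage.
have tF : trivIset setT F by move=> i j _ _ [w [/= <- <-]].
have kX x : (\int[P]_(w in X @^-1` [set x]) (k (X w))%:E = (k x * pr (X @^-1` [set x]))%:E)%E.
  rewrite (integral_finite_support (s := [:: x]))//.
    by rewrite big_seq1 setIid.
  rewrite (_ : _ `&` _ = set0) ?measure0//; apply/seteqP; split => // w [/= E].
  by rewrite E inE eqxx.
rewrite !expectationE -FT !integral_bigcup//; last 2 first.
- by rewrite FT; apply: (@bounded_integrable _ _ _ _ _ (M)) => //; exact: discrete_rv_measurable.
- by rewrite FT; apply: (@bounded_integrable _ _ _ _ _ (M)).
apply: eq_eseriesr => i _.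
have [[x xi]|none] := pselect (exists x : U, pickle x = i).
  have -> : F i = X @^-1` [set x].
    apply/seteqP; split => w; rewrite /F /=; last by move=> ->.
    by rewrite -xi => /(pcan_inj pickleK).
  by rewrite H kX.
have -> : F i = set0 by apply/seteqP; split => // w /= wi; case: none; exists (X w).
by rewrite !integral_set0.
Qed.

End DiscreteIntegrals.

Section SlotProbability.
Variables (R : realType) (n : nat) (sw : switch R n) (eps : R).
Hypotheses (n0 : (0 < n)%N) (eps01 : 0 < eps < 1).
Hypothesis traffic : uniform_bernoulli sw eps.

Local Notation P := (sw_P sw).
Local Notation history := (@history R n sw).
Local Notation arrival := (@arrival R n sw).
Local Notation schedule := (@schedule R n sw).
Local Notation queue := (@queue R n sw).
Local Notation past := (@past R n sw).
Local Notation lam := ((1 - eps) / n%:R).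

Let lam01 : 0 <= lam <= 1.
Proof.
case/andP: eps01 => ? ?; have n1 : 1 <= n%:R :> R by rewrite ler1n.
apply/andP; split; first by rewrite divr_ge0// subr_ge0 ltW.
by rewrite ler_pdivrMr; lra.
Qed.

Definition arr_matrix (a : arr n) : 'M[nat]_n := \matrix_(i, j) (a (i, j) : nat).

Lemma history_measurable t B : history t B -> measurable B.
Proof.
apply; split; first exact: sigma_algebra_measurable.
by move=> _ [[u [m [_ ->]]]|[u [s [_ ->]]]]; [exact: queue_rv|exact: schedule_rv].
Qed.

Lemma past_history t B : past t B -> history t B.
Proof.
move=> pB A [sA subA]; apply: pB; split=> // _ [[u [m [ut ->]]]|[u [s [ut ->]]]]; apply: subA.
  by left; exists u, m.
by right; exists u, s; split => //; exact: ltnW.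
Qed.

Lemma history_schedule t s : history t (schedule t @^-1` [set s]).
Proof. by move=> A [_ subA]; apply: subA; right; exists t, s. Qed.

Lemma historyI t B B' : history t B -> history t B' -> history t (B `&` B').
Proof. exact: (@measurableI _ (g_sigma_algebraType _)). Qed.

Lemma arrival_law t a : P (arrival t @^-1` [set arr_matrix a]) = (bern lam a)%:E.
Proof.
have [marg indep _] := traffic.
pose J := [seq (t, p.1, p.2) | p <- enum {: 'I_n * 'I_n}].
have uJ : uniq J by rewrite map_inj_uniq ?enum_uniq// => -[i j] [i' j'] /= [-> ->].
have -> : arrival t @^-1` [set arr_matrix a] =
    \bigcap_(k in [set` J]) ((fun w => arrival k.1.1 w k.1.2 k.2) @^-1`
      [set (a (k.1.2, k.2) : nat)]).
  apply/seteqP; split => w /=.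
    by move=> E k /= /mapP[[i j] _ ->] /=; rewrite E mxE.
  move=> H; apply/matrixP => i j; rewrite mxE; apply: (H (t, i, j)) => /=.
  by apply/mapP; exists (i, j); rewrite ?mem_enum.
rewrite (indep J (fun k => (a (k.1.2, k.2) : nat)) uJ).
rewrite big_map big_enum/= /bern -prodEFin; apply: eq_bigr => -[i j] _ /=.
by have [p1 p0] := marg t i j; case: (a (i, j)).
Qed.

Lemma arr_matrix_inj : injective arr_matrix.
Proof.
move=> a a' E; apply/ffunP => -[i j].
by have := congr1 (fun m : 'M[nat]_n => m i j) E; rewrite !mxE; case: (a _); case: (a' _).
Qed.

(** Arrivals other than zero or one have probability zero, because the Bernoulli
masses already sum to one. *)
Lemma arrival_support t : P (arrival t @^-1` (~` range arr_matrix)) = 0%E.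
Proof.
have marr a : measurable (arrival t @^-1` [set arr_matrix a]) by exact: (@arrival_rv _ _ sw t (arr_matrix a)).
have mr : measurable (arrival t @^-1` range arr_matrix).
  exact: (discrete_rv_preimage (@arrival_rv _ _ sw t)).
have E : arrival t @^-1` range arr_matrix =
    \big[setU/set0]_(a <- enum {: arr n}) (arrival t @^-1` [set arr_matrix a]).
  rewrite -bigcup_seq; apply/seteqP; split => w.
    by move=> [a _ Ea]; exists a; rewrite /= ?mem_enum.
  by move=> [a _ /= ->]; exists a.
rewrite E in mr.
rewrite (_ : arrival t @^-1` _ = ~` \big[setU/set0]_(a <- enum {: arr n})
  (arrival t @^-1` [set arr_matrix a])); last by rewrite -E.
rewrite probability_setC//.
have one B : measurable B -> P B = (\int[P]_(w in B) 1)%E.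
  by move=> mB; rewrite integral_cst// mul1e.
rewrite (one _ mr).
rewrite ge0_integral_bigsetU//=; last 2 first.
- by rewrite enum_uniq.
- by move=> a a' _ _ [w [/= -> /arr_matrix_inj]].
under eq_bigr do rewrite -(one _ (marr _)) arrival_law.
rewrite sumEFin big_enum/= bern_sum1.
by rewrite subee.
Qed.

(** The integral over one slot is a finite sum, because the arrivals are
independent of everything known once the schedule is chosen. *)
Lemma slot_integral t B q (h : 'M[nat]_n -> R) : history t B ->
  (forall w, B w -> queue t w = q) ->
  (\int[P]_(w in B) (h (queue t.+1 w))%:E =
   (\sum_s pr P (B `&` schedule t @^-1` [set s]) *
      fmean (bern lam) (fun a => h (nextq q a s)))%:E)%E.
Proof.
move=> hB qB; have mB := history_measurable hB.
pose Y w : 'S_n * 'M[nat]_n := (schedule t w, arrival t w).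
have Yrv : discrete_rv Y.
  move=> [s m]; rewrite (_ : _ @^-1` _ = schedule t @^-1` [set s] `&` arrival t @^-1` [set m]).
    by apply: measurableI; [exact: (@schedule_rv _ _ sw t s)|exact: (@arrival_rv _ _ sw t m)].
  by apply/seteqP; split => [w [<- <-]|w [/= <- <-]].
pose F (y : 'S_n * 'M[nat]_n) := h (\matrix_(i, j) (q i j + y.2 i j - (y.1 i == j))%N).
pose r := [seq (u.1, arr_matrix u.2) | u <- enum {: 'S_n * arr n}].
have ur : uniq r.
  by rewrite map_inj_uniq ?enum_uniq// => -[s a] [s' a'] [-> /arr_matrix_inj ->].
transitivity (\int[P]_(w in B) (F (Y w))%:E)%E.
  apply: eq_integral => w; rewrite inE => /qB qw; congr (h _)%:E.
  by apply/matrixP => i j; rewrite queueE qw mxE.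
rewrite (integral_finite_support F Yrv mB ur); last first.
  apply: (@subset_measure0 _ _ _ P _ (arrival t @^-1` (~` range arr_matrix))).
  - by apply: measurableI => //; exact: discrete_rv_preimage.
  - exact: (discrete_rv_preimage (@arrival_rv _ _ sw t)).
  - move=> w [_ /= /negP H] [a _ E]; apply: H; apply/mapP.
    by exists (schedule t w, a); rewrite ?mem_enum//= E.
  - exact: arrival_support.
congr (_%:E); rewrite big_map big_enum/= -(pair_bigA _ (fun s a =>
  F (s, arr_matrix a) * pr P (B `&` Y @^-1` [set (s, arr_matrix a)])))/=.
apply: eq_bigr => s _; rewrite /fmean mulr_sumr; apply: eq_bigr => a _.
have -> : pr P (B `&` Y @^-1` [set (s, arr_matrix a)]) =
    bern lam a * pr P (B `&` schedule t @^-1` [set s]).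
  have hBs := historyI hB (history_schedule s).
  have [_ _ indep] := traffic.
  rewrite /pr (_ : _ `&` _ = arrival t @^-1` [set arr_matrix a] `&` (B `&` schedule t @^-1` [set s])).
    rewrite indep// arrival_law fineM// fin_num_measure//.
    exact: history_measurable hBs.
  apply/seteqP; split => w; first by move=> [Bw [<- <-]].
  by move=> [/= Aw [Bw Sw]]; split => //; rewrite /= -Aw -Sw.
have -> : F (s, arr_matrix a) = h (nextq q a s).
  by rewrite /F; congr h; apply/matrixP => i j; rewrite !mxE.
by ring.
Qed.

End SlotProbability.

(** The one-step hypothesis is stated on the events [X t = x], so that it covers
chains with a kernel and policies with explicit randomness alike. *)
Lemma tracks_of_step (R : realType) (n : nat) (sw : switch R n) (St : countType)
    (X : nat -> sw_T sw -> St) (g : St -> 'M[nat]_n) (A : (St -> R) -> St -> R) :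
  markov_operator A -> (forall t, discrete_rv (X t)) ->
  (forall t w, queue t w = g (X t w)) ->
  (forall t x (f : St -> R) (M : R), (forall y, `|f y| <= M) ->
    (\int[sw_P sw]_(w in X t @^-1` [set x]) (f (X t.+1 w))%:E =
     (A f x * pr (sw_P sw) (X t @^-1` [set x]))%:E)%E) ->
  tracks g A (X 0%N).
Proof.
move=> HA Xrv qX step; split => // t phi M phiM.
have iterE (f : St -> R) : (forall y, `|f y| <= M) ->
    ('E_(sw_P sw)[fun w => f (X t w)] = 'E_(sw_P sw)[fun w => iter t A f (X 0%N w)])%E.
  elim: t f => [//|t IH] f fM.
  have AfM y : `|A f y| <= M.
    by rewrite -(mo_cst HA M y); apply: (mo_norm HA).
  rewrite iterSr -IH//; apply: (@expectation_countable _ _ _ _ _ _ _ _ M) => //.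
    exact: (discrete_rv_measurable (Xrv t.+1)).
  by move=> x; exact: step fM.
rewrite -iterE//; congr expectation; apply/funext => w.
by rewrite qX.
Qed.

(** * Positive probability paths *)

Section NumericalSemigroup.
Local Open Scope nat_scope.
Variable S : nat -> Prop.
Hypotheses (S0 : S 0) (SD : forall a b, S a -> S b -> S (a + b)).
Hypothesis gcd1 : forall c, (forall k, 0 < k -> S k -> c %| k) -> c = 1.

(** The least difference of two members divides every member, hence is one; two
consecutive members generate everything from some point on. *)
Lemma numerical_semigroup : exists N0, forall N, N0 <= N -> S N.
Proof.
have SM k a : S a -> S (k * a).
  by move=> Sa; elim: k => [//|k IH]; rewrite mulSn; exact: SD.
pose D d := `[< 0 < d /\ exists a, S a /\ S (a + d) >].
have exD : exists d, D d.
  apply: contrapT => noD; have : 2 = 1 by apply: gcd1 => k k0 Sk; case: noD; exists k;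
    apply/asboolP; split=> //; exists 0.
  by [].
case: (ex_minnP exD) => d /asboolP[d0 [a [Sa Sad]]] dmin.
have d1 : d = 1.
  apply: gcd1 => k k0 Sk; apply: contrapT => /negP nd.
  have r0 : 0 < k %% d by rewrite lt0n.
  have /dmin : D (k %% d).
    apply/asboolP; split=> //; exists (k %/ d * (a + d)); split; first exact: SM.
    have -> : k %/ d * (a + d) + k %% d = k %/ d * a + k.
      by rewrite mulnDr -addnA -divn_eq.
    by apply: SD => //; exact: SM.
  by rewrite leqNgt ltn_pmod.
rewrite d1 in Sad; case: (posnP a) => [a0|a0].
  by exists 0 => N _; rewrite -(muln1 N); apply: SM; rewrite a0 in Sad.
exists (a * a) => N aN.
have rq : N %% a <= N %/ a.
  by apply: leq_trans (ltnW (ltn_pmod N a0)) _; rewrite leq_divRL.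
have -> : N = (N %/ a - N %% a) * a + N %% a * (a + 1).
  rewrite {1}(divn_eq N a) mulnBl mulnDr muln1 addnA subnK//.
  by rewrite leq_mul2r rq orbT.
by apply: SD; exact: SM.
Qed.

End NumericalSemigroup.

Section Reachability.
Variables (R : realType) (St : Type) (A : (St -> R) -> St -> R).
Hypothesis HA : markov_operator A.

(** [A] moves a fraction of the mass at [x] to [y] in [k] steps. *)
Definition reaches k x y := exists2 alpha : R, 0 < alpha &
  forall f, (forall v, 0 <= f v) -> alpha * f y <= iter k A f x.

Lemma reaches0 x : reaches 0 x x.
Proof. by exists 1 => // f _; rewrite mul1r. Qed.

Lemma reachesD k l x y z : reaches k x y -> reaches l y z -> reaches (k + l) x z.
Proof.
move=> [a a0 aP] [b b0 bP]; exists (a * b); first exact: mulr_gt0.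
move=> f f0; rewrite iterD -mulrA.
apply: le_trans (aP _ _); last exact: (mo_ge0 (markov_iter HA l)).
by rewrite ler_wpM2l ?(ltW a0)// bP.
Qed.

(** A loop at [z] absorbs the waiting time, in place of an aperiodicity argument. *)
Lemma reaches_loop z : reaches 1 z z ->
  (forall x, exists k, reaches k x z) ->
  exists z, forall x, exists N0, forall N, (N0 <= N)%N -> reaches N x z.
Proof.
move=> zz xz; exists z => x; have [k kP] := xz x; exists k => N /subnKC <-.
apply: reachesD kP _; elim: (N - k)%N => [|j IH]; first exact: reaches0.
by rewrite -addn1; exact: reachesD IH zz.
Qed.

End Reachability.

(** * The chains of the two classes *)

Section ChainModel.
Variables (R : realType) (n : nat) (sw : switch R n) (eps w c : R).
Hypotheses (n0 : (0 < n)%N) (eps01 : 0 < eps < 1).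
Hypothesis traffic : uniform_bernoulli sw eps.

Local Notation P := (sw_P sw).
Local Notation lam := ((1 - eps) / n%:R).
Local Notation arrival := (@arrival R n sw).
Local Notation schedule := (@schedule R n sw).
Local Notation queue := (@queue R n sw).

Variables (St : countType) (X : nat -> sw_T sw -> St) (g : St -> 'M[nat]_n).
Variables (p : St -> St -> R) (bound : 'M[nat]_n -> R).
Hypothesis Xhist : forall t x, history t (X t @^-1` [set x]).
Hypotheses (mc : markov_chain P X p) (irr : irreducible_chain p) (aper : aperiodic_chain p).
Hypotheses (qX : forall t w, queue t w = g (X t w))
  (gfin : forall B : set 'M[nat]_n, finite_set B -> finite_set (g @^-1` B)).
Hypothesis wb : weight_bound X g bound.
Hypothesis bound_le : forall q,
  total R q / n%:R + w * frob_norm (perpK (real_mx R q)) - c <= bound q.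

Let p0 x y : 0 <= p x y. Proof. by case: mc => -[H _] _ _; exact: H. Qed.
Let Xrv t : discrete_rv (X t). Proof. by case: mc. Qed.

Let at_time t x : set (sw_T sw) := X t @^-1` [set x].
Let mat t x : measurable (at_time t x). Proof. exact: (Xrv t x). Qed.

Lemma sum_over_discrete (U : countType) (Y : sw_T sw -> U) (B : set (sw_T sw)) :
  discrete_rv Y -> measurable B ->
  P B = (\sum_(0 <= i <oo) P (B `&` Y @^-1` [set y | pickle y = i]))%E.
Proof.
move=> Yrv mB.
have mF i : measurable (B `&` Y @^-1` [set y | pickle y = i]).
  by apply: measurableI => //; exact: discrete_rv_preimage.
rewrite -(@measure_semi_bigcup _ _ _ P (fun i => B `&` Y @^-1` [set y | pickle y = i]))//.
- by congr (P _); apply/seteqP; split => [w' Bw|w' [i _ []]//]; exists (pickle (Y w')).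
- by move=> i j _ _ [w' [[_ /= <-] [_ /= <-]]].
- exact: bigcup_measurable.
Qed.

Lemma event_at_code (U : countType) (Y : sw_T sw -> U) i :
  (exists y, Y @^-1` [set y | pickle y = i] = Y @^-1` [set y]) \/
  Y @^-1` [set y | pickle y = i] = set0.
Proof.
have [[y yi]|none] := pselect (exists y : U, pickle y = i).
  left; exists y; apply/seteqP; split => w' /=; last by move=> ->.
  by rewrite -yi => /(pcan_inj pickleK).
by right; apply/seteqP; split => // w' /= wi; case: none; exists (Y w').
Qed.

(** The Markov property is given for complete paths; the initial positions are
summed out one at a time. *)
Lemma two_step_law t x y :
  P (at_time t x `&` at_time t.+1 y) = (P (at_time t x) * (p x y)%:E)%E.
Proof.
pose E k (v : nat -> St) := \bigcap_(u in [set u | (k <= u <= t)%N]) at_time u (v u).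
have mE k v : measurable (E k v).
  by apply: bigcap_measurableType => u _; exact: mat.
suff H k : (k <= t)%N -> forall v,
    P (E k v `&` at_time t.+1 y) = (P (E k v) * (p (v t) y)%:E)%E.
  have := H t (leqnn t) (fun=> x).
  suff -> : E t (fun=> x) = at_time t x by [].
  apply/seteqP; split => [w' /(_ t)|w' atw u /=]; first by apply; rewrite /= leqnn.
  by rewrite -eqn_leq => /eqP <-.
elim: k => [_ v|k IH kt v].
  by have [_ _ /(_ t v y)] := mc.
pose upd z u := if u == k then z else v u.
have vE z : E k.+1 v `&` at_time k z = E k (upd z).
  apply/seteqP; split => w'.
    move=> [Ew kz] u /= /andP[ku ut]; rewrite /upd.
    by case: eqP => [->//|/eqP uk]; apply: Ew; rewrite /= ut andbT ltn_neqAle eq_sym uk.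
  move=> Ew; split.
    move=> u /= /andP[ku ut]; have := Ew u; rewrite /upd /= (ltnW ku) ut (gtn_eqF ku).
    exact.
  by have := Ew k; rewrite /upd /= leqnn (ltnW kt) eqxx; apply.
have vt z : upd z t = v t by rewrite /upd (gtn_eqF kt).
rewrite (sum_over_discrete (Xrv k)); last by apply: measurableI.
rewrite [in RHS](sum_over_discrete (Xrv k) (mE _ _)) muleC -nneseriesZl//.
apply: eq_eseriesr => i _.
have [[z ->]|->] := event_at_code (X k) i; last by rewrite !setI0 measure0 mule0.
rewrite -setIA (setIC (at_time t.+1 y)) setIA -/(at_time k z) vE (IH (ltnW kt)) vt muleC.
by [].
Qed.

Lemma pr_two_step t x y :
  pr P (at_time t x `&` at_time t.+1 y) = pr P (at_time t x) * p x y.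
Proof. by rewrite /pr two_step_law (pr_fin P (mat t x)). Qed.

Let kstep_ge0 k x y : (0 <= kstep p k x y)%E.
Proof.
elim: k x => [|k IH] x /=; first by rewrite lee_fin.
by apply: esum_ge0 => z _; rewrite mule_ge0// lee_fin.
Qed.

Lemma kstepS_gt0 k x y : (0 < kstep p k.+1 x y)%E ->
  exists z, 0 < p x z /\ (0 < kstep p k z y)%E.
Proof.
move=> /= pos; apply: contrapT => no; move: pos; rewrite esum1 ?ltxx// => z _.
have [pz|pz] := eqVneq (p x z) 0; first by rewrite pz mul0e.
have : ~ (0 < kstep p k z y)%E.
  by move=> kz; apply: no; exists z; split => //; rewrite lt_neqAle eq_sym pz p0.
move=> /negP; rewrite -leNgt => kz.
have -> : kstep p k z y = 0%E by apply/eqP; rewrite eq_le kz kstep_ge0.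
by rewrite mule0.
Qed.

Lemma reached_kstep k t x y : 0 < pr P (at_time t x) -> (0 < kstep p k x y)%E ->
  0 < pr P (at_time (t + k) y).
Proof.
elim: k t x => [|k IH] t x xt.
  by rewrite addn0 /=; case: eqP => [<-//|_]; rewrite ltxx.
move=> /kstepS_gt0[z [pz kz]]; rewrite addnS -addSn; apply: IH kz.
apply: (@lt_le_trans _ _ (pr P (at_time t x `&` at_time t.+1 z))).
  by rewrite pr_two_step mulr_gt0.
rewrite /pr fine_le ?fin_num_measure//; first exact: measurableI.
  by apply: le_measure; rewrite ?inE//; exact: measurableI.
Qed.

(** Each row of the kernel is thus determined by the process, which transfers the
facts about one slot to the kernel. *)
Lemma every_state_reached x : exists t, 0 < pr P (at_time t x).
Proof.
have [x0 x00] : exists x0, 0 < pr P (at_time 0 x0).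
  apply: contrapT => no; have := sum_over_discrete (Xrv 0) (@measurableT _ (sw_T sw)).
  rewrite probability_setT eseries0 => [[/eqP]|i _ _]; first by rewrite oner_eq0.
  have [[z ->]|->] := event_at_code (X 0) i; last by rewrite setI0 measure0.
  rewrite setTI -/(at_time 0 z) (pr_fin P (mat 0 z)); congr (_%:E).
  apply/eqP; rewrite eq_le pr_ge0 andbT leNgt; apply/negP => h.
  by apply: no; exists z.
have [k kP] := irr x0 x; exists (0 + k)%N; exact: reached_kstep kP.
Qed.

Let nR : 1 <= n%:R :> R. Proof. by rewrite ler1n. Qed.
Let lam01 : 0 <= lam <= 1.
Proof.
case/andP: eps01 => ? ?; have n1 := nR.
apply/andP; split; first by rewrite divr_ge0// subr_ge0 ltW.
by rewrite ler_pdivrMr; lra.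
Qed.

Definition next_queues (q : 'M[nat]_n) : set 'M[nat]_n :=
  range (fun u : 'S_n * arr n => nextq q u.2 u.1).

Let support_exists x : exists s : seq St, uniq s /\ [set` s] = g @^-1` next_queues (g x).
Proof.
have fr : finite_set (next_queues (g x)).
  apply: finite_image; exact: (@finite_finset ('S_n * arr n : finType)%type).
have /finite_seqP[s sE] := gfin fr; exists (undup s); split; first exact: undup_uniq.
by rewrite sE; apply/seteqP; split => y /=; rewrite mem_undup.
Qed.

(** A row of the kernel is supported on finitely many states, those lying over
the possible next queues. *)
Definition support x : seq St := projT1 (cid (support_exists x)).

Let support_uniq x : uniq (support x).
Proof. by rewrite /support; case: cid => s []. Qed.

Let supportE x y : (y \in support x) <-> next_queues (g x) (g y).
Proof.
rewrite /support; case: cid => s [_ /= sE].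
by rewrite -[X in _ <-> X]/((g @^-1` next_queues (g x)) y) -sE.
Qed.

Definition kernel_op (f : St -> R) x : R := \sum_(y <- support x) p x y * f y.

Let off_support t x :
  P (at_time t x `&` X t.+1 @^-1` [set y | y \notin support x]) = 0%E.
Proof.
apply: (@subset_measure0 _ _ _ P _ (arrival t @^-1` (~` range (@arr_matrix n)))).
- by apply: measurableI => //; apply: discrete_rv_preimage.
- exact: (discrete_rv_preimage (@arrival_rv _ _ sw t)).
- move=> w' [/= xw yw] [a _ E]; move/negP : yw; apply; apply/supportE.
  exists (schedule t w', a) => //=; rewrite -(qX t.+1) -xw -qX.
  by apply/matrixP => i j; rewrite queueE -E !mxE.
- exact: (arrival_support traffic).
Qed.

Let kernel_op_integral t x (f : St -> R) :
  (\int[P]_(w' in at_time t x) (f (X t.+1 w'))%:E =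
   (kernel_op f x * pr P (at_time t x))%:E)%E.
Proof.
rewrite (integral_finite_support f (Xrv t.+1) (mat t x) (support_uniq x) (off_support t x)).
congr (_%:E); rewrite /kernel_op mulr_suml; apply: eq_bigr => y _.
by rewrite -/(at_time t.+1 y) pr_two_step; ring.
Qed.

Let schedule_law_at t x (s : 'S_n) : R :=
  pr P (at_time t x `&` schedule t @^-1` [set s]) / pr P (at_time t x).

Let schedule_integral t x (F : 'S_n -> R) : 0 < pr P (at_time t x) ->
  (\int[P]_(w' in at_time t x) (F (schedule t w'))%:E =
   ((\sum_s schedule_law_at t x s * F s) * pr P (at_time t x))%:E)%E.
Proof.
move=> pos; rewrite (@integral_finite_support _ _ _ P _ (schedule t) _ (enum {: 'S_n}) F).
- congr (_%:E); rewrite big_enum/= mulr_suml; apply: eq_bigr => s _.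
  by rewrite /schedule_law_at; field; rewrite gt_eqF.
- exact: (@schedule_rv _ _ sw t).
- exact: mat.
- exact: enum_uniq.
- rewrite (_ : _ `&` _ = set0) ?measure0//; apply/seteqP; split => // w' [_ /=].
  by rewrite mem_enum.
Qed.

Let schedule_law_sum1 t x : 0 < pr P (at_time t x) -> \sum_s schedule_law_at t x s = 1.
Proof.
move=> pos; have := schedule_integral (fun=> 1) pos.
rewrite (integral_cst P (mat t x)) mul1e.
move=> /(etrans (esym (pr_fin P (mat t x)))) [H].
apply: (mulIf (lt0r_neq0 pos)); rewrite mul1r [RHS]H; congr (_ * _).
by apply: eq_bigr => s _; rewrite mulr1.
Qed.

Let slot_identity t x (phi : 'M[nat]_n -> R) : 0 < pr P (at_time t x) ->
  kernel_op (fun y => phi (g y)) x =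
  fmean (slot_law lam (schedule_law_at t x)) (fun u => phi (nextq (g x) u.2 u.1)).
Proof.
move=> pos; apply: (mulIf (lt0r_neq0 pos)).
have := @kernel_op_integral t x (fun y => phi (g y)).
have -> : (fun w' => (phi (g (X t.+1 w')))%:E) = fun w' => (phi (queue t.+1 w'))%:E.
  by apply/funext => w'; rewrite qX.
rewrite (slot_integral traffic phi (@Xhist t x) (q := g x)); last first.
  by move=> w' <-; exact: qX.
move=> [<-]; rewrite /fmean -(pair_bigA _ (fun s a => slot_law lam (schedule_law_at t x) (s, a)
  * phi (nextq (g x) a s)))/= mulr_suml; apply: eq_bigr => s _.
rewrite mulr_sumr mulr_suml; apply: eq_bigr => a _.
by rewrite /slot_law/= /schedule_law_at; field; rewrite gt_eqF.
Qed.

Let kernel_op_markov : markov_operator kernel_op.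
Proof.
split.
- move=> k f h x; rewrite /kernel_op mulr_sumr -big_split; apply: eq_bigr => y _ /=.
  by ring.
- by move=> f h fh x; apply: ler_sum => y _; exact: ler_wpM2l.
- move=> k x; have [t pos] := every_state_reached x.
  rewrite (slot_identity (fun=> k) pos) fmean_cst//.
  by rewrite slot_law_sum1//; exact: schedule_law_sum1.
Qed.

Let kernel_pos_support x y : 0 < p x y -> y \in support x.
Proof.
move=> pxy; have [t pos] := every_state_reached x.
apply: contrapT => /negP yn.
have : pr P (at_time t x `&` at_time t.+1 y) = 0.
  rewrite /pr (@subset_measure0 _ _ _ P _ (at_time t x `&` X t.+1 @^-1` [set y | y \notin support x]))//.
  - exact: measurableI.
  - by apply: measurableI => //; apply: discrete_rv_preimage.
  - by move=> w' [? /= ->].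
  - exact: off_support.
by rewrite pr_two_step => /eqP; rewrite mulf_eq0 !gt_eqF.
Qed.

Let kstep_reaches k x y : (0 < kstep p k x y)%E -> reaches kernel_op k x y.
Proof.
elim: k x => [|k IH] x.
  by rewrite /=; case: eqP => [-> _|_]; [exact: reaches0|rewrite ltxx].
move=> /kstepS_gt0[z [pz kz]]; rewrite -add1n.
apply: (reachesD kernel_op_markov _ (IH _ kz)).
exists (p x z) => // f f0; rewrite /= /kernel_op (bigD1_seq z) ?support_uniq//=.
  by rewrite lerDl sumr_ge0// => v _; rewrite mulr_ge0.
exact: kernel_pos_support.
Qed.

Let kernel_reach : exists z, forall x, exists N0, forall N, (N0 <= N)%N ->
  reaches kernel_op N x z.
Proof.
have [[z]|noSt] := pselect (inhabited St); last first.
  have Q : sw_T sw -> False by move=> w'; apply: noSt; exists; exact: X 0 w'.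
  have : P setT = 0%E.
    by rewrite (_ : setT = set0) ?measure0//; apply/seteqP; split => // w' _; case: (Q w').
  by rewrite probability_setT => -[/eqP]; rewrite oner_eq0.
have [||c' H|N1 N1P] := @numerical_semigroup (fun k => reaches kernel_op k z z).
- exact: reaches0.
- by move=> a b; exact: reachesD.
- apply: (aper (x := z)) => k k0 kz; apply: H => //; exact: kstep_reaches.
exists z => x; have [k kP] := irr x z; exists (k + N1)%N => N kN.
have -> : N = (k + (N - k))%N by rewrite subnKC// (leq_trans (leq_addr _ _) kN).
by apply: (reachesD kernel_op_markov (kstep_reaches kP)); apply: N1P; lia.
Qed.

(** Only the states matter that the process visits with positive probability at some
time, and by irreducibility these are all states. *)
Theorem chain_switch_model :
  switch_model lam w c g kernel_op /\ tracks g kernel_op (X 0%N).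
Proof.
split; last first.
  apply: tracks_of_step => // t x f M _; exact: kernel_op_integral.
split => //.
  move=> x; have [t pos] := every_state_reached x.
  exists (schedule_law_at t x); split.
  - by move=> s; rewrite divr_ge0 ?pr_ge0.
  - exact: schedule_law_sum1.
  - by move=> phi; exact: slot_identity.
  apply: le_trans (bound_le _) _.
  have : P (X t @^-1` [set x]) != 0%E.
    by rewrite (pr_fin P (mat t x)) eqe gt_eqF.
  move=> /(wb (t := t)) /le_trans; apply; rewrite /cond_expectation /Rintegral.
  rewrite (_ : (\int[P]_(w' in _) _)%E = \int[P]_(w' in at_time t x)
      (weight R (g x) (schedule t w'))%:E)%E; last first.
    by apply: eq_integral => w'; rewrite inE => <-; rewrite qX.
  rewrite (schedule_integral (fun s => weight R (g x) s) pos)/= -/(pr P _) mulfK//.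
  exact: lt0r_neq0.
Qed.

End ChainModel.

(** * Scheduling policies with a finite memory *)

Section PolicyModel.
Variables (R : realType) (n : nat) (sw : switch R n) (eps w c : R).
Hypotheses (n0 : (0 < n)%N) (eps01 : 0 < eps < 1).
Hypothesis traffic : uniform_bernoulli sw eps.

Local Notation P := (sw_P sw).
Local Notation lam := ((1 - eps) / n%:R).
Local Notation arrival := (@arrival R n sw).
Local Notation schedule := (@schedule R n sw).
Local Notation queue := (@queue R n sw).

Variables (C : countType) (init : 'M[nat]_n -> C).
Local Notation S := ('M[nat]_n * C)%type.
Variables (upd : S -> 'M[nat]_n -> C) (k : S -> 'S_n -> R) (Inv : pred S).

Fixpoint policy_state (t : nat) (w' : sw_T sw) : S :=
  if t is t'.+1 then (queue t'.+1 w', upd (policy_state t' w') (queue t'.+1 w'))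
  else (queue 0%N w', init (queue 0%N w')).

Definition policy_next (x : S) (a : arr n) (s : 'S_n) : S :=
  (nextq x.1 a s, upd x (nextq x.1 a s)).

Definition no_arrival : arr n := [ffun=> false].

Hypotheses (k0 : forall x s, 0 <= k x s) (k1 : forall x, \sum_s k x s = 1).
Hypothesis law : forall t x s, pr P (policy_state t @^-1` [set x] `&` schedule t @^-1` [set s]) =
  k x s * pr P (policy_state t @^-1` [set x]).
Hypotheses (Inv_init : forall q, Inv (q, init q))
  (Inv_next : forall x a s, Inv x -> 0 < k x s -> Inv (policy_next x a s)).
Hypothesis gain : forall x, Inv x ->
  total R x.1 / n%:R + w * frob_norm (perpK (real_mx R x.1)) - c <=
  \sum_s k x s * weight R x.1 s.
Hypothesis Inv_finite : forall B : set 'M[nat]_n, finite_set B ->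
  finite_set [set x : S | Inv x /\ B x.1].

(** Slots without arrivals have positive probability, so a state that can stay put
during such slots, and to which all others drain, provides the common mass of
the minorization. *)
Definition drains (x y : S) := exists2 s, 0 < k x s & y = policy_next x no_arrival s.
Inductive drains_to (z : S) : S -> Prop :=
| drains_refl : drains_to z z
| drains_step x y : drains x y -> drains_to z y -> drains_to z x.
Variable z0 : S.
Hypotheses (z0_Inv : Inv z0) (z0_stays : drains z0 z0)
  (z0_reached : forall x, Inv x -> drains_to z0 x).

Let nR : 1 <= n%:R :> R. Proof. by rewrite ler1n. Qed.
Let lam_lt1 : 0 < lam < 1.
Proof.
case/andP: eps01 => ? ?; have n1 := nR; have n0R : 0 < n%:R :> R by lra.
apply/andP; split; first by rewrite divr_gt0// subr_gt0.
by rewrite ltr_pdivrMr//; lra.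
Qed.
Let lam01 : 0 <= lam <= 1. Proof. by case/andP: lam_lt1 => ? ?; apply/andP; split; lra. Qed.

Let St : countType := {x : S | Inv x}.
Let g (x : St) : 'M[nat]_n := (val x).1.
Let nxt (x : St) a s : St := insubd x (policy_next (val x) a s).

Let nxtE (x : St) a s : 0 < k (val x) s -> val (nxt x a s) = policy_next (val x) a s.
Proof. by move=> ks; rewrite insubdK//; apply: Inv_next => //; exact: valP. Qed.

Definition policy_op (f : St -> R) (x : St) : R :=
  fmean (slot_law lam (k (val x))) (fun u => f (nxt x u.2 u.1)).

Let raw_op (f : S -> R) (x : S) : R :=
  fmean (slot_law lam (k x)) (fun u => f (policy_next x u.2 u.1)).

Let law0 x u : 0 <= slot_law lam (k x) u.
Proof. by rewrite mulr_ge0// bern_ge0. Qed.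

Let law1 x : \sum_u slot_law lam (k x) u = 1.
Proof. by rewrite slot_law_sum1. Qed.

Let policy_op_markov : markov_operator policy_op.
Proof.
split=> [a f h x|f h fh x|a x]; last exact: fmean_cst.
  by rewrite /policy_op fmeanD fmeanZ.
by apply: fmean_le => // u; exact: fh.
Qed.

Let raw_op_markov : markov_operator raw_op.
Proof.
split=> [a f h x|f h fh x|a x]; last exact: fmean_cst.
  by rewrite /raw_op fmeanD fmeanZ.
by apply: fmean_le => // u; exact: fh.
Qed.

Let fmean_policy (F G : 'S_n * arr n -> R) x :
  (forall u, 0 < k x u.1 -> F u = G u) ->
  fmean (slot_law lam (k x)) F = fmean (slot_law lam (k x)) G.
Proof.
move=> FG; apply: eq_bigr => u _; have [ku|ku] := eqVneq (k x u.1) 0.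
  by rewrite /slot_law ku !mul0r.
by rewrite FG// lt_neqAle eq_sym ku k0.
Qed.

Let policy_op_raw (f : S -> R) x :
  policy_op (fun y => f (val y)) x = raw_op f (val x).
Proof. by apply: fmean_policy => u ku; rewrite nxtE. Qed.

Let iter_policy_op_raw (f : S -> R) t x :
  iter t policy_op (fun y => f (val y)) x = iter t raw_op f (val x).
Proof.
elim: t f x => [//|t IH] f x; rewrite !iterSr -IH; congr (iter t _ _ x).
by apply/funext => y; exact: policy_op_raw.
Qed.

Let past_set_mono t B : past (sw := sw) t B -> past (sw := sw) t.+1 B.
Proof.
move=> pB A [sA subA]; apply: pB; split=> // _ [[u [m [ut ->]]]|[u [s [ut ->]]]]; apply: subA.
  by left; exists u, m; split=> //; exact: leqW.
by right; exists u, s; split => //; exact: leqW.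
Qed.

Lemma policy_state_past t x : past t (policy_state t @^-1` [set x]).
Proof.
elim: t x => [|t IH] [q c'].
  have hq : past (sw := sw) 0 (queue 0%N @^-1` [set q]).
    by move=> A [_ subA]; apply: subA; left; exists 0%N, q.
  have [ic|nic] := pselect (init q = c').
    suff -> : policy_state 0 @^-1` [set (q, c')] = queue 0%N @^-1` [set q] by [].
    apply/seteqP; split => w' /=; first by move=> [].
    by move=> E; rewrite E ic.
  rewrite (_ : _ @^-1` _ = set0); first by move=> A [[A0 _ _] _].
  by apply/seteqP; split => // w' /= [qw icw]; apply: nic; rewrite -qw.
have hq : past (sw := sw) t.+1 (queue t.+1 @^-1` [set q]).
  by move=> A [_ subA]; apply: subA; left; exists t.+1, q.
pose G := [set A | (exists u m, (u <= t.+1)%N /\ A = queue u @^-1` [set m])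
            \/ (exists u s, (u < t.+1)%N /\ A = schedule u @^-1` [set s])].
have Xrv : discrete_rv (T := g_sigma_algebraType G) (policy_state t).
  by move=> x; exact: past_set_mono (IH x).
have := @discrete_rv_preimage _ (g_sigma_algebraType G) _ _ Xrv [set x | upd x q = c'].
move=> /(@measurableI _ (g_sigma_algebraType G) _ _ hq); congr (past _ _).
apply/seteqP; split => w' /=; first by move=> [-> ->].
by move=> [-> <-].
Qed.

Let state_history t x : history t (policy_state t @^-1` [set x]).
Proof. by apply: past_history; exact: policy_state_past. Qed.

Let state_rv t : discrete_rv (policy_state t).
Proof. by move=> x; apply: history_measurable; exact: state_history. Qed.

Let stateE t w' : queue t w' = (policy_state t w').1. Proof. by case: t. Qed.

Let state_step t x (f : S -> R) :
  (\int[P]_(w' in policy_state t @^-1` [set x]) (f (policy_state t.+1 w'))%:E =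
   (raw_op f x * pr P (policy_state t @^-1` [set x]))%:E)%E.
Proof.
have -> : (\int[P]_(w' in policy_state t @^-1` [set x]) (f (policy_state t.+1 w'))%:E =
    \int[P]_(w' in policy_state t @^-1` [set x])
      ((fun q => f (q, upd x q)) (queue t.+1 w'))%:E)%E.
  by apply: eq_integral => w'; rewrite inE /= => ->.
rewrite (slot_integral traffic (fun q => f (q, upd x q)) (@state_history t x) (q := x.1)).
  congr (_%:E); rewrite /raw_op /fmean -(pair_bigA _ (fun s a =>
    slot_law lam (k x) (s, a) * f (policy_next x a s)))/= mulr_suml.
  apply: eq_bigr => s _; rewrite law mulr_sumr mulr_suml; apply: eq_bigr => a _.
  by rewrite /slot_law/=; ring.
by move=> w' <-; exact: stateE.
Qed.

Let start (w' : sw_T sw) : St := exist Inv (queue 0%N w', init (queue 0%N w')) (Inv_init _).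

Let tracks_policy : tracks g policy_op start.
Proof.
have [X0rv trackE] : tracks (sw := sw) (fun x : S => x.1) raw_op (policy_state 0).
  by apply: tracks_of_step => // t x f M _; exact: state_step.
split; last first.
  move=> t phi M phiM; rewrite (trackE t phi M phiM); congr expectation.
  apply/funext => w'; rewrite (_ : (fun x => phi (g x)) = fun y : St => phi (val y).1)//.
  by rewrite (iter_policy_op_raw (fun y => phi y.1)).
move=> x; have := X0rv (val x); congr measurable; apply/seteqP; split => w' /=.
  by move=> E; apply: val_inj.
by move=> <-.
Qed.

Let drains_reaches (x y : St) : drains (val x) (val y) -> reaches policy_op 1 x y.
Proof.
move=> [s ks yE]; exists (slot_law lam (k (val x)) (s, no_arrival)).
  by rewrite mulr_gt0// bern_gt0.
move=> f f0; rewrite /= /policy_op /fmean (bigD1 (s, no_arrival))//=.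
have -> : nxt x no_arrival s = y by apply: val_inj; rewrite nxtE.
by rewrite lerDl sumr_ge0// => u _; rewrite mulr_ge0.
Qed.

Let drains_to_reaches z (x : St) : drains_to (val z) (val x) ->
  exists j, reaches policy_op j x z.
Proof.
move E : (val x) => x' xz; elim: xz x E => [x /val_inj ->|{}x' y xy yz IH x E].
  by exists 0%N; exact: reaches0.
have Iy : Inv y.
  by have [s ks ->] := xy; apply: Inv_next ks; rewrite -E; exact: valP.
have [j jP] := IH (exist Inv y Iy) erefl.
exists (1 + j)%N; apply: (reachesD policy_op_markov _ jP).
by apply: drains_reaches; rewrite E.
Qed.

(** The states that satisfy the invariant form the state space.  The schedule is allowed to be random
given the state, which is how sampling enters; the drained state [z0] with its
loop makes the chain aperiodic. *)
Theorem policy_switch_model : has_model sw eps w c.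
Proof.
exists St, g, policy_op, start; split; last exact: tracks_policy.
split => //.
- move=> x; exists (k (val x)); split => //; last exact: gain (valP x).
  by move=> phi; apply: fmean_policy => u ku; rewrite /g nxtE.
- pose z : St := exist Inv z0 z0_Inv.
  apply: (@reaches_loop _ _ _ policy_op_markov z).
    by apply: drains_reaches.
  by move=> x; apply: drains_to_reaches; apply: z0_reached; exact: valP.
- move=> B fB; rewrite (_ : g @^-1` B = val @^-1` [set x : S | Inv x /\ B x.1]).
    by apply: finite_preimage (Inv_finite fB) => x y _ _; exact: val_inj.
  by apply/seteqP; split => [x Bx|x []//]; split => //; exact: valP.
Qed.

End PolicyModel.

(** * Policies that sample schedules *)

Section Draining.
Variables (R : realType) (n : nat).
Hypothesis n0 : (0 < n)%N.
Implicit Types (q : 'M[nat]_n) (s : 'S_n).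

Definition load q : nat := (\sum_i \sum_j q i j)%N.

Definition serve q s : 'M[nat]_n := nextq q (no_arrival n) s.

Lemma serveE q s i j : serve q s i j = (q i j - (s i == j))%N.
Proof. by rewrite !mxE ffunE addn0. Qed.

Lemma serve_le q s : (load (serve q s) <= load q)%N.
Proof. by do 2!apply: leq_sum => ? _; rewrite serveE leq_subr. Qed.

Lemma serve_lt q s : 0 < weight R q s -> (load (serve q s) < load q)%N.
Proof.
rewrite weightE -natr_sum ltr0n lt0n sum_nat_eq0 negb_forall => /existsP[i /=].
rewrite -lt0n => qi.
rewrite /load (bigD1 i)//= [X in (_ < X)%N](bigD1 i)//= -addSn leq_add//; last first.
  by do 2!apply: leq_sum => ? _; rewrite serveE leq_subr.
rewrite (bigD1 (s i))//= [X in (_ < X)%N](bigD1 (s i))//= -addSn leq_add//.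
  by rewrite serveE eqxx ltn_subrL qi.
by apply: leq_sum => ? _; rewrite serveE leq_subr.
Qed.

Lemma serve0 s : serve (const_mx 0%N) s = const_mx 0%N.
Proof. by apply/matrixP => i j; rewrite serveE !mxE. Qed.

Lemma total_gt0 q : q != const_mx 0%N -> 0 < total R q.
Proof.
apply: contra_neqT; rewrite -leNgt => T0; apply/matrixP => i j; rewrite mxE.
have : total R q = 0 by apply/eqP; rewrite eq_le T0; do 2!apply: sumr_ge0 => ? _.
move/psumr_eq0P => H; have {}H := H (fun i _ => sumr_ge0 _ (fun j _ => ler0n _ _)).
move/psumr_eq0P: (H i erefl) => {}H.
by have /eqP := H (fun j _ => ler0n _ _) j erefl; rewrite pnatr_eq0 => /eqP.
Qed.

Lemma max_weight_gt0 q : q != const_mx 0%N -> 0 < max_weight R q.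
Proof.
move=> /total_gt0 T0; have := max_weight_gap R q.
have := frob_norm_ge0 (perpK (real_mx R q)) => p0 H.
have : 0 < n%:R * max_weight R q by lra.
by rewrite pmulr_rgt0// ltr0n.
Qed.

End Draining.

Section SampledPolicies.
Variables (R : realType) (n : nat) (sw : switch R n) (eps w : R).
Hypotheses (n0 : (0 < n)%N) (eps01 : 0 < eps < 1) (w0 : 0 <= w).
Hypothesis traffic : uniform_bernoulli sw eps.
Variables (Xi : finType) (rule : 'M[nat]_n -> Xi -> 'S_n).
Hypotheses (Xi0 : (0 < #|Xi|)%N) (sampled : sampled_schedule sw rule).
Hypothesis gain : forall q,
  total R q / n%:R + w * frob_norm (perpK (real_mx R q)) <=
  #|Xi|%:R^-1 * \sum_xi weight R q (rule q xi).

Local Notation P := (sw_P sw).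
Local Notation S := ('M[nat]_n * unit)%type.

Let init (q : 'M[nat]_n) : unit := tt.
Let upd (x : S) (q : 'M[nat]_n) : unit := tt.
Let k (x : S) s : R := #|Xi|%:R^-1 * \sum_xi (rule x.1 xi == s)%:R.

Let k0 x s : 0 <= k x s.
Proof. by rewrite mulr_ge0 ?invr_ge0// sumr_ge0. Qed.

Let sum_k x (F : 'S_n -> R) : \sum_s k x s * F s = #|Xi|%:R^-1 * \sum_xi F (rule x.1 xi).
Proof.
under eq_bigr do rewrite -mulrA mulr_suml.
rewrite -mulr_sumr exchange_big/=; congr (_ * _); apply: eq_bigr => xi _.
rewrite (bigD1 (rule x.1 xi))//= eqxx mul1r big1 ?addr0// => s.
by rewrite eq_sym => /negbTE ->; rewrite mul0r.
Qed.

Let k1 x : \sum_s k x s = 1.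
Proof.
transitivity (\sum_s k x s * 1); first by apply: eq_bigr => s _; rewrite mulr1.
by rewrite sum_k sumr_const mulVf// pnatr_eq0 -lt0n.
Qed.

Let law t x s :
  pr P (policy_state init upd t @^-1` [set x] `&` @schedule R n sw t @^-1` [set s]) =
  k x s * pr P (policy_state init upd t @^-1` [set x]).
Proof.
have [xi [xirv xilaw sE]] := sampled.
set E := policy_state init upd t @^-1` [set x].
have pE : past t E by exact: policy_state_past.
have mE : measurable E by apply: history_measurable; apply: past_history; exact: pE.
have qE w' : E w' -> queue t w' = x.1 by rewrite /E /= => <-; case: (t).
have : (\int[P]_(w' in E) (schedule t w' == s)%:R%:E =
        \int[P]_(w' in E) (rule x.1 (xi t w') == s)%:R%:E)%E.
  by apply: eq_integral => w'; rewrite inE => /qE qw; rewrite sE qw.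
rewrite (integral_finite_support (s := enum {: 'S_n}) (fun s' => (s' == s)%:R)
  (@schedule_rv _ _ sw t) mE (enum_uniq _)); last first.
  by rewrite (_ : _ `&` _ = set0) ?measure0//; apply/seteqP; split => // w' [_ /=]; rewrite mem_enum.
rewrite (integral_finite_support (s := enum {: Xi}) (fun u => (rule x.1 u == s)%:R)
  (xirv t) mE (enum_uniq _)); last first.
  by rewrite (_ : _ `&` _ = set0) ?measure0//; apply/seteqP; split => // w' [_ /=]; rewrite mem_enum.
case; rewrite !big_enum/= (bigD1 s)//= eqxx mul1r big1 ?addr0 => [->|s' /negbTE ->]; last first.
  by rewrite mul0r.
rewrite /k -mulrA mulr_suml mulr_sumr; apply: eq_bigr => u _.
rewrite [RHS]mulrCA; congr (_ * _).
by rewrite /pr setIC xilaw// fineM// fin_num_measure.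
Qed.

Theorem sampled_switch_model : has_model sw eps w 0.
Proof.
pose z0 : S := (const_mx 0%N, tt).
have someS x : exists2 s, 0 < k x s & x.1 != const_mx 0%N -> 0 < weight R x.1 s.
  have [x0|x0] := eqVneq x.1 (const_mx 0%N).
    have [xi _] : exists xi : Xi, true by move/card_gt0P: Xi0 => [xi _]; exists xi.
    exists (rule x.1 xi) => //; rewrite mulr_gt0 ?invr_gt0 ?ltr0n//.
    by rewrite (bigD1 xi)//= eqxx ltr_pwDl// sumr_ge0.
  have : 0 < #|Xi|%:R^-1 * \sum_xi weight R x.1 (rule x.1 xi).
    apply: lt_le_trans (gain x.1); rewrite ltr_pwDl//.
      by rewrite divr_gt0 ?ltr0n// total_gt0.
    by rewrite mulr_ge0// frob_norm_ge0.
  rewrite -(sum_k x (weight R x.1)) => sumpos.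
  have [s _ ks] : exists2 s, true & 0 < k x s * weight R x.1 s.
    apply/exists2P; apply: contrapT => /forallNP H; move: sumpos; rewrite ltNge.
    apply/negP/negPn/sumr_le0 => s _; rewrite leNgt; apply/negP => ks.
    by apply: (H s).
  exists s => [|_]; rewrite lt_neqAle ?k0 ?weight_ge0 andbT eq_sym.
    by apply: contraTneq ks => ->; rewrite mul0r ltxx.
  by apply: contraTneq ks => ->; rewrite mulr0 ltxx.
have nextE x s : policy_next upd x (no_arrival n) s = (serve x.1 s, tt) by [].
apply: (@policy_switch_model _ _ _ _ _ _ n0 eps01 traffic _ init upd k xpredT k0 k1 law
  _ _ _ _ z0) => //.
- by move=> x _; rewrite sum_k subr0.
- move=> B fB; rewrite (_ : [set _ | _] = fst @^-1` B); last first.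
    by apply/seteqP; split => x //= [].
  by apply: finite_preimage fB => -[q []] [q' []] _ _ /= ->.
- by have [s ks _] := someS z0; exists s; rewrite ?nextE ?serve0.
- move=> [q []] _; have [N] := ubnP (load q); elim: N q => // N IH q qN.
  have [->|q0] := eqVneq q (const_mx 0%N); first exact: drains_refl.
  have [s ks ws] := someS (q, tt).
  apply: (@drains_step _ _ _ _ _ _ _ (serve q s, tt)); first by exists s.
  by apply: IH; rewrite -ltnS; apply: leq_trans qN; rewrite ltnS; apply: serve_lt (ws q0).
Qed.

End SampledPolicies.

(** * Policies that run MaxWeight on outdated queue lengths *)

Section QueueVariation.
Variables (R : realType) (n : nat).
Implicit Types (q : 'M[nat]_n) (s : 'S_n) (a : arr n).

Lemma weight_nextq_ge q a s s' : weight R q s - n%:R <= weight R (nextq q a s') s.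
Proof.
rewrite !weightE lerBlDr -[X in _ + X%:R](card_ord n) -sum1_card natr_sum -big_split/=.
by apply: ler_sum => i _; rewrite !mxE -natrD ler_nat; case: (a _); case: (_ == _); lia.
Qed.

Lemma max_weight_nextq_le q a s : max_weight R (nextq q a s) <= max_weight R q + n%:R.
Proof.
apply: max_weight_le => [|s'].
  by rewrite addr_ge0// (le_trans (weight_ge0 R q s))// weight_le_max.
apply: le_trans (_ : weight R q s' + n%:R <= _); last by rewrite lerD2r weight_le_max.
rewrite !weightE -[X in _ + X%:R](card_ord n) -sum1_card natr_sum -big_split/=.
by apply: ler_sum => i _; rewrite !mxE -natrD ler_nat; case: (a _); case: (_ == _); lia.
Qed.

Lemma load_eq0 q : (load q == 0%N) = (q == const_mx 0%N).
Proof.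
apply/eqP/eqP => [/eqP|->]; last by rewrite /load big1// => i _; rewrite big1// => j _; rewrite mxE.
rewrite sum_nat_eq0 => /forallP q0; apply/matrixP => i j; rewrite mxE.
by have /= := q0 i; rewrite sum_nat_eq0 => /forallP/(_ j)/= /eqP.
Qed.

Lemma serve_idle q s : weight R q s = 0 -> serve q s = q.
Proof.
rewrite weightE -natr_sum => /eqP; rewrite pnatr_eq0 sum_nat_eq0 => /forallP q0.
apply/matrixP => i j; rewrite serveE; case: eqP => [<-|_]; last by rewrite subn0.
by have /eqP -> := q0 i.
Qed.

End QueueVariation.

Section DeterministicPolicies.
Variables (R : realType) (n : nat) (sw : switch R n) (eps c : R).
Hypotheses (n0 : (0 < n)%N) (eps01 : 0 < eps < 1).
Hypothesis traffic : uniform_bernoulli sw eps.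
Variables (mw : 'M[nat]_n -> 'S_n) (C : countType) (init : 'M[nat]_n -> C).
Local Notation S := ('M[nat]_n * C)%type.
Variables (upd : S -> 'M[nat]_n -> C) (sigma : S -> 'S_n) (Inv : pred S) (D : set C) (c0 : C).

Definition quiet (x : S) : S := policy_next upd x (no_arrival n) (sigma x).

Local Notation z0 := ((const_mx 0%N, c0) : S).

Hypothesis mwP : is_maxweight_rule R mw.
Hypothesis scheduleE : forall t w',
  @schedule R n sw t w' = sigma (policy_state init upd t w').
Hypotheses (Inv_init : forall q, Inv (q, init q))
  (Inv_next : forall x a, Inv x -> Inv (policy_next upd x a (sigma x))).
Hypothesis near_optimal : forall x, Inv x -> max_weight R x.1 - c <= weight R x.1 (sigma x).
Hypotheses (finD : finite_set D) (Inv_D : forall x, Inv x -> D x.2).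
Hypotheses (z0_Inv : Inv z0) (z0_quiet : quiet z0 = z0).
Hypothesis settles : forall x, Inv x -> x.1 = const_mx 0%N -> exists N, iter N quiet x = z0.
(** Without arrivals the policy either serves a packet or ends up using a
MaxWeight schedule of the current queues. *)
Hypothesis refreshes : forall x, Inv x -> exists N,
  (load (iter N quiet x).1 < load x.1)%N \/ sigma (iter N quiet x) = mw (iter N quiet x).1.

Local Notation P := (sw_P sw).

Let max_weight_mw q : max_weight R q = weight R q (mw q).
Proof. by apply/eqP; rewrite eq_le weight_le_max max_weight_le// weight_ge0. Qed.

Let load_iter x N : (load (iter N quiet x).1 <= load x.1)%N.
Proof. by elim: N => //= N IH; apply: leq_trans IH; exact: serve_le. Qed.

Let Inv_iter x N : Inv x -> Inv (iter N quiet x).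
Proof. by move=> Ix; elim: N => //= N IH; exact: Inv_next. Qed.

Let progress x : Inv x -> x.1 != const_mx 0%N ->
  exists N, (load (iter N quiet x).1 < load x.1)%N.
Proof.
move=> Ix x0; have [N [H|H]] := refreshes Ix; first by exists N.
have [lt|ge] := ltnP (load (iter N quiet x).1) (load x.1); first by exists N.
exists N.+1; apply: leq_trans (load_iter x N); apply: (@serve_lt R).
rewrite H -max_weight_mw; apply: max_weight_gt0 => //; apply: contraNneq x0 => E.
by move: ge; rewrite E [leqRHS](eqP (_ : _ == 0%N)) ?load_eq0// leqn0 load_eq0.
Qed.

Let reaches_empty x : Inv x -> exists N, iter N quiet x = z0.
Proof.
have [K] := ubnP (load x.1); elim: K x => // K IH x xK Ix.
have [x0|x0] := eqVneq x.1 (const_mx 0%N); first exact: settles.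
have [N lt] := progress Ix x0.
have [|M E] := IH (iter N quiet x) _ (Inv_iter N Ix).
  by rewrite -ltnS; apply: leq_trans xK.
by exists (M + N)%N; rewrite iterD.
Qed.

Let k (x : S) s : R := (sigma x == s)%:R.

Let sum_k x (F : 'S_n -> R) : \sum_s k x s * F s = F (sigma x).
Proof.
rewrite (bigD1 (sigma x))//= /k eqxx mul1r big1 ?addr0// => s.
by rewrite eq_sym => /negbTE ->; rewrite mul0r.
Qed.

Let law t x s :
  pr P (policy_state init upd t @^-1` [set x] `&` @schedule R n sw t @^-1` [set s]) =
  k x s * pr P (policy_state init upd t @^-1` [set x]).
Proof.
rewrite /k; have [<-|ne] := eqVneq (sigma x) s.
  rewrite mul1r; congr pr; apply/seteqP; split => w' /=; first by case.
  by move=> E; rewrite scheduleE E.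
rewrite mul0r (_ : _ `&` _ = set0) ?/pr ?measure0//; apply/seteqP; split => // w' /= [E].
by rewrite scheduleE E; apply/eqP.
Qed.

Theorem deterministic_switch_model : has_model sw eps n%:R^-1 c.
Proof.
have nR : 0 < n%:R :> R by rewrite ltr0n.
have quietP x : drains upd k x (quiet x) by exists (sigma x); rewrite // /k eqxx ltr01.
apply: (@policy_switch_model _ _ _ _ _ _ n0 eps01 traffic _ init upd k Inv _ _ law
  _ _ _ _ z0) => //.
- move=> x; transitivity (\sum_s k x s * 1); first by apply: eq_bigr => s _; rewrite mulr1.
  by rewrite sum_k.
- move=> x a s Ix; rewrite /k; case: eqP => [<- _|]; [exact: Inv_next|by rewrite ltxx].
- move=> x Ix; rewrite sum_k; apply: le_trans (near_optimal Ix); rewrite lerD2r.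
  by rewrite mulrC -mulrDr mulrC ler_pdivrMr// mulrC max_weight_gap.
- move=> B fB; apply: sub_finite_set (finite_setX fB finD) => x [Ix Bx].
  by split => //; exact: Inv_D.
- by rewrite -{2}z0_quiet.
- move=> x Ix; have [N <-] := reaches_empty Ix.
  elim: N x Ix => [|N IH] x Ix; first exact: drains_refl.
  by rewrite iterSr; apply: drains_step (quietP x) (IH _ _); exact: Inv_next.
Qed.

End DeterministicPolicies.

Section OutdatedMaxWeight.
Variables (R : realType) (n : nat) (sw : switch R n) (eps : R) (m : nat).
Variable mw : 'M[nat]_n -> 'S_n.
Hypotheses (n0 : (0 < n)%N) (eps01 : 0 < eps < 1).
Hypotheses (traffic : uniform_bernoulli sw eps) (mwP : is_maxweight_rule R mw).

Local Notation lag k := (2 * n%:R * k%:R : R).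

Let max_weight_mw q : max_weight R q = weight R q (mw q).
Proof. by apply/eqP; rewrite eq_le weight_le_max max_weight_le// weight_ge0. Qed.

(** One slot costs a schedule at most [2 n] of its distance to MaxWeight: the
weight of a fixed schedule and the maximal weight each change by at most [n]. *)
Let lag_next (q : 'M[nat]_n) a s s' k : max_weight R q - lag k <= weight R q s ->
  max_weight R (nextq q a s') - lag k.+1 <= weight R (nextq q a s') s.
Proof.
have := max_weight_nextq_le R q a s'; have := weight_nextq_ge R q a s s'.
rewrite -(natr1 k) mulrDr mulr1 => ? ? ?; lra.
Qed.

Let lag0 (q : 'M[nat]_n) k : max_weight R q - lag k <= weight R q (mw q).
Proof. by rewrite max_weight_mw gerBl// !mulr_ge0. Qed.

Section Bursty.
Hypotheses (m0 : (0 < m)%N) (bursty : bursty_maxweight sw m mw).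
Local Notation C := (nat * 'S_n)%type.
Local Notation S := ('M[nat]_n * C)%type.

Let init q : C := (0%N, mw q).
Let upd (x : S) q' : C :=
  let k := if q' == const_mx 0%N then 0%N else (x.2.1.+1 %% m)%N in
  (k, if k == 0%N then mw q' else x.2.2).
Let sigma (x : S) := x.2.2.
Let Inv (x : S) : bool := [&& (x.2.1 < m)%N, (x.2.1 == 0%N) ==> (x.2.2 == mw x.1),
  (x.1 == const_mx 0%N) ==> (x.2.1 == 0%N) &
  max_weight R x.1 - lag x.2.1 <= weight R x.1 x.2.2].

Let stateE t w : policy_state (sw := sw) init upd t w =
  (queue t w, (burst_counter m t w, schedule t w)).
Proof.
elim: t => [|t IH] /=; first by rewrite bursty.
by rewrite {1}/upd IH/= [schedule t.+1 w]bursty.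
Qed.

Let Inv_next x a : Inv x -> Inv (policy_next upd x a (sigma x)).
Proof.
rewrite /Inv /= => /and4P[km k0 x0 opt].
have [E|ne] := eqVneq; first by rewrite eqxx/= m0 eqxx/= lag0.
have [E|ne'] := eqVneq (x.2.1.+1 %% m)%N 0%N; first by rewrite E m0 eqxx/= lag0.
rewrite ltn_mod m0/=; have kE : (x.2.1.+1 %% m = x.2.1.+1)%N.
  rewrite modn_small// ltn_neqAle km andbT.
  by apply: contraNneq ne' => ->; rewrite modnn.
by rewrite kE; exact: lag_next.
Qed.

Let quietE (x : S) : quiet upd sigma x = (serve x.1 x.2.2, upd x (serve x.1 x.2.2)).
Proof. by []. Qed.

Let bursty_refreshes j x : Inv x -> (m - x.2.1 <= j)%N ->
  exists N, sigma (iter N (quiet upd sigma) x) = mw (iter N (quiet upd sigma) x).1.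
Proof.
elim: j x => [|j IH] x Ix jx.
  by case/and4P: Ix => km _ _ _; move: jx; rewrite leqn0 subn_eq0 leqNgt km.
have Iy := Inv_next (no_arrival n) Ix.
have [k0|k0] := eqVneq (quiet upd sigma x).2.1 0%N.
  by exists 1%N; case/and4P: Iy => _ /implyP H _ _; apply/eqP/H/eqP.
have [|N E] := IH (quiet upd sigma x) Iy; last by exists N.+1; rewrite iterSr.
have kx : (quiet upd sigma x).2.1 = x.2.1.+1.
  move: k0; rewrite /=; case: ifP => // _ k0; rewrite modn_small//.
  case/and4P: Ix => km _ _ _; rewrite ltn_neqAle km andbT.
  by apply: contraNneq k0 => ->; rewrite modnn.
by rewrite kx; lia.
Qed.

Lemma bursty_switch_model : has_model sw eps n%:R^-1 (lag m).
Proof.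
pose c0 : C := (0%N, mw (const_mx 0%N)).
have upd0 : upd (const_mx 0%N, c0) (const_mx 0%N) = c0 by rewrite /upd eqxx/=.
apply: (@deterministic_switch_model _ _ _ _ _ n0 eps01 traffic mw _ init upd sigma Inv
  (`I_m `*` setT) c0) => //.
- by move=> t w; rewrite stateE.
- by move=> q; rewrite /Inv/= m0 !eqxx lag0 !implybT.
- move=> x /and4P[km _ _]; apply: le_trans; rewrite lerD2l lerN2.
  by rewrite ler_wpM2l ?mulr_ge0// ler_nat ltnW.
- by apply: finite_setX; [exact: finite_II|exact: finite_finset].
- by move=> x /and4P[].
- by rewrite /Inv/= m0 !eqxx lag0.
- by rewrite quietE serve0 upd0.
- move=> [q [k s]] /and4P[/= _ k0 q0 _] E; exists 0%N; rewrite /= E.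
  by move: k0 q0; rewrite E eqxx => /implyP H /eqP k0; rewrite k0 in H *; rewrite (eqP (H _)).
- move=> x Ix; have [N E] := bursty_refreshes Ix (leqnn _); by exists N; right.
Qed.

End Bursty.

Section Pipelined.
Hypothesis pipelined : pipelined_maxweight sw m mw.
Local Notation C := (seq 'S_n)%type.
Local Notation S := ('M[nat]_n * C)%type.

Let init q : C := nseq m (mw q).
Let upd (x : S) (q' : 'M[nat]_n) : C := behead (rcons x.2 (mw x.1)).
Let sigma (x : S) := head (mw x.1) x.2.
Let Inv (x : S) : bool := (size x.2 == m) &&
  [forall j : 'I_m, max_weight R x.1 - lag (m - j)%N <= weight R x.1 (nth (mw x.1) x.2 j)].

Let stateE t w : policy_state (sw := sw) init upd t w =
  (queue t w, mkseq (fun j => mw (queue (t + j - m)%N w)) m).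
Proof.
elim: t => [|t IH] /=.
  congr (_, _); rewrite /init; apply: (@eq_from_nth _ 1%g) => [|j].
    by rewrite size_nseq size_mkseq.
  rewrite size_nseq => jm; rewrite nth_nseq jm nth_mkseq// add0n.
  by have -> : (j - m = 0)%N by lia.
rewrite /upd IH/=; congr (_, _).
apply: (@eq_from_nth _ 1%g) => [|j].
  by rewrite size_behead size_rcons !size_mkseq.
rewrite size_behead size_rcons size_mkseq/= => jm; rewrite nth_behead nth_rcons size_mkseq.
rewrite [RHS]nth_mkseq//; have [lt|ge] := ltnP j.+1 m.
  by rewrite nth_mkseq//; congr (mw (queue _ w)); lia.
have -> : j.+1 == m by rewrite eqn_leq ge jm.
by congr (mw (queue _ w)); lia.
Qed.

Let Inv_next x a : Inv x -> Inv (policy_next upd x a (sigma x)).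
Proof.
move=> /andP[/eqP sz /forallP opt]; apply/andP; split.
  by rewrite /= size_behead size_rcons sz.
apply/forallP => j; have jm := ltn_ord j.
rewrite /= nth_behead nth_rcons sz; have [lt|ge] := ltnP j.+1 m.
  rewrite -subnSK//; apply: lag_next.
  by rewrite (set_nth_default (mw x.1)) ?sz//; exact: (opt (Ordinal lt)).
have -> : j.+1 == m by rewrite eqn_leq ge jm.
rewrite -subnSK//; apply: lag_next.
exact: lag0.
Qed.

(** As long as no packet has been served, every schedule that enters the
pipeline is MaxWeight for the current queues. *)
Let quiet_pipeline x i : size x.2 = m -> (i <= m)%N ->
  (exists j, (load (iter j (quiet upd sigma) x).1 < load x.1)%N) \/
  iter i (quiet upd sigma) x = (x.1, drop i x.2 ++ nseq i (mw x.1)).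
Proof.
move=> sz; elim: i => [|i IH] im; first by right; rewrite drop0 cats0; case: (x).
have [|E] := IH (ltnW im); first by left.
set s := sigma (x.1, drop i x.2 ++ nseq i (mw x.1)).
have [ws|ws] := eqVneq (weight R x.1 s) 0; last first.
  left; exists i.+1; rewrite iterS E; apply: (@serve_lt R).
  by rewrite lt_neqAle eq_sym ws weight_ge0.
right; rewrite iterS E /quiet /policy_next /= -/s.
rewrite [nextq _ _ _](serve_idle ws) /upd/=; congr (_, _).
rewrite (drop_nth 1%g) ?sz//= rcons_cat; congr (_ ++ _).
by rewrite -cats1 -(nseqD i 1) addn1.
Qed.

Lemma pipelined_switch_model : has_model sw eps n%:R^-1 (lag m).
Proof.
pose c0 : C := nseq m (mw (const_mx 0%N)).
have Inv_nseq q : Inv (q, nseq m (mw q)).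
  rewrite /Inv/= size_nseq eqxx; apply/forallP => j; rewrite nth_nseq ltn_ord.
  exact: lag0.
have full x : Inv x -> drop m x.2 ++ nseq m (mw x.1) = nseq m (mw x.1).
  by move=> /andP[/eqP sz _]; rewrite drop_oversize ?sz.
have head_nseq q : head (mw q) (nseq m (mw q)) = mw q by case: (m).
apply: (@deterministic_switch_model _ _ _ _ _ n0 eps01 traffic mw _ init upd sigma Inv
  [set l | size l = m] c0) => //.
- move=> t w; rewrite stateE /sigma/= pipelined -nth0; case: (posnP m) => [->|m0].
    by rewrite subn0.
  by rewrite nth_mkseq// addn0.
- move=> x /andP[/eqP sz /forallP opt]; rewrite /sigma.
  case: (posnP m) => [mE|m0].
    by have := size0nil (etrans sz mE) => -> /=; exact: lag0.
  by have := opt (Ordinal m0); rewrite /= subn0 nth0.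
- apply: (@sub_finite_set _ _ (range (@tval m 'S_n))).
    by move=> l /= /eqP sz; exists (Tuple sz).
  by apply: finite_image; exact: finite_finset.
- by move=> x /andP[/eqP].
- rewrite /quiet /policy_next [nextq _ _ _]serve0 /upd; congr (_, _).
  by rewrite /= /c0 -cats1 -(nseqD m 1) addn1.
- move=> x Ix x0; exists m; have /andP[/eqP sz _] := Ix.
  have [[j]|->] := quiet_pipeline sz (leqnn m); last by rewrite full// x0.
  have /eqP l0 : load x.1 == 0%N by rewrite load_eq0 x0.
  by rewrite l0.
- move=> x Ix; have /andP[/eqP sz _] := Ix.
  have [[j lt]|E] := quiet_pipeline sz (leqnn m); first by exists j; left.
  by exists m; right; rewrite E full// /sigma /= head_nseq.
Qed.

End Pipelined.
End OutdatedMaxWeight.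

(** * The gain of a switch is at most of order [n] *)

Section GainBound.
Variables (R : realType) (n : nat).
Implicit Types (q : 'M[nat]_n) (s : 'S_n).

(** On [coneS] every schedule has the same weight, so the advantage of a schedule
over the average one comes from the distance to the cone. *)
Lemma weight_excess_le q s : (0 < n)%N ->
  weight R q s <= total R q / n%:R + 2 * n%:R * frob_norm (perpK (real_mx R q)).
Proof.
move=> n0; have nR : 1 <= n%:R :> R by rewrite ler1n.
set x := real_mx R q; set d := frob_norm _.
have d0 : 0 <= d by exact: frob_norm_ge0.
have xE : x = projK x + perpK x by rewrite /perpK addrC subrK.
have [Sz _] := projK_coneK x.
have Ez := coneS_frob_perm s Sz.
have Ew : weight R q s = frob (projK x) (perm_mx s) + frob (perpK x) (perm_mx s).
  by rewrite /weight -frobDl -xE.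
have Et : total R q = (\sum_i \sum_j projK x i j) + \sum_i \sum_j perpK x i j.
  rewrite -big_split; apply: eq_bigr => i _; rewrite -big_split; apply: eq_bigr => j _.
  by have := congr1 (fun y : 'M[R]_n => y i j) xE; rewrite !mxE.
have bs : frob (perpK x) (perm_mx s) <= n%:R * d.
  rewrite frob_perm -[X in X%:R * _](card_ord n) mulr_natl -sumr_const.
  by apply: ler_sum => i _; apply: le_trans (ler_norm _) (entry_le_frob_norm _ _ _).
have := sum_le_frob_norm (perpK x); rewrite ler_norml => /andP[bt _].
rewrite Ew Et -Ez -(ler_pM2l (_ : 0 < n%:R))//; last by lra.
rewrite [leRHS]mulrDr (mulrC n%:R (_ / _)) divfK; last by rewrite gt_eqF//; lra.
have nd : n%:R * d <= n%:R * (n%:R * d) by rewrite ler_peMl// mulr_ge0.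
have nbs := ler_wpM2l (ler0n R n) bs; rewrite -/d in bt; lra.
Qed.

Variables (lam w : R) (St : countType) (g : St -> 'M[nat]_n) (A : (St -> R) -> St -> R).
Hypotheses (n1 : (1 < n)%N) (lam01 : 0 < lam < 1).
Hypothesis model : switch_model lam w 0 g A.

(** A single arrival at an entry that is not served moves [x] off [coneS], by the
cross relation of [coneS]; hence the queues cannot stay in the cone. *)
Lemma exists_off_cone : exists x, 0 < frob_norm (perpK (real_mx R (g x))).
Proof.
apply: contrapT => /forallNP on_cone.
have [x0 _] := sm_reach model.
have [k [k0 k1 Ak _]] := sm_slot model x0.
pose phi q : R := (0 < frob_norm (perpK (real_mx R q)))%R%:R.
have [s ks] : exists s, 0 < k s.
  apply: contrapT => /forallNP H; have := ltr01 (R := R); rewrite -k1 ltNge.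
  by move/negP; apply; apply: sumr_le0 => s _; rewrite leNgt; apply/negP.
have A0 : fmean (slot_law lam k) (fun u => phi (nextq (g x0) u.2 u.1)) = 0.
  rewrite -Ak -(mo_cst (sm_markov model) 0 x0); congr A; apply/funext => y.
  by rewrite /phi; case: ltP (on_cone y).
have l01 : 0 <= lam <= 1 by case/andP: lam01 => ? ?; apply/andP; split; lra.
have next_cone a : coneS (real_mx R (nextq (g x0) a s)).
  have pos u : 0 <= slot_law lam k u * phi (nextq (g x0) u.2 u.1).
    by rewrite !mulr_ge0// bern_ge0.
  have /eqP : slot_law lam k (s, a) * phi (nextq (g x0) a s) = 0.
    by apply: (psumr_eq0P (fun u _ => pos u) A0).
  rewrite mulf_eq0 /slot_law/= mulf_eq0 (gt_eqF ks) (gt_eqF (bern_gt0 a lam01))/=.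
  rewrite pnatr_eq0 eqb0 -leNgt => d0.
  suff -> : real_mx R (nextq (g x0) a s) = projK (real_mx R (nextq (g x0) a s)).
    by have [] := projK_coneK (real_mx R (nextq (g x0) a s)).
  apply/eqP; rewrite -subr_eq0; apply/eqP/matrixP => i j; rewrite [RHS]mxE.
  apply/eqP; rewrite -normr_eq0 eq_le normr_ge0 andbT.
  by apply: le_trans (entry_le_frob_norm (perpK (real_mx R (nextq (g x0) a s))) i j) _.
pose i0 : 'I_n := Ordinal (ltnW n1); pose i1 : 'I_n := Ordinal n1.
have i01 : i0 != i1 by [].
have s01 : s i0 != s i1 by rewrite (inj_eq perm_inj).
pose a : arr n := [ffun p => p == (i0, s i1)].
have /coneS_crossP/(_ i0 (s i1) i1 (s i0)) := next_cone (no_arrival n).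
have /coneS_crossP/(_ i0 (s i1) i1 (s i0)) := next_cone a.
have i10 : (i1 == i0) = false by [].
have s10 : (s i1 == s i0) = false by rewrite eq_sym (negbTE s01).
rewrite !mxE !ffunE !xpair_eqE !eqxx (negbTE s01) ?i10 ?s10 ?(negbTE s01)/= !addn0 !subn0 natrD.
by move=> ? ?; lra.
Qed.

Lemma gain_le : w <= 2 * n%:R.
Proof.
have [x d0] := exists_off_cone.
have [k [k0 k1 _ gain]] := sm_slot model x.
set d := frob_norm _ in d0 gain.
have : \sum_s k s * weight R (g x) s <= total R (g x) / n%:R + 2 * n%:R * d.
  set b := leRHS; rewrite (_ : b = \sum_s k s * b); last by rewrite -mulr_suml k1 mul1r.
  apply: ler_sum => s _.
  exact: (ler_wpM2l (k0 s) (weight_excess_le (g x) s (ltnW n1))).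
move=> /(le_trans gain) H; rewrite -(ler_pM2r d0); lra.
Qed.

End GainBound.

(** * The six cases *)

Section Cases.
Variables (R : realType) (beta : R) (eps : nat -> R) (sw : forall n, switch R n).
Hypothesis eps01 : forall n, (0 < n)%N -> 0 < eps n < 1.
Hypothesis epsTheta : eps \is 'Theta_\oo (fun n : nat => n%:R `^ (- beta)).
Hypothesis traffic : forall n, (0 < n)%N -> uniform_bernoulli (sw n) (eps n).

Local Notation lam n := ((1 - eps n) / n%:R).

Lemma heavy_traffic_of_models (n1 : nat) (w c : nat -> R) (a b C : R) :
  (0 < n1)%N -> 0 <= a -> 1 <= b -> 1 + a + b < beta -> 1 <= C ->
  (forall n, (n1 <= n)%N -> 0 < w n <= 1 /\ 0 <= c n) ->
  (\forall n \near \oo, (w n)^-1 <= C * n%:R `^ a /\ n%:R + c n <= C * n%:R `^ b) ->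
  (forall n, (n1 <= n)%N -> has_model (sw n) (eps n) (w n) (c n)) ->
  heavy_traffic_limit n1 eps sw.
Proof.
move=> n1_gt0 a0 b1 ab C1 wc near_wc models.
apply: (heavy_traffic_of_estimates n1_gt0 eps01 epsTheta a0 b1 ab C1 wc near_wc) => n n1n.
have [St [g [A [X0 [model track]]]]] := models n n1n.
have n0 : (0 < n)%N by exact: leq_trans n1n.
have [w01 c0] := wc n n1n.
exact: (switch_steady_state n0 (eps01 n0) w01 c0 model track).
Qed.

Let nat1_le_powR n (a : R) : (0 < n)%N -> 0 <= a -> 1 <= n%:R `^ a.
Proof.
move=> n0 a0; rewrite -[leLHS](powRr0 n%:R); apply: ler_powR => //.
by rewrite ler1n.
Qed.

Let nat_le_powR n (a : R) : (0 < n)%N -> 1 <= a -> n%:R <= n%:R `^ a.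
Proof.
move=> n0 a1; rewrite -[leLHS](powRr1 (ler0n R n)); apply: ler_powR => //.
by rewrite ler1n.
Qed.

Let powR_nat_le n (a b : R) : (0 < n)%N -> a <= b -> n%:R `^ a <= n%:R `^ b.
Proof. by move=> n0 ab; apply: ler_powR => //; rewrite ler1n. Qed.

Section GainClass.
Variables (W1 : nat -> R) (alpha1 : R).
Hypothesis cls : forall n, (0 < n)%N -> classPi1 (sw n) (const_mx n%:R^-1) (W1 n).
Hypothesis W1O : (fun n => ((W1 n)^-1)%R) =O_\oo (fun n : nat => n%:R `^ alpha1).

Let gain_model n (w : R) : (0 < n)%N -> w <= W1 n ->
  has_model (sw n) (eps n) w 0.
Proof.
move=> n0 wW; have [_ [St [X [g [[Xhist [p [mc irr aper]]] [qX gfin] wb]]]]] := cls n0.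
exists St, g, (kernel_op p gfin), (X 0%N).
apply: (chain_switch_model n0 (eps01 n0) (traffic n0) Xhist mc irr aper qX gfin wb) => q.
rewrite subr0 lerD//; last by rewrite ler_wpM2r// frob_norm_ge0.
rewrite /total mulr_suml; apply: ler_sum => i _; rewrite mulr_suml.
by apply: ler_sum => j _; rewrite !mxE.
Qed.

(** The gain is at most of order [n], so its inverse cannot decay faster than
[n^-1]. *)
Lemma gain_exponent_ge : - 1 <= alpha1.
Proof.
rewrite leNgt; apply/negP => alpha1_lt.
have [C C0 W1C] := bigO_powR_bound W1O.
have cvg0 : (fun n : nat => n%:R `^ (1 + alpha1) : R) @ \oo --> (0 : R).
  by apply: powR_nat_cvg0; lra.
have small : \forall n \near \oo, n%:R `^ (1 + alpha1) < (2 * C)^-1.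
  have Ci : 0 < (2 * C)^-1 by rewrite invr_gt0; lra.
  move/cvgrPdist_lt: cvg0 => /(_ _ Ci); apply: filterS => n.
  by rewrite sub0r normrN ger0_norm// powR_ge0.
have [n [[n2 nC] ns]] := filter_ex (filterI (filterI (nbhs_infty_gt 1%N) W1C) small).
have n0 : (0 < n)%N by exact: ltnW n2.
have nR : 0 < n%:R :> R by rewrite ltr0n.
have [W0 _] := cls n0.
have [St [g [A [X0 [model _]]]]] := gain_model n0 (lexx (W1 n)).
have lam01 : 0 < lam n < 1.
  have /andP[e0 e1] := eps01 n0.
  have n1 : 1 <= n%:R :> R by rewrite ler1n.
  by apply/andP; split; [rewrite divr_gt0// subr_gt0|rewrite ltr_pdivrMr//; lra].
have Wn := gain_le n2 lam01 model.
have : 1 <= 2 * C * n%:R `^ (1 + alpha1).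
  rewrite powRD; last by rewrite pnatr_eq0 -lt0n n0 implybT.
  have Wn0 : W1 n != 0 by rewrite gt_eqF.
  rewrite powRr1// -[leLHS](mulfV Wn0).
  apply: le_trans (_ : 2 * n%:R * (C * n%:R `^ alpha1) <= _); last by rewrite le_eqVlt; apply/orP; left; apply/eqP; ring.
  apply: ler_pM => //; [exact: ltW|by rewrite invr_ge0 ltW|].
  exact: le_trans (ler_norm _) nC.
apply/negP; rewrite -ltNge mulrC -ltr_pdivlMr ?div1r//; lra.
Qed.

Lemma heavy_traffic_Pi1 : 3 + alpha1 < beta -> heavy_traffic_limit 1 eps sw.
Proof.
move=> beta_gt; have alpha1_ge := gain_exponent_ge.
have [C C0 W1C] := bigO_powR_bound W1O.
apply: (@heavy_traffic_of_models 1 (fun n => Num.min (W1 n) 1) (fun=> 0)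
  (Num.max alpha1 0) 1 (C + 1)) => //.
- by rewrite le_max lexx orbT.
- by rewrite -addrA; case: (leP alpha1 0) => ?; lra.
- by lra.
- move=> n n0; have [W0 _] := cls n0; split => //.
  by rewrite lt_min W0 ltr01 ge_min lexx orbT.
- near=> n.
  have n0 : (0 < n)%N by near: n; exact: nbhs_infty_gt.
  have [W0 _] := cls n0.
  have WC : `|(W1 n)^-1| <= C * n%:R `^ alpha1 by near: n.
  have p1 : 1 <= n%:R `^ (Num.max alpha1 0) by apply: nat1_le_powR; rewrite // le_max lexx orbT.
  have pa : n%:R `^ alpha1 <= n%:R `^ (Num.max alpha1 0).
    by apply: powR_nat_le; rewrite // le_max lexx.
  split; last first.
    rewrite addr0 powRr1// ler_peMl//; lra.
  have WC' := le_trans (ler_norm _) WC.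
  case: (leP (W1 n) 1) => _; rewrite ?invr1; nra.
- by move=> n n0; apply: gain_model => //; rewrite ge_min lexx.
Unshelve. all: by end_near. Qed.

End GainClass.

(** Here [a = 4] and [b = 1]. *)
Lemma heavy_traffic_quartic_gain n1 : (0 < n1)%N -> 6 < beta ->
  (forall n, (n1 <= n)%N -> has_model (sw n) (eps n) (4 * n%:R ^+ 4)^-1 0) ->
  heavy_traffic_limit n1 eps sw.
Proof.
move=> n1_gt0 beta_gt models.
apply: (@heavy_traffic_of_models n1 (fun n => (4 * n%:R ^+ 4)^-1) (fun=> 0) 4 1 4) => //.
- by lra.
- by lra.
- move=> n n1n; have n0 : (0 < n)%N by exact: leq_trans n1n.
  have p1 : 1 <= n%:R ^+ 4 :> R by rewrite exprn_ege1// ler1n.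
  by split => //; rewrite invr_gt0 invf_le1; [apply/andP; split; lra|lra].
- near=> n; rewrite invrK addr0 powR_mulrn// powRr1//; split => //.
  by rewrite ler_peMl//; lra.
Unshelve. all: by end_near. Qed.

Lemma heavy_traffic_power_of_d d (ch : forall n, 'M[nat]_n -> seq 'S_n -> 'S_n) :
  (2 <= d)%N -> (forall n, (0 < n)%N -> is_heaviest_choice R (ch n)) ->
  (forall n, (0 < n)%N -> power_of_d (sw n) d (ch n)) -> 6 < beta ->
  heavy_traffic_limit 1 eps sw.
Proof.
move=> d2 chP pd beta_gt; apply: heavy_traffic_quartic_gain => // n n0.
apply: (sampled_switch_model n0 (eps01 n0) _ (traffic n0) _ (pd n n0)).
- by rewrite invr_ge0 mulr_ge0// exprn_ge0.
- by apply/card_gt0P; exists (nseq_tuple d 1%g).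
- by move=> q; rewrite [X in _ + X <= _]mulrC; apply: power_of_d_gap => //; exact: chP.
Qed.

Lemma heavy_traffic_random_flip d (ch : forall n, 'M[nat]_n -> seq 'S_n -> 'S_n) :
  (1 <= d)%N -> (forall n, (1 < n)%N -> is_heaviest_choice R (ch n)) ->
  (forall n, (1 < n)%N -> random_flip (sw n) d (ch n)) -> 6 < beta ->
  heavy_traffic_limit 2 eps sw.
Proof.
move=> d1 chP rf beta_gt; apply: heavy_traffic_quartic_gain => // n n1.
have n0 := ltnW n1.
apply: (sampled_switch_model n0 (eps01 n0) _ (traffic n0) _ (rf n n1)).
- by rewrite invr_ge0 mulr_ge0// exprn_ge0.
- have r01 : (Ordinal n0, Ordinal n1).1 != (Ordinal n0, Ordinal n1).2 by [].
  by apply/card_gt0P; exists (1%g, nseq_tuple d (exist _ (Ordinal n0, Ordinal n1) r01)).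
- by move=> q; rewrite [X in _ + X <= _]mulrC; apply: random_flip_gap => //; exact: chP.
Qed.

(** With gain [1 / n] one has [a = 1], so that the loss alone fixes the exponent. *)
Lemma heavy_traffic_near_maxweight (c : nat -> R) (C b : R) : 1 <= b -> 2 + b < beta -> 0 <= C ->
  (forall n, (0 < n)%N -> 0 <= c n) ->
  (\forall n \near \oo, c n <= C * n%:R `^ b) ->
  (forall n, (0 < n)%N -> has_model (sw n) (eps n) n%:R^-1 (c n)) ->
  heavy_traffic_limit 1 eps sw.
Proof.
move=> b1 beta_gt C0 c0 cC models.
apply: (@heavy_traffic_of_models 1 (fun n => n%:R^-1) c 1 b (C + 1)) => //.
- by lra.
- move=> n n0; split; last exact: c0.
  by rewrite invr_gt0 ltr0n n0 invf_le1 ?ler1n// ltr0n.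
- near=> n.
  have n0 : (0 < n)%N by near: n; exact: nbhs_infty_gt.
  have cn : c n <= C * n%:R `^ b by near: n.
  have nb := nat_le_powR n0 b1.
  rewrite invrK powRr1//; split; first by rewrite ler_peMl//; lra.
  by rewrite mulrDl mul1r addrC lerD.
Unshelve. all: by end_near. Qed.

Lemma heavy_traffic_Pi2 (W2 : nat -> R) (alpha2 : R) :
  (forall n, (0 < n)%N -> classPi2 (sw n) (W2 n)) ->
  W2 =O_\oo (fun n : nat => n%:R `^ alpha2) ->
  2 + Num.max alpha2 2 < beta -> heavy_traffic_limit 1 eps sw.
Proof.
move=> cls W2O beta_gt; have [C C0 W2C] := bigO_powR_bound W2O.
apply: (@heavy_traffic_near_maxweight W2 C (Num.max alpha2 2)) => //.
- by rewrite le_max; apply/orP; right; lra.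
- exact: ltW.
- by move=> n n0; have [] := cls n n0.
- near=> n.
  have n0 : (0 < n)%N by near: n; exact: nbhs_infty_gt.
  have WC : `|W2 n| <= C * n%:R `^ alpha2 by near: n.
  apply: le_trans (le_trans (ler_norm _) WC) _; rewrite ler_pM2l//.
  by apply: powR_nat_le; rewrite // le_max lexx.
- move=> n n0; have [_ [St [X [g [[Xhist [p [mc irr aper]]] [qX gfin] wb]]]]] := cls n n0.
  exists St, g, (kernel_op p gfin), (X 0%N).
  apply: (chain_switch_model n0 (eps01 n0) (traffic n0) Xhist mc irr aper qX gfin wb) => q.
  rewrite lerD2r mulrC -mulrDr mulrC ler_pdivrMr ?ltr0n// mulrC; exact: max_weight_gap.
Unshelve. all: by end_near. Qed.

(** An update every [m] slots, or a delay of [m] slots, costs [2 n m], of order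
[n ^ (1 + gamma)]. *)
Lemma heavy_traffic_outdated (m : nat -> nat) (gamma : R) :
  (fun n => (m n)%:R : R) =O_\oo (fun n : nat => n%:R `^ gamma) ->
  3 + Num.max gamma 1 < beta ->
  (forall n, (0 < n)%N -> has_model (sw n) (eps n) n%:R^-1 (2 * n%:R * (m n)%:R)) ->
  heavy_traffic_limit 1 eps sw.
Proof.
move=> mO beta_gt models; have [C C0 mC] := bigO_powR_bound mO.
apply: (@heavy_traffic_near_maxweight (fun n => 2 * n%:R * (m n)%:R) (2 * C)
  (1 + Num.max gamma 1)) => //.
- by rewrite lerDl le_max ler01 orbT.
- by lra.
- by lra.
- near=> n.
  have n0 : (0 < n)%N by near: n; exact: nbhs_infty_gt.
  have WC : `|(m n)%:R| <= C * n%:R `^ gamma by near: n.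
  rewrite powRD ?powRr1//; last by rewrite pnatr_eq0 -lt0n n0 implybT.
  rewrite mulrACA ler_pM2l; last by rewrite mulr_gt0// ltr0n.
  apply: le_trans (le_trans (ler_norm _) WC) _; rewrite ler_pM2l//.
  by apply: powR_nat_le; rewrite // le_max lexx.
Unshelve. all: by end_near. Qed.

End Cases.
Theorem theorem15 (R : realType) (beta : R) (eps : nat -> R)
  (beta_gt0 : 0 < beta)
  (eps01 : forall n, (0 < n)%N -> 0 < eps n < 1)
  (epsTheta : eps \is 'Theta_\oo (fun n : nat => n%:R `^ (- beta)))
  (sw : forall n, switch R n)
  (traffic : forall n, (0 < n)%N -> uniform_bernoulli (sw n) (eps n)) :
  (* (i) *)
  (forall (W1 : nat -> R) (alpha1 : R),
      (forall n, (0 < n)%N -> classPi1 (sw n) (const_mx n%:R^-1) (W1 n)) ->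
      (fun n => ((W1 n)^-1)%R) =O_\oo (fun n : nat => n%:R `^ alpha1) ->
      3 + alpha1 < beta ->
      heavy_traffic_limit 1 eps sw) /\
  (forall (d : nat) (ch : forall n, 'M[nat]_n -> seq 'S_n -> 'S_n),
      (2 <= d)%N ->
      (forall n, (0 < n)%N -> is_heaviest_choice R (ch n)) ->
      (forall n, (0 < n)%N -> power_of_d (sw n) d (ch n)) ->
      6 < beta ->
      heavy_traffic_limit 1 eps sw) /\
  (forall (d : nat) (ch : forall n, 'M[nat]_n -> seq 'S_n -> 'S_n),
      (1 <= d)%N ->
      (forall n, (1 < n)%N -> is_heaviest_choice R (ch n)) ->
      (forall n, (1 < n)%N -> random_flip (sw n) d (ch n)) ->
      6 < beta ->
      heavy_traffic_limit 2 eps sw) /\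
  (* (ii) *)
  (forall (W2 : nat -> R) (alpha2 : R),
      (forall n, (0 < n)%N -> classPi2 (sw n) (W2 n)) ->
      W2 =O_\oo (fun n : nat => n%:R `^ alpha2) ->
      2 + Num.max alpha2 2 < beta ->
      heavy_traffic_limit 1 eps sw) /\
  (forall (m : nat -> nat) (gamma : R) (mw : forall n, 'M[nat]_n -> 'S_n),
      (forall n, (0 < n)%N -> (0 < m n)%N) ->
      (fun n => (m n)%:R : R) =O_\oo (fun n : nat => n%:R `^ gamma) ->
      (forall n, (0 < n)%N -> is_maxweight_rule R (mw n)) ->
      (forall n, (0 < n)%N -> bursty_maxweight (sw n) (m n) (mw n)) ->
      3 + Num.max gamma 1 < beta ->
      heavy_traffic_limit 1 eps sw) /\
  (forall (m : nat -> nat) (gamma : R) (mw : forall n, 'M[nat]_n -> 'S_n),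
      (fun n => (m n)%:R : R) =O_\oo (fun n : nat => n%:R `^ gamma) ->
      (forall n, (0 < n)%N -> is_maxweight_rule R (mw n)) ->
      (forall n, (0 < n)%N -> pipelined_maxweight (sw n) (m n) (mw n)) ->
      3 + Num.max gamma 1 < beta ->
      heavy_traffic_limit 1 eps sw).
Proof.
split; first by move=> W1 alpha1; exact: heavy_traffic_Pi1.
split; first by move=> d ch; exact: heavy_traffic_power_of_d.
split; first by move=> d ch; exact: heavy_traffic_random_flip.
split; first by move=> W2 alpha2; exact: heavy_traffic_Pi2.
split=> m gamma mw.
  move=> m0 mO mwP pol beta_gt; apply: (heavy_traffic_outdated eps01 epsTheta mO beta_gt) => n n0.
  exact: (bursty_switch_model n0 (eps01 n n0) (traffic n n0) (mwP n n0) (m0 n n0) (pol n n0)).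
move=> mO mwP pol beta_gt; apply: (heavy_traffic_outdated eps01 epsTheta mO beta_gt) => n n0.
exact: (pipelined_switch_model n0 (eps01 n n0) (traffic n n0) (mwP n n0) (pol n n0)).
Qed.
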